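(* Let $((X_t,\sigma_t))_{t\in\mathbb Z}$ be the strictly stationary AGARCH$(p,q)$ process with true parameter $\theta_0=(\alpha_0^\circ,\alpha_1^\circ,\dots,\alpha_p^\circ,\beta_1^\circ,\dots,\beta_q^\circ,\gamma^\circ)^T$, such that 1. $\alpha_i^\circ>0$ for some $i\in\{1,\dots,p\}$ and $(\alpha_p^\circ,\beta_q^\circ)\ne(0,0)$; 2. the polynomials $a^\circ(z)=\sum_{i=1}^p\alpha_i^\circ z^i$ and $b^\circ(z)=1-\sum_{j=1}^q\beta_j^\circ z^j$ have no common zeros. Suppose the distribution of $Z_0$ is not concentrated at two points, and let $K\subset(0,\infty)\times[0,\infty)^p\times B\times[-1,1]$ be compact with $\theta_0\in K$, where $B=\{(\beta_1,\dots,\beta_q)^T\in[0,1)^q:\sum_{j=1}^q\beta_j<1\}$. Then the QMLE $\hat\theta_n$ is strongly consistent: $\hat\theta_n\to\theta_0$ a.s.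
   Context: $(Z_t)_{t\in\mathbb Z}$ i.i.d. with $\mathbb EZ_0=0$, $\mathbb EZ_0^2=1$, $\mathcal F_t=\sigma(Z_k:k\le t)$. AGARCH$(p,q)$ with parameter $(\alpha_0,\dots,\alpha_p,\beta_1,\dots,\beta_q,\gamma)$, $\alpha_0>0$, $\alpha_i,\beta_j\ge0$, $|\gamma|\le1$: $X_t=\sigma_tZ_t$, $\sigma_t^2=\alpha_0+\sum_{i=1}^p\alpha_i(|X_{t-i}|-\gamma X_{t-i})^2+\sum_{j=1}^q\beta_j\sigma_{t-j}^2$, $t\in\mathbb Z$, with $\sigma_t\ge0$ $\mathcal F_{t-1}$-measurable; the process in the claim is the unique strictly stationary solution for $\theta_0$. For $\theta=(\alpha_0,\dots,\alpha_p,\beta_1,\dots,\beta_q,\gamma)\in K$ and fixed initial values $\hat h_0(\theta)=\dots=\hat h_{-q+1}(\theta)$ given by the coordinates of a fixed vector in $[0,\infty)^q$, define recursively $\hat h_t(\theta)=\alpha_0+\sum_{i=1}^p\alpha_i(|X_{t-i}|-\gamma X_{t-i})^2+\sum_{j=1}^q\beta_j\hat h_{t-j}(\theta)$, $t\ge1$, using data $X_{-p+1},\dots,X_n$. $\hat L_n(\theta)=-\frac12\sum_{t=1}^n(X_t^2/\hat h_t(\theta)+\log\hat h_t(\theta))$, and the QMLE $\hat\theta_n$ maximizes $\hat L_n$ over $K$. *)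

(* Defs.v *)
From mathcomp Require Import all_boot all_order all_algebra.
From mathcomp Require Import all_classical all_reals all_analysis.
Import Order.TTheory GRing.Theory Num.Theory.
From mathcomp Require Import complex.
Import numFieldNormedType.Exports.

Set Implicit Arguments.
Unset Strict Implicit.
Unset Printing Implicit Defensive.

Local Open Scope classical_set_scope.
Local Open Scope ring_scope.

(** * Parameter vectors
   theta = (alpha_0, alpha_1, ..., alpha_p, beta_1, ..., beta_q, gamma)^T
   is a row vector with p + q + 2 = (p.+1 + q).+1 coordinates:
   coordinates 0..p are alpha_0..alpha_p, coordinates p+1..p+q are
   beta_1..beta_q and coordinate p+q+1 is gamma. *)
Notation param R p q := 'rV[R]_((p.+1 + q).+1).

Definition alph {R : realType} {p q : nat} (th : param R p q) (i : nat) : R :=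
  th 0 (inord i).

(** beta_j, for 1 <= j <= q (and 0 outside this range, e.g. beta_q = 0
    when q = 0) *)
Definition bet {R : realType} {p q : nat} (th : param R p q) (j : nat) : R :=
  if (0 < j <= q)%N then th 0 (inord (p + j)) else 0.

Definition gam {R : realType} {p q : nat} (th : param R p q) : R :=
  th 0 (inord (p + q).+1).

Definition param_space {R : realType} {p q : nat} : set (param R p q) :=
  [set th | [/\ 0 < alph th 0,
     (forall i, (1 <= i <= p)%N -> 0 <= alph th i),
     (forall j, (1 <= j <= q)%N -> 0 <= bet th j < 1),
     \sum_(1 <= j < q.+1) bet th j < 1 &
     -1 <= gam th <= 1]].

Definition apoly {R : realType} {p q : nat} (th : param R p q) : {poly R} :=
  \sum_(1 <= i < p.+1) (alph th i)%:P * 'X^i.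

Definition bpoly {R : realType} {p q : nat} (th : param R p q) : {poly R} :=
  1 - \sum_(1 <= j < q.+1) (bet th j)%:P * 'X^j.

Definition iid_seq {R : realType} {d : measure_display} {T : measurableType d}
    (P : probability T R) (Z : int -> T -> R) : Prop :=
  [/\ (forall t, measurable_fun setT (Z t)),
      (forall t (B : set R), measurable B ->
          P (Z t @^-1` B) = P (Z 0 @^-1` B)) &
      (forall (n : nat) (ts : nat -> int) (B : nat -> set R),
          (forall k l, (k < n)%N -> (l < n)%N -> ts k = ts l -> k = l) ->
          (forall k, measurable (B k)) ->
          P (\bigcap_(k in `I_n) (Z (ts k) @^-1` B k)) =
          (\prod_(k < n) P (Z (ts k) @^-1` B k))%E)].

Definition past_sigma {R : realType} {T : Type} (Z : int -> T -> R) (t : int)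
    : set (set T) :=
  <<s [set A | exists k : int, k <= t /\
        exists B : set R, measurable B /\ A = Z k @^-1` B] >>.

Definition measurable_wrt {R : realType} {T : Type} (F : set (set T))
    (f : T -> R) : Prop :=
  forall B : set R, measurable B -> F (f @^-1` B).

Definition agarch_solution {R : realType} {d : measure_display}
    {T : measurableType d} (P : probability T R) (p q : nat)
    (th : param R p q) (Z X S : int -> T -> R) : Prop :=
  forall t : int,
  [/\ (forall w, 0 <= S t w),
      measurable_wrt (past_sigma Z (t - 1)) (S t),
      (\forall w \ae P, X t w = S t w * Z t w) &
      (\forall w \ae P, S t w ^+ 2 =
          alph th 0
          + \sum_(1 <= i < p.+1)
               alph th i * (`|X (t - i%:Z) w| - gam th * X (t - i%:Z) w) ^+ 2
          + \sum_(1 <= j < q.+1) bet th j * S (t - j%:Z) w ^+ 2)].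

(** strict stationarity of the bivariate process (X_t, sigma_t): all finite
    dimensional distributions are shift invariant (checked on measurable
    rectangles, which determine them). *)
Definition strictly_stationary2 {R : realType} {d : measure_display}
    {T : measurableType d} (P : probability T R) (X S : int -> T -> R) : Prop :=
  forall (h : int) (n : nat) (ts : nat -> int) (A B : nat -> set R),
    (forall k, measurable (A k) /\ measurable (B k)) ->
    P (\bigcap_(k in `I_n) (X (ts k) @^-1` A k `&` S (ts k) @^-1` B k)) =
    P (\bigcap_(k in `I_n) (X (ts k + h) @^-1` A k `&` S (ts k + h) @^-1` B k)).

(** hs th x v t = [:: hhat_t; hhat_{t-1}; ...; hhat_1; hhat_0; ...; hhat_{-q+1}]
    where the initial values are hhat_{-k} = v k (k < q) and, for t >= 1,
    hhat_t = alpha_0 + sum_i alpha_i (|x_{t-i}| - gamma x_{t-i})^2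
             + sum_j beta_j hhat_{t-j}. *)
Fixpoint hs {R : realType} {p q : nat} (th : param R p q) (x : int -> R)
    (v : 'I_q -> R) (t : nat) : seq R :=
  match t with
  | 0 => [seq v j | j <- enum 'I_q]
  | t'.+1 =>
      (alph th 0
       + \sum_(1 <= i < p.+1)
            alph th i * (`|x (t'.+1%:Z - i%:Z)| - gam th * x (t'.+1%:Z - i%:Z)) ^+ 2
       + \sum_(1 <= j < q.+1) bet th j * nth 0 (hs th x v t') j.-1)
      :: hs th x v t'
  end.

Definition hhat {R : realType} {p q : nat} (th : param R p q) (x : int -> R)
    (v : 'I_q -> R) (t : nat) : R :=
  head 0 (hs th x v t).

Definition Lhat {R : realType} {p q : nat} (th : param R p q) (x : int -> R)
    (v : 'I_q -> R) (n : nat) : R :=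
  - (2^-1) * \sum_(1 <= t < n.+1)
      (x t%:Z ^+ 2 / hhat th x v t + ln (hhat th x v t)).

(* Main.v *)
(* Everything is transported to the law of the innovations on the path space [int -> R],
   where [sigma_t ^ 2] is the minimal solution of a linear recursion with i.i.d. random
   coefficients. Comparing two solutions, and a fractional moment of the minimal one,
   show that the given stationary solution is this one and grows subexponentially.

   Given [theta <> theta0], let [h] be the volatility computed with [theta] from the
   infinite past. As [z ^ 2] has mean [1] and is independent of [h] and [sigma ^ 2], the mean
   of [X ^ 2 / h + ln h - z ^ 2 - ln (sigma ^ 2)] is that of
   [sigma ^ 2 / h + ln h - 1 - ln (sigma ^ 2)], which is nonnegative and vanishes only if
   [h = sigma ^ 2] almost surely. In that case, applying the lag polynomials of [theta0]
   and [theta] crosswise gives a finite linear relation between the squared positive and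
   negative parts of the returns; resampling one innovation at a time shows, since it
   does not take just two values, that all the coefficients vanish, so [theta = theta0] by
   coprimality.

   For nearby parameters, [h] lies between its values at two extreme parameters, and the
   recursively computed volatility differs from it by a geometrically small error. Hence
   by ergodicity the likelihood at [theta0] eventually exceeds those on a neighbourhood
   of [theta], and compactness yields consistency. *)
Require Import Defs.
From HB Require Import structures.
From mathcomp Require Import all_boot all_order all_algebra.
From mathcomp Require Import all_classical all_reals all_analysis.
From mathcomp Require Import measurable_realfun ring lra zify.
Import Order.TTheory GRing.Theory Num.Theory.
From mathcomp Require Import complex.
Import numFieldNormedType.Exports.

Set Implicit Arguments.
Unset Strict Implicit.
Unset Printing Implicit Defensive.

Local Open Scope classical_set_scope.
Local Open Scope ring_scope.

(** * Laws of i.i.d. paths *)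

(** Moments are scarce: stationarity provides no mean for [sigma_t ^ 2], and none is available for
    [sigma ^ 2 / h] or [ln h] at other parameters. No law of large numbers is therefore applied to
    the likelihood. A one-sided ergodic statement takes its place: sums of a function of positive
    mean along a shift are bounded below. It serves twice, for the likelihood gap with its unbounded
    terms truncated, and for the fractional moment itself. There, unrolling the recursion expresses
    [sigma_t ^ 2] through weights of paths of lags; the proportion of the remaining tail lost over
    each block of lags has positive mean, so the weights decay exponentially. Very small powers of
    them then have small means, and the recursion contracts in fractional mean. On the path space
    the shift acts on every path, and the minimal solution is a supremum with a default value, so
    that shift identities and dependence on the past hold everywhere. Independence is expressed by
    gluing two paths and integrating over one of them. *)

Definition int_of_code (k : nat) : int :=
  if odd k then Negz k./2 else Posz k./2.

Lemma int_of_code_inj : injective int_of_code.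
Proof.
move=> a b; rewrite /int_of_code => h.
rewrite -(odd_double_half a) -(odd_double_half b).
by case: (odd a) (odd b) h => -[] // [->].
Qed.

Lemma int_of_code_surj (t : int) : exists k, int_of_code k = t.
Proof.
case: t => n; [exists n.*2 | exists n.*2.+1]; rewrite /int_of_code /=.
  by rewrite odd_double doubleK.
by rewrite odd_double /= uphalf_double.
Qed.

(** Initial segments of one enumeration of the times, instead of arbitrary finite sets of times,
    make these events stable under intersection: the shorter list of constraints is padded with
    [setT]. *)
Definition cylinders {R : realType} : set (set (int -> R)) :=
  [set C | exists (n : nat) (B : nat -> set R), (forall k, measurable (B k)) /\
     C = [set z | forall k, (k < n)%N -> B k (z (int_of_code k))]].

Definition paths (R : realType) : Type := int -> R.

HB.instance Definition _ (R : realType) :=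
  Measurable.copy (paths R) (g_sigma_algebraType (@cylinders R)).

Section paths.
Context {R : realType}.

Lemma setI_closed_cylinders : setI_closed (@cylinders R).
Proof.
move=> _ _ [n [B [mB ->]]] [n' [B' [mB' ->]]].
exists (maxn n n'), (fun k => (if (k < n)%N then B k else setT) `&`
                      (if (k < n')%N then B' k else setT)); split.
  by move=> k; apply: measurableI; case: ifP.
apply/seteqP; split=> [z /= [h h'] k _|z /= h].
  by split; case: ifP => // kn; [exact: h|exact: h'].
split=> k kn; have := h k; rewrite leq_max kn ?orbT => /(_ isT) [//].
Qed.

Lemma cylinder_setT : @cylinders R setT.
Proof.
exists 0%N, (fun=> setT); split => //.
by apply/seteqP; split.
Qed.

Lemma measurable_cylinder (C : set (paths R)) : cylinders C -> measurable C.
Proof. exact: sub_sigma_algebra. Qed.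

Lemma measurable_coord (t : int) :
  measurable_fun [set: paths R] (fun z : paths R => z t).
Proof.
move=> _ B mB; rewrite setTI.
have [k <-] := int_of_code_surj t.
apply: sub_sigma_algebra.
exists k.+1, (fun i => if i == k then B else setT); split.
  by move=> i; case: ifP.
apply/seteqP; split=> [z /= h i _|z /= /(_ k (ltnSn _))].
  by case: eqP => // ->.
by rewrite eqxx.
Qed.

Lemma measurable_fun_path d (T : measurableType d) (f : T -> paths R) :
  (forall t, measurable_fun setT (fun x => f x t)) -> measurable_fun setT f.
Proof.
move=> mf; apply: (@measurability _ _ T (paths R) setT f (@cylinders R)) => //.
move=> _ [_ [n [B [mB ->]]] <-].
rewrite setTI (_ : _ @^-1` _ =
   \bigcap_(k in `I_n) ((fun x => f x (int_of_code k)) @^-1` B k)) //.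
apply: bigcap_measurableType => k _.
by rewrite -[X in measurable X]setTI; exact: mf.
Qed.

Lemma path_measure_unique (m1 m2 : {measure set (paths R) -> \bar R}) :
  (m1 setT < +oo)%E -> (forall C, cylinders C -> m1 C = m2 C) ->
  forall A, measurable A -> m1 A = m2 A.
Proof.
move=> fin12 m12 A mA.
apply: (@measure_unique _ R (paths R) (@cylinders R) (fun=> setT)) => //.
- exact: setI_closed_cylinders.
- by move=> _; exact: cylinder_setT.
- by rewrite bigcup_const //; exists 0%N.
Qed.

Definition time_shift (s : int) (z : paths R) : paths R :=
  fun t => z (t + s).

Lemma time_shiftD s t z : time_shift s (time_shift t z) = time_shift (s + t) z.
Proof. by apply/funext => u; rewrite /time_shift addrA. Qed.

Lemma time_shift0 z : time_shift 0 z = z.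
Proof. by apply/funext => u; rewrite /time_shift addr0. Qed.

Lemma measurable_time_shift s : measurable_fun setT (time_shift s).
Proof. by apply: measurable_fun_path => t; exact: measurable_coord. Qed.

(** Two independent paths glued along [I] have the law of one path. Integrating over the second path
    thus plays the role of a conditional expectation given the innovations at the times in [I]. *)
Definition splice (I : pred int) (zz : paths R * paths R)
  : paths R := fun t => if I t then zz.1 t else zz.2 t.

Lemma measurable_splice I : measurable_fun setT (splice I).
Proof.
apply: measurable_fun_path => t; rewrite /splice; case: (I t).
  exact: (measurableT_comp (measurable_coord t) measurable_fst).
exact: (measurableT_comp (measurable_coord t) measurable_snd).
Qed.

End paths.

Section iid_law.
Context {R : realType} (mu : probability (paths R) R).
Hypothesis iidmu : iid_seq mu (fun t z => z t).
Local Open Scope ereal_scope.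

Lemma iid_cylinder (n : nat) (ts : nat -> int) (B : nat -> set R) :
  (forall k l, (k < n)%N -> (l < n)%N -> ts k = ts l -> k = l) ->
  (forall k, measurable (B k)) ->
  mu [set z | forall k, (k < n)%N -> B k (z (ts k))] =
  \prod_(k < n) mu [set z | B k (z 0%R)].
Proof.
case: iidmu => _ same ind inj mB.
rewrite (_ : [set z | _] =
   \bigcap_(k in `I_n) ((fun z : paths R => z (ts k)) @^-1` B k)) //.
rewrite ind//; apply: eq_bigr => i _.
exact: same.
Qed.

Lemma shift_invariant s A : measurable A -> mu (time_shift s @^-1` A) = mu A.
Proof.
move=> mA.
have h := @path_measure_unique R (pushforward mu (time_shift s)) mu.
apply: (h (measurable_time_shift s) _ _ A mA).
  rewrite /= /pushforward preimage_setT.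
  by apply: (@le_lt_trans _ _ 1%E); [exact: probability_le1|exact: ltry].
move=> _ [n [B [mB ->]]].
rewrite /= /pushforward iid_cylinder//; last first.
  by move=> k l _ _ /addIr /int_of_code_inj.
by rewrite iid_cylinder// => k l _ _ /int_of_code_inj.
Qed.

Lemma splice_invariant I A : measurable A ->
  (mu \x mu) (splice I @^-1` A) = mu A.
Proof.
move=> mA.
have h := @path_measure_unique R (pushforward (mu \x mu) (splice I)) mu.
apply: (h (measurable_splice I) _ _ A mA).
  rewrite /= /pushforward preimage_setT.
  exact: le_lt_trans (probability_le1 _ measurableT) (ltry _).
move=> _ [n [B [mB ->]]].
rewrite /= /pushforward.
pose B1 k := if I (int_of_code k) then B k else setT.
pose B2 k := if I (int_of_code k) then setT else B k.
have mB1 k : measurable (B1 k) by rewrite /B1; case: ifP.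
have mB2 k : measurable (B2 k) by rewrite /B2; case: ifP.
pose C (B : nat -> set R) : set (paths R) :=
  [set z | forall k, (k < n)%N -> B k (z (int_of_code k))].
have mC B' : (forall k, measurable (B' k)) -> measurable (C B').
  by move=> mB'; apply: sub_sigma_algebra; exists n, B'.
have inj : forall k l, (k < n)%N -> (l < n)%N ->
    int_of_code k = int_of_code l -> k = l.
  by move=> k l _ _; exact: int_of_code_inj.
rewrite (_ : _ @^-1` _ = C B1 `*` C B2); last first.
  apply/seteqP; split=> [[z z']|[z z']]; rewrite /splice /C /B1 /B2 /=.
    by move=> H; split=> k kn; have := H k kn; case: ifP.
  by move=> [H1 H2] k kn; have := H1 k kn; have := H2 k kn; case: ifP.
rewrite product_measure1E; [|exact: mC|exact: mC].
have E B' : (forall k, measurable (B' k)) ->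
    mu (C B') = \prod_(k < n) mu [set z | B' k (z 0%R)].
  by move=> mB'; exact: iid_cylinder.
transitivity ((\prod_(k < n) mu [set z | B1 k (z 0%R)]) *
              (\prod_(k < n) mu [set z | B2 k (z 0%R)])).
  by congr (_ * _); exact: E.
transitivity (\prod_(k < n) mu [set z | B k (z 0%R)]); last exact/esym/E.
rewrite -[LHS]big_split/=; apply: eq_bigr => k _.
rewrite /B1 /B2; case: (I _).
  by rewrite (_ : [set z | setT _] = setT)// probability_setT mule1.
by rewrite (_ : [set z | setT _] = setT)// probability_setT mul1e.
Qed.

Lemma ge0_integral_shift s (f : paths R -> \bar R) :
  measurable_fun [set: paths R] f -> (forall z, 0 <= f z) ->
  \int[mu]_z f (time_shift s z) = \int[mu]_z f z.
Proof.
move=> mf f0.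
rewrite -(ge0_integral_pushforward (measurable_time_shift s) mu measurableT mf)//.
apply: eq_measure_integral; first exact: measurable_time_shift.
by move=> m A mA _; exact: shift_invariant.
Qed.

Lemma integrable_shift s (f : paths R -> \bar R) :
  mu.-integrable setT f -> mu.-integrable setT (f \o time_shift s).
Proof.
move=> /integrableP[mf intf]; apply/integrableP; split.
  by apply: measurableT_comp => //; exact: measurable_time_shift.
rewrite (ge0_integral_shift s (f := fun z => `|f z|))//.
exact: measurableT_comp.
Qed.

Lemma integral_shift s (f : paths R -> \bar R) :
  mu.-integrable setT f ->
  \int[mu]_z f (time_shift s z) = \int[mu]_z f z.
Proof.
move=> intf; have mf := measurable_int _ intf.
rewrite integralE [RHS]integralE; congr (_ - _).
  rewrite -(ge0_integral_shift s (measurable_funepos mf))//.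
  by apply: eq_integral => z _; rewrite !funeposE.
rewrite -(ge0_integral_shift s (measurable_funeneg mf))//.
by apply: eq_integral => z _; rewrite !funenegE.
Qed.

Lemma ge0_integral_splice I (f : paths R -> \bar R) :
  measurable_fun [set: paths R] f -> (forall z, 0 <= f z) ->
  \int[mu]_z f z = \int[mu]_z \int[mu]_z' f (splice I (z, z')).
Proof.
move=> mf f0.
rewrite -(@fubini_tonelli1 _ _ _ _ R mu mu (f \o splice I)); last 2 first.
- exact: (measurableT_comp mf (measurable_splice I)).
- by move=> z; exact: f0.
rewrite -(ge0_integral_pushforward (measurable_splice I) (mu \x mu) measurableT mf)//.
apply: eq_measure_integral; first exact: measurable_splice.
by move=> m A mA _; exact/esym/splice_invariant.
Qed.

Lemma ae_shift s (Q : paths R -> Prop) :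
  (\forall z \ae mu, Q z) -> \forall z \ae mu, Q (time_shift s z).
Proof.
move=> [N [mN N0 QN]]; exists (time_shift s @^-1` N); split.
- by rewrite -[X in measurable X]setTI; exact: measurable_time_shift.
- by rewrite shift_invariant.
- by move=> z /= nQ; exact: QN.
Qed.

Lemma ae_splice I (Q : paths R -> Prop) :
  (\forall z \ae mu, Q z) ->
  \forall z \ae mu, \forall z' \ae mu, Q (splice I (z, z')).
Proof.
move=> [N [mN N0 QN]].
have mgN : measurable (splice I @^-1` N).
  by rewrite -[X in measurable X]setTI; exact: measurable_splice.
have h : \int[mu]_z mu (xsection (splice I @^-1` N) z) = 0.
  by have := splice_invariant I mN; rewrite N0 => <-.
have mx : measurable_fun [set: paths R]
    (fun z => mu (xsection (splice I @^-1` N) z)).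
  exact: measurable_fun_xsection.
have : ae_eq mu setT (fun z => mu (xsection (splice I @^-1` N) z)) (cst 0).
  apply/(ae_eq_integral_abs mu measurableT mx).
  by rewrite -[RHS]h; apply: eq_integral => z _; rewrite gee0_abs.
apply: filterS => z /(_ Logic.I) /= Nz.
exists (xsection (splice I @^-1` N) z); split => //.
  exact: measurable_xsection.
by move=> z' /= nQ; rewrite /xsection /= inE; exact: QN.
Qed.

(** Required on every path and not up to null sets, so that it can be used by substitution in a
    spliced path. *)
Definition depends_on {U : Type} (I : pred int) (f : paths R -> U) :=
  forall z z', (forall t, I t -> z t = z' t) -> f z = f z'.

(** Along a path spliced at [I], [f] sees only the first path and [g] only the second, so the double
    integral factorizes. *)
Lemma ge0_integralM_indep I (f g : paths R -> \bar R) :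
  measurable_fun [set: paths R] f -> measurable_fun [set: paths R] g ->
  (forall z, 0 <= f z) -> (forall z, 0 <= g z) ->
  depends_on I f -> depends_on (predC I) g ->
  \int[mu]_z (f z * g z) = \int[mu]_z f z * \int[mu]_z g z.
Proof.
move=> mf mg f0 g0 df dg.
rewrite (ge0_integral_splice I); last 2 first.
- exact: emeasurable_funM.
- by move=> z; exact: mule_ge0.
rewrite -ge0_integralZr//; last exact: integral_ge0.
apply: eq_integral => z _.
rewrite -ge0_integralZl//.
apply: eq_integral => z' _; congr (_ * _).
  by apply: df => t It; rewrite /splice It.
by apply: dg => t; rewrite /splice /= => /negbTE ->.
Qed.

End iid_law.

(** * Ergodicity *)

Section ergodicity.
Context {R : realType} (mu : probability (paths R) R).
Hypothesis iidmu : iid_seq mu (fun t z => z t).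

Let m (A : set (paths R)) : R := fine (mu A).

Let mE A : measurable A -> mu A = (m A)%:E.
Proof. by move=> mA; rewrite /m fineK// fin_num_measure. Qed.

Let mD A B : measurable A -> measurable B -> A `<=` B -> m (B `\` A) = m B - m A.
Proof.
move=> mA mB AB; rewrite /m measureD//; last first.
  by apply: le_lt_trans (probability_le1 mu mB) (ltry _).
by rewrite setIidr// fineB// fin_num_measure.
Qed.

Let m_mono A B : measurable A -> measurable B -> A `<=` B -> m A <= m B.
Proof.
move=> mA mB AB; apply: fine_le; rewrite ?fin_num_measure//.
by apply: le_measure; rewrite ?inE.
Qed.

Let m_ge0 A : 0 <= m A. Proof. exact/fine_ge0/measure_ge0. Qed.

Let m_nd_approx (F : (set (paths R))^nat) :
  (forall k, measurable (F k)) -> nondecreasing_seq F ->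
  forall e : R, 0 < e -> exists k, m (\bigcup_n F n) - m (F k) <= e.
Proof.
move=> mF ndF e e0.
have mU : measurable (\bigcup_n F n) by exact: bigcupT_measurable.
have h : (mu \o F) x @[x --> \oo] --> mu (\bigcup_n F n).
  exact: nondecreasing_cvg_mu.
have {}h : m (F x) @[x --> \oo] --> m (\bigcup_n F n).
  by apply: (fine_cvg (f := mu \o F)); rewrite -mE.
have /cvgrPdist_le/(_ e e0)[k _ /(_ k (leqnn k)) hk] := h.
by exists k; apply: le_trans hk; exact: ler_norm.
Qed.

(* [C] is eventually shifted away from the coordinates determining [A], which makes the
   two events independent; the general case is a monotone class argument. *)
Lemma mixing (N : int) (C A : set (paths R)) :
  N != 0 -> cylinders C -> measurable A ->
  forall e : R, 0 < e -> exists n0, forall n, (n0 <= n)%N ->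
    `|m (A `&` time_shift (N * n%:Z) @^-1` C) - m A * m C| <= e.
Proof.
move=> N0 cC mA.
have mC : measurable C by exact: measurable_cylinder.
pose Cn (n : nat) := time_shift (N * n%:Z) @^-1` C.
have mCn n : measurable (Cn n).
  by rewrite /Cn -[X in measurable X]setTI; exact: measurable_time_shift.
have mCnE n : m (Cn n) = m C by rewrite /m /Cn shift_invariant.
pose H : set (set (paths R)) := [set A | measurable A /\
  forall e : R, 0 < e -> exists n0, forall n, (n0 <= n)%N ->
    `|m (A `&` Cn n) - m A * m C| <= e].
suff : <<s cylinders >> `<=` H by move=> /(_ A mA)[].
apply: lambda_system_subset => //; first exact: setI_closed_cylinders.
- split => //.
  + split => // e e0; exists 0%N => n _.
    by rewrite setTI mCnE /m probability_setT/= mul1r subrr normr0 ltW.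
  + move=> B E EB [mB hB] [mE' hE]; split; first exact: measurableD.
    move=> e e0; have e20 : 0 < e / 2 by rewrite divr_gt0.
    have [n1 h1] := hB _ e20; have [n2 h2] := hE _ e20.
    exists (maxn n1 n2) => n; rewrite geq_max => /andP[/h1 {}h1 /h2 {}h2].
    rewrite (_ : (B `\` E) `&` Cn n = (B `&` Cn n) `\` (E `&` Cn n)); last first.
      apply/seteqP; split=> [z [[Bz Ez] Cz]|z [[Bz Cz] nEC]].
        by split => // -[].
      by split => //; split => // Ez; apply: nEC.
    rewrite !mD//; [|exact: measurableI|exact: measurableI|exact: setSI].
    rewrite (_ : _ - _ = (m (B `&` Cn n) - m B * m C) - (m (E `&` Cn n) - m E * m C));
      last by rewrite mulrBl; ring.
    apply: le_trans (ler_normB _ _) _.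
    by rewrite [leRHS]splitr lerD.
  + change (forall F : nat -> set (paths R), nondecreasing_seq F ->
      (forall k, H (F k)) -> H (\bigcup_n F n)) => F ndF hF.
    have mF k : measurable (F k) by case: (hF k).
    have mU : measurable (\bigcup_n F n) by exact: bigcupT_measurable.
    split => // e e0; have e30 : 0 < e / 3 by rewrite divr_gt0.
    have [k hk] := m_nd_approx mF ndF e30.
    have [_ /(_ _ e30) [n0 hn0]] := hF k.
    exists n0 => n /hn0 {}hn0.
    have FU : F k `<=` \bigcup_n F n by exact: bigcup_sup.
    have d0 : 0 <= m (\bigcup_n F n) - m (F k) by rewrite subr_ge0 m_mono.
    have h1 : `|m ((\bigcup_n F n) `&` Cn n) - m (F k `&` Cn n)| <= e / 3.
      apply: le_trans hk; rewrite -!mD//; [|exact: measurableI|exact: measurableI|exact: setSI].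
      rewrite ger0_norm//; apply: m_mono.
      * by apply: measurableD; exact: measurableI.
      * exact: measurableD.
      * by move=> z [[Uz Cz] nF]; split => // Fz; apply: nF.
    have h2 : `|m (F k) * m C - m (\bigcup_n F n) * m C| <= e / 3.
      rewrite -mulrBl normrM distrC (ger0_norm d0) (ger0_norm (m_ge0 _)).
      apply: le_trans hk; rewrite ler_piMr//.
      by rewrite -lee_fin -mE// probability_le1.
    rewrite (_ : _ - _ = (m ((\bigcup_n F n) `&` Cn n) - m (F k `&` Cn n)) +
      (m (F k `&` Cn n) - m (F k) * m C) + (m (F k) * m C - m (\bigcup_n F n) * m C));
      last by ring.
    apply: le_trans (ler_normD _ _) _.
    rewrite (_ : e = e / 3 + e / 3 + e / 3); last by field.
    by rewrite lerD//; apply: le_trans (ler_normD _ _) _; rewrite lerD.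
- move=> D cD; have mDD := measurable_cylinder cD.
  split=> // e e0.
  case: cC mC => n1 [B1 [mB1 CE]] mC; case: cD => n2 [B2 [mB2 DE]].
  (* [L] bounds the absolute values of all times in both cylinders, so a shift by more than [2 * L]
     makes their sets of times disjoint. *)
  pose L := (\sum_(k < maxn n1 n2) `|int_of_code k|)%N.
  have hL k : (k < maxn n1 n2)%N -> (`|int_of_code k| <= L)%N.
    by move=> kn; rewrite /L (bigD1 (Ordinal kn))//= leq_addr.
  exists (2 * L).+1 => n hn.
  pose ts k := if (k < n2)%N then int_of_code k
               else int_of_code (k - n2) + N * n%:Z.
  pose B k := if (k < n2)%N then B2 k else B1 (k - n2)%N.
  have mB k : measurable (B k) by rewrite /B; case: ifP.
  have Nn (x y : int) : (`|x| <= L)%N -> (`|y| <= L)%N -> x != y + N * n%:Z.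
    move=> hx hy; apply/eqP => xy.
    have : (n <= `|(N * n%:Z)%R|)%N by rewrite abszM leq_pmull// absz_gt0.
    have -> : N * n%:Z = x - y by rewrite xy addrC addKr.
    by lia.
  have := @iid_cylinder _ _ iidmu (n2 + n1) ts B _ mB.
  have -> : [set z | forall k, (k < n2 + n1)%N -> B k (z (ts k))] = D `&` Cn n.
    rewrite DE /Cn CE; apply/seteqP; split=> z /=.
      move=> h; split=> k kn.
        by have := h k; rewrite /B /ts kn; apply; rewrite ltn_addr.
      have := h (n2 + k)%N; rewrite ltn_add2l => /(_ kn).
      by rewrite /B /ts ltnNge leq_addr /= addKn.
    move=> [h1 h2] k kn; rewrite /B /ts; case: ifPn => [/h1//|]; rewrite -leqNgt => nk.
    by apply: h2; rewrite ltn_subLR.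
  move=> EDC; suff -> : m (D `&` Cn n) = m D * m C by rewrite subrr normr0 ltW.
  rewrite -fineM ?fin_num_measure//.
  rewrite /m; congr fine; rewrite EDC.
    rewrite big_split_ord/=; congr (_ * _)%E.
      rewrite DE iid_cylinder//; last by move=> k l _ _ /int_of_code_inj.
      by apply: eq_bigr => k _; rewrite /B ltn_ord.
    rewrite CE iid_cylinder//; last by move=> k l _ _ /int_of_code_inj.
    by apply: eq_bigr => k _; rewrite /B ltnNge leq_addr /= addKn.
  move=> k l hk hl; rewrite /ts.
    case: ifPn => kn2; case: ifPn => ln2.
    - exact: int_of_code_inj.
    - move=> /eqP; rewrite (negbTE (Nn _ _ _ _))//; apply: hL; lia.
    - move=> /esym/eqP; rewrite (negbTE (Nn _ _ _ _))//; apply: hL; lia.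
    - move=> /addIr/int_of_code_inj; lia.
Qed.

(** By invariance, [A] meets a far shift of [C] with the same probability as it meets [C], so mixing
    makes [A] independent of all cylinders, hence of itself. All nonzero steps [N] are covered
    because the lag expansions move backwards in blocks. *)
Lemma zero_one (N : int) (A : set (paths R)) :
  N != 0 -> measurable A -> time_shift N @^-1` A = A -> mu A = 0 \/ mu A = 1%E.
Proof.
move=> N0 mA AE.
have An n : time_shift (N * n%:Z) @^-1` A = A.
  elim: n => [|n ih].
    by apply/seteqP; split=> z; rewrite /preimage /= mulr0 time_shift0.
  rewrite -[RHS]ih -{2}AE; apply/seteqP; split=> z;
    by rewrite /preimage /= time_shiftD -(addn1 n) PoszD mulrDr mulr1 addrC.
have ind C : cylinders C -> m (A `&` C) = m A * m C.
  move=> cC; have mC := measurable_cylinder cC.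
  apply/eqP; rewrite -subr_eq0 -normr_le0; apply/ler_addgt0Pl => e e0; rewrite addr0.
  have [n /(_ n (leqnn n))] := mixing N0 cC mA e0.
  rewrite -{1}(An n) -preimage_setI {1}/m shift_invariant//.
  exact: measurableI.
have a0 : 0 <= m A by [].
pose m1 := mrestr mu mA.
pose m2 := mscale (NngNum a0) mu.
have : m1 A = m2 A.
  apply: (path_measure_unique (m1 := m1) (m2 := m2)) => //.
    have /= := probability_le1 mu mA.
    rewrite -[X in mu X]setTI => h; exact: le_lt_trans h (ltry _).
  move=> C cC; have mC := measurable_cylinder cC.
  change (mu (C `&` A) = ((m A)%:E * mu C)%E).
  rewrite setIC mE; last exact: measurableI.
  by rewrite ind// (mE mC) EFinM.
change (mu (A `&` A) = ((m A)%:E * mu A)%E -> mu A = 0 \/ mu A = 1%E).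
rewrite setIid !mE// => -[/eqP].
rewrite -subr_eq0 -[X in X - _]mulr1 -mulrBr mulf_eq0 subr_eq0 => /orP[/eqP->|/eqP <-].
  by left.
by right.
Qed.

Section maximal.
Variables (N : int) (g : paths R -> R).
Hypothesis intg : mu.-integrable setT (EFin \o g).

(* [max_sum n z] is the largest of the partial sums of length at most [n]. *)
Fixpoint max_sum (n : nat) (z : paths R) : R :=
  if n is n'.+1 then Num.max 0 (g z + max_sum n' (time_shift N z)) else 0.

Let mg : measurable_fun setT g.
Proof. by apply/measurable_EFinP; exact: measurable_int intg. Qed.

Lemma measurable_max_sum n : measurable_fun setT (max_sum n).
Proof.
elim: n => [|n ih] /=; first exact: measurable_cst.
apply: measurable_maxr => //; apply: measurable_funD; first exact: mg.
exact: (measurableT_comp ih (measurable_time_shift N)).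
Qed.

Lemma max_sum_ge0 n z : 0 <= max_sum n z.
Proof. by case: n => //= n; rewrite le_max lexx. Qed.

Lemma max_sumS n z : max_sum n z <= max_sum n.+1 z.
Proof.
elim: n z => [|n ih] z; first exact: max_sum_ge0.
rewrite /= ge_max le_max lexx /= le_max; apply/orP; right.
by rewrite lerD2l; exact: ih.
Qed.

Lemma sum_le_max_sum n z :
  \sum_(k < n) g (time_shift (N * k%:Z) z) <= max_sum n z.
Proof.
elim: n z => [|n ih] z; first by rewrite big_ord0.
rewrite big_ord_recl /= mulr0 time_shift0 le_max; apply/orP; right.
rewrite lerD2l; apply: le_trans (ih _); apply: ler_sum => k _.
by rewrite time_shiftD /bump leq0n addnC PoszD mulrDr mulr1.
Qed.

Lemma integrable_max_sum n : mu.-integrable setT (EFin \o max_sum n).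
Proof.
elim: n => [|n ih].
  have -> : EFin \o max_sum 0 = cst 0%E by [].
  exact: integrable0.
have ih' : mu.-integrable setT (EFin \o (max_sum n \o time_shift N)).
  exact: (integrable_shift iidmu N ih).
apply: (@le_integrable _ _ _ mu setT _ _
   ((EFin \o g) \+ (EFin \o (max_sum n \o time_shift N)))) => //.
- by apply/measurable_EFinP; exact: measurable_max_sum.
- move=> z _ /=; rewrite lee_fin.
  by case: (leP 0 (g z + _)) => _; rewrite ?normr0.
- exact: integrableD.
Qed.

(* On the event [0 < max_sum n.+1] one has [max_sum n.+1 = g + max_sum n o shift]. *)
Lemma maximal_ergodic n :
  (0 <= \int[mu]_z (g z * \1_[set z | 0 < max_sum n.+1 z] z)%:E)%E.
Proof.
have mset : measurable [set z | 0 < max_sum n.+1 z].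
  rewrite -[X in measurable X]setTI.
  have := measurable_max_sum n.+1.
  by move=> /(_ measurableT _ (measurable_itv `]0, +oo[)); rewrite set_itvE.
have int1 : mu.-integrable setT
    (fun z => (g z * \1_[set z | 0 < max_sum n.+1 z] z)%:E).
  apply: (@le_integrable _ _ _ mu setT _ _ (EFin \o g)) => //.
    apply/measurable_EFinP/measurable_funM; first exact: mg.
    exact: measurable_indic.
  move=> z _ /=; rewrite lee_fin normrM ler_piMr//.
  by rewrite indicE; case: (_ \in _); rewrite ?normr1 ?normr0.
have int2 := integrable_max_sum n.+1.
have int3 : mu.-integrable setT (EFin \o (max_sum n \o time_shift N)).
  exact: (integrable_shift iidmu N (integrable_max_sum n)).
have h : (\int[mu]_z ((EFin \o max_sum n.+1) \- (EFin \o (max_sum n \o time_shift N)))%E z <=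
   \int[mu]_z (g z * \1_[set z | (0 < max_sum n.+1 z)%R] z)%:E)%E.
  apply: le_integral => //; first exact: integrableB.
  move=> z _; rewrite lee_fin indicE.
  have m0 := max_sum_ge0 n (time_shift N z).
  have -> : (z \in [set z | 0 < max_sum n.+1 z]) = (0 < max_sum n.+1 z).
    by apply/idP/idP; rewrite inE.
  rewrite /=; case: (ltP 0 (g z + _)) => h.
    by rewrite h mulr1 addrK.
  by rewrite ltxx mulr0 sub0r oppr_le0.
apply: le_trans h; rewrite integralB//.
rewrite (integral_shift iidmu N (integrable_max_sum n)).
rewrite sube_ge0; last first.
  by rewrite (integrable_fin_num measurableT int2) ?orbT.
apply: le_integral => //; first exact: integrable_max_sum.
by move=> z _; rewrite lee_fin; exact: max_sumS.
Qed.

End maximal.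

(** The event that the sums of [- f] are unbounded above is shift invariant. If it had probability
    one, almost every path would eventually lie in the events of the maximal inequality, which in
    the limit would give [- f] a nonnegative mean. *)
Lemma birkhoff_lower (N : int) (f : paths R -> R) :
  N != 0 -> mu.-integrable setT (EFin \o f) ->
  (0 < \int[mu]_z (f z)%:E)%E ->
  \forall z \ae mu, exists C, forall n,
    - C <= \sum_(k < n) f (time_shift (N * k%:Z) z).
Proof.
move=> N0 intf f0.
have mf : measurable_fun [set: paths R] f.
  by apply/measurable_EFinP; exact: measurable_int intf.
pose g := \- f.
have intg : mu.-integrable setT (EFin \o g).
  by have := integrableN intf.
pose Sg n z := \sum_(k < n) g (time_shift (N * k%:Z) z).
have mS n : measurable_fun setT (Sg n).
  apply: measurable_sum => k.
  apply: (measurableT_comp _ (measurable_time_shift _)).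
  exact: measurable_funN.
pose A := \bigcap_(C : nat) \bigcup_(n : nat) [set z | C%:R < Sg n z].
have mA : measurable A.
  apply: bigcapT_measurable => C; apply: bigcupT_measurable => n.
  rewrite -[X in measurable X]setTI.
  have := mS n measurableT _ (measurable_itv `]C%:R, +oo[).
  by congr (measurable (_ `&` _)); apply/seteqP; split => z /=; rewrite in_itv/= andbT.
have SS n z : Sg n.+1 z = g z + Sg n (time_shift N z).
  rewrite /Sg big_ord_recl /= mulr0 time_shift0; congr (_ + _).
  apply: eq_bigr => k _.
  by rewrite time_shiftD /bump leq0n addnC PoszD mulrDr mulr1.
have AE : time_shift N @^-1` A = A.
  apply/seteqP; split=> z Az C _ /=.
    (* Raising the level by more than the absolute value of [g z] absorbs the first term, by which
       the sums along [z] and along its shift differ. *)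
    have [n _ /= hn] := Az (C + (Num.truncn `|g z|).+1)%N Logic.I.
    exists n.+1 => //=; rewrite SS.
    have /andP[] : (- `|g z| <= g z <= `|g z|) by rewrite -ler_norml.
    by move: hn (truncnS_gt `|g z|); rewrite natrD; lra.
  have [[|n] _ /=] := Az (C + (Num.truncn `|g z|).+1)%N Logic.I.
    by rewrite /Sg big_ord0 ltNge ler0n.
  rewrite SS => hn; exists n => //=.
  by move: hn (truncnS_gt `|g z|) (ler_norm (g z)); rewrite natrD; lra.
have [A0|A1] := zero_one N0 mA AE.
  exists A; split => //.
  move=> z /= nb C _ /=; apply: contrapT => hC; apply: nb.
  exists C%:R => n.
  rewrite lerNl -sumrN leNgt; apply/negP => h.
  by apply: hC; exists n.
exfalso.
pose D n := [set z | 0 < max_sum N g n.+1 z].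
have mD' n : measurable (D n).
  rewrite -[X in measurable X]setTI.
  have := measurable_max_sum N intg n.+1.
  by move=> /(_ measurableT _ (measurable_itv `]0, +oo[)); rewrite set_itvE.
have h : (\int[mu]_z (g z * \1_(D n) z)%:E @[n --> \oo] --> \int[mu]_z (g z)%:E)%E.
  have [| | | | |_ _ //] := @dominated_convergence _ _ R mu setT measurableT
    (fun n z => (g z * \1_(D n) z)%:E) (EFin \o g) (fun z => `|(g z)%:E|%E).
  - move=> n; apply/measurable_EFinP/measurable_funM; last exact: measurable_indic.
    exact: measurable_funN.
  - exact: (measurable_int _ intg).
  - have : \forall z \ae mu, A z.
      exists (~` A); split => //; first exact: measurableC.
      by rewrite probability_setC// A1 subee.
    apply: filterS => z Az _.
    have [n _ /= hn] := Az 0%N Logic.I.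
    apply: cvg_near_cst; exists n => // k /= nk.
    rewrite indicE mem_set ?mulr1// /D /=.
    apply: lt_le_trans hn _; apply: le_trans (sum_le_max_sum N g n z) _.
    have /nondecreasing_seqP : forall n, max_sum N g n z <= max_sum N g n.+1 z.
      by move=> i; exact: max_sumS.
    by move=> /(_ n k.+1 (leq_trans nk (leqnSn k))).
  - exact: integrable_abse.
  - apply: aeW => z n _ /=; rewrite lee_fin normrM ler_piMr//.
    by rewrite indicE; case: (_ \in _); rewrite ?normr1 ?normr0.
have : (0 <= \int[mu]_z (g z)%:E)%E.
  rewrite -(cvg_lim _ h)//; apply: lime_ge; first by apply/cvg_ex; eexists; exact: h.
  by apply: nearW => n; exact: maximal_ergodic.
have -> : (\int[mu]_z (g z)%:E = - \int[mu]_z (f z)%:E)%E.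
  transitivity (\int[mu]_z (- (f z)%:E))%E; first by apply: eq_integral.
  by rewrite (integralN (f := EFin \o f))//; exact: integrable_add_def.
by rewrite oppe_ge0 leNgt f0.
Qed.

End ergodicity.

(** * Linear recursions *)

Section linear_recursions.
Context {R : realType}.
Implicit Types (b : nat -> R) (c : nat -> nat -> R).

Lemma expn_lt_bound (b : R) (q : nat) : 0 <= b < 1 ->
  exists r : R, [/\ 0 < r, r < 1 & b < r ^+ q].
Proof.
move=> /andP[b0 b1].
have bern (x : R) n : 0 <= x <= 1 -> 1 - n%:R * x <= (1 - x) ^+ n.
  move=> /andP[x0 x1]; elim: n => [|n ih]; first by rewrite mul0r subr0 expr0.
  rewrite exprS; apply: (@le_trans _ _ ((1 - x) * (1 - n%:R * x))).
    rewrite -natr1; have : 0 <= n%:R * x ^+ 2 by rewrite mulr_ge0 // sqr_ge0.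
    by rewrite expr2; lra.
  by rewrite ler_wpM2l// subr_ge0.
have q0 : 0 < q.+2%:R :> R by rewrite ltr0n.
(* Bernoulli's inequality calls for [q%:R * x < 1 - b]; the denominator [q.+2] gives this strictly
   together with [x < 1], also for [q = 0]. *)
pose x := (1 - b) / q.+2%:R.
have x0 : 0 < x by rewrite divr_gt0// subr_gt0.
have x1 : x < 1.
  rewrite /x ltr_pdivrMr// mul1r; apply: (@le_lt_trans _ _ 1); first by lra.
  by rewrite ltr1n.
exists (1 - x); split; [by lra|by lra|].
apply: lt_le_trans (bern x q _); last by rewrite !ltW.
suff : q%:R * x < 1 - b by lra.
have : x * q.+2%:R = 1 - b by rewrite /x divfK// gt_eqF.
by rewrite -(addn2 q) natrD mulrDr; lra.
Qed.

Lemma expr_vanish (r C D : R) : 0 <= r < 1 -> (forall n, D <= C * r ^+ n) -> D <= 0.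
Proof.
move=> /andP[r0 r1] h.
have h1 : C * r ^+ n @[n --> \oo] --> (0 : R).
  rewrite -(mulr0 C); apply: cvgMr; apply: cvg_expr.
  by rewrite ger0_norm.
rewrite -(cvg_lim (@Rhausdorff R) h1); apply: limr_ge; first by apply/cvg_ex; exists 0.
exact: nearW.
Qed.

(* Each iteration of the recursion multiplies the bound [C * l ^+ k] by the factor
   [(\sum_j b j) * l ^+ q], which is less than [1]. *)
Lemma homogeneous_le0 (D : nat -> R) b q (C l : R) :
  (forall j, 0 <= b j) -> 1 <= l -> (\sum_(1 <= j < q.+1) b j) * l ^+ q < 1 ->
  (forall k, D k <= \sum_(1 <= j < q.+1) b j * D (k + j)%N) ->
  (forall k, D k <= C * l ^+ k) -> D 0%N <= 0.
Proof.
move=> b0 l1 bl hD hC.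
pose r := (\sum_(1 <= j < q.+1) b j) * l ^+ q.
have l0 : 0 <= l by lra.
have r0 : 0 <= r by rewrite mulr_ge0 ?sumr_ge0// exprn_ge0.
have {}hC k : D k <= `|C| * l ^+ k.
  by apply: le_trans (hC k) _; rewrite ler_wpM2r ?exprn_ge0// ler_norm.
suff h n k : D k <= `|C| * l ^+ k * r ^+ n.
  apply: (@expr_vanish r `|C|); first by rewrite r0.
  by move=> n; have := h n 0%N; rewrite expr0 mulr1.
elim: n k => [|n ih] k; first by rewrite expr0 mulr1.
apply: le_trans (hD k) _.
rewrite exprS /r [X in _ <= X](_ : _ = \sum_(1 <= j < q.+1)
   b j * (`|C| * l ^+ (k + q) * r ^+ n)); last first.
  by rewrite -mulr_suml exprD /r; ring.
rewrite !big_nat; apply: ler_sum => j /andP[j1 jq].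
rewrite ler_wpM2l//; apply: le_trans (ih _) _.
rewrite ler_wpM2r ?exprn_ge0// ler_wpM2l//.
by apply: ler_weXn2l => //; rewrite leq_add2l.
Qed.

(* The constants depend on the initial values only through their bound [A]. *)
Lemma forward_decay b q (A : R) :
  (forall j, 0 <= b j) -> \sum_(1 <= j < q.+1) b j < 1 -> 0 <= A ->
  exists C r, [/\ 0 <= C, 0 < r, r < 1 & forall u : nat -> R,
    (forall s, (s < q)%N -> u s <= A) ->
    (forall s, (q <= s)%N -> u s <= \sum_(1 <= j < q.+1) b j * u (s - j)%N) ->
    forall s, u s <= C * r ^+ s].
Proof.
move=> b0 b1 A0.
have [|r [r0 r1 br]] := @expn_lt_bound (\sum_(1 <= j < q.+1) b j) q.
  by rewrite b1 sumr_ge0.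
have C0 : 0 <= A / r ^+ q by rewrite divr_ge0 ?exprn_ge0// ltW.
exists (A / r ^+ q), r; split => // u hA hu s.
elim/ltn_ind: s => s ih.
have [sq|qs] := ltnP s q.
  apply: le_trans (hA s sq) _; rewrite mulrAC ler_pdivlMr ?exprn_gt0// ler_wpM2l//.
  by apply: ler_wiXn2l; [exact: ltW|exact: ltW|exact: ltnW].
apply: le_trans (hu s qs) _; set C := A / _ in C0 ih *.
apply: (@le_trans _ _ (\sum_(1 <= j < q.+1) b j * (C * r ^+ (s - q)))).
  rewrite !big_nat; apply: ler_sum => j /andP[j1 jq].
  rewrite ler_wpM2l//; apply: le_trans (ih _ _) _; first by lia.
  rewrite ler_wpM2l//; apply: ler_wiXn2l; [exact: ltW|exact: ltW|lia].
rewrite -mulr_suml.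
have -> : r ^+ s = r ^+ q * r ^+ (s - q) by rewrite -exprD subnKC.
rewrite mulrCA ler_wpM2l// ler_wpM2r//; last exact: ltW.
by rewrite exprn_ge0// ltW.
Qed.

(* [path_weight c N k] is the total weight of the paths from lag [0] to lag [k] all of
   whose vertices but the last lie below [N], a jump of size [i] landing at [k]
   having weight [c k i]. *)
Fixpoint path_weight c (N k : nat) : R :=
  if N is N'.+1 then
    path_weight c N' k + path_weight c N' N' * c k (k - N')%N
  else (k == 0%N)%:R.

Section path_weight.
Variables (c : nat -> nat -> R) (m : nat).
Hypotheses (m0 : (0 < m)%N) (c0 : forall k i, 0 <= c k i)
  (cm : forall k i, (m < i)%N -> c k i = 0).

Lemma path_weight_ge0 N k : 0 <= path_weight c N k.
Proof.
elim: N k => [|N ih] k /=; first by rewrite ler0n.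
by rewrite addr_ge0// mulr_ge0.
Qed.

Lemma path_weight_mono N N' k : (N <= N')%N -> path_weight c N k <= path_weight c N' k.
Proof.
elim: N' => [|N' ih]; first by rewrite leqn0 => /eqP ->.
rewrite leq_eqVlt => /orP[/eqP -> //|]; rewrite ltnS => /ih h.
by apply: le_trans h _; rewrite /= lerDl mulr_ge0// path_weight_ge0.
Qed.

Lemma path_weight_far N k : (N + m <= k)%N -> path_weight c N k = 0.
Proof.
elim: N k => [|N ih] k h /=; first by rewrite (gtn_eqF (leq_trans m0 _)).
by rewrite ih; [rewrite cm ?mulr0 ?addr0//; lia|lia].
Qed.

(** Step [N] replaces the term at lag [N] by its residual and passes its weight on to the lags
    [N + 1, ..., N + m]. With the residual of an arbitrary [V] kept explicit, solutions and
    subsolutions are both special cases. *)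
Lemma path_expansion (V : nat -> R) N :
  V 0%N = \sum_(k < N) path_weight c k k *
             (V k - \sum_(1 <= i < m.+1) c (k + i)%N i * V (k + i)%N)
          + \sum_(N <= k < N + m) path_weight c N k * V k.
Proof.
elim: N => [|N ih].
  rewrite big_ord0 add0r add0n big_ltn//= mul1r big_nat big1 ?addr0// => i /andP[i0 _].
  by rewrite gtn_eqF// mul0r.
rewrite {1}ih big_ord_recr /= -addrA; congr (_ + _).
have NNm : (N < N + m)%N by lia.
rewrite [LHS](big_ltn NNm) mulrBr -addrA; congr (_ + _).
rewrite (_ : \sum_(N.+1 <= k < N.+1 + m) _ =
    \sum_(N.+1 <= k < N.+1 + m) path_weight c N k * V k +
    path_weight c N N * \sum_(1 <= i < m.+1) c (N + i)%N i * V (N + i)%N); last first.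
  under eq_bigr do rewrite mulrDl.
  rewrite big_split/=; congr (_ + _); rewrite mulr_sumr.
  rewrite -{1}[N.+1]add1n big_addn (_ : (N.+1 + m - N)%N = m.+1); last by lia.
  by apply: eq_bigr => i _; rewrite addnK mulrA [(i + N)%N]addnC.
rewrite [RHS]addrC addrK.
rewrite addSn big_nat_recr/=; last by lia.
by rewrite path_weight_far// mul0r addr0.
Qed.

Lemma path_expansion_le (V e : nat -> R) N :
  (forall k, V k <= e k + \sum_(1 <= i < m.+1) c (k + i)%N i * V (k + i)%N) ->
  V 0%N <= \sum_(k < N) path_weight c k k * e k
          + \sum_(N <= k < N + m) path_weight c N k * V k.
Proof.
move=> h; rewrite {1}(path_expansion V N) lerD2r; apply: ler_sum => k _.
by rewrite ler_wpM2l ?path_weight_ge0// lerBlDr.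
Qed.

Lemma path_expansion_eq (V e : nat -> R) N :
  (forall k, V k = e k + \sum_(1 <= i < m.+1) c (k + i)%N i * V (k + i)%N) ->
  V 0%N = \sum_(k < N) path_weight c k k * e k
          + \sum_(N <= k < N + m) path_weight c N k * V k.
Proof.
move=> h; rewrite {1}(path_expansion V N); congr (_ + _); apply: eq_bigr => k _.
by rewrite {1}h addrK.
Qed.

End path_weight.

Lemma cvg_sumr (I : Type) (r : seq I) (f : I -> nat -> R) (l : I -> R) :
  (forall i, f i n @[n --> \oo] --> l i) ->
  \sum_(i <- r) f i n @[n --> \oo] --> \sum_(i <- r) l i.
Proof.
move=> fl; elim: r => [|a r ih].
  under eq_cvg do rewrite big_nil.
  by rewrite big_nil; exact: cvg_cst.
under eq_cvg do rewrite big_cons.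
by rewrite big_cons; exact: cvgD.
Qed.

(* Minimal nonnegative solution of [v t = e t + \sum_i c (t - i) i * v (t - i)]. *)
Section minimal_solution.
Variables (m : nat) (e : int -> R) (c : int -> nat -> R).

Fixpoint rec_iter (n : nat) (t : int) : R :=
  if n is n'.+1 then
    e t + \sum_(1 <= i < m.+1) c (t - i%:Z) i * rec_iter n' (t - i%:Z)
  else 0.

(** The supremum lives in the extended reals and [fine] sends an infinite one to [0]. The value is
    therefore total and measurable in the data; it is shown to solve the recursion where the
    iterates are bounded. *)
Definition rec_sol (t : int) : R :=
  fine (ereal_sup (range (fun n => (rec_iter n t)%:E))).

Hypotheses (e0 : forall t, 0 <= e t) (c0 : forall t i, 0 <= c t i).

Lemma rec_iter_ge0 n t : 0 <= rec_iter n t.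
Proof.
elim: n t => //= n ih t; rewrite addr_ge0// sumr_ge0// => i _.
by rewrite mulr_ge0.
Qed.

Lemma rec_iterS n t : rec_iter n t <= rec_iter n.+1 t.
Proof.
elim: n t => [|n ih] t; first exact: rec_iter_ge0.
rewrite [leRHS]/= [leLHS]/= lerD2l; apply: ler_sum => i _.
by rewrite ler_wpM2l.
Qed.

Lemma rec_iter_nd t : nondecreasing_seq (rec_iter ^~ t).
Proof. by apply/nondecreasing_seqP => n; exact: rec_iterS. Qed.

Lemma rec_iter_le (D : int -> R) : (forall t, 0 <= D t) ->
  (forall t, e t + \sum_(1 <= i < m.+1) c (t - i%:Z) i * D (t - i%:Z) <= D t) ->
  forall n t, rec_iter n t <= D t.
Proof.
move=> D0 hD; elim=> [|n ih] t; first exact: D0.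
apply: le_trans (hD t); rewrite /= lerD2l; apply: ler_sum => i _.
by rewrite ler_wpM2l.
Qed.

Section bounded.
Hypothesis bnd : forall t, exists B, forall n, rec_iter n t <= B.

Lemma rec_sol_cvg t : rec_iter n t @[n --> \oo] --> rec_sol t.
Proof.
have [B hB] := bnd t.
have nd : nondecreasing_seq (fun n => (rec_iter n t)%:E).
  by move=> i j ij; rewrite lee_fin; exact: rec_iter_nd.
have : (rec_iter n t)%:E @[n --> \oo] --> (rec_sol t)%:E; last by move/fine_cvg.
rewrite /rec_sol fineK; first exact: ereal_nondecreasing_cvgn.
rewrite fin_numElt; apply/andP; split.
  apply: (@lt_le_trans _ _ (0%:E : \bar R)); first exact: ltNyr.
  by apply: ereal_sup_ubound; exists 0%N.
apply: (@le_lt_trans _ _ B%:E); last exact: ltry.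
by apply: ge_ereal_sup => _ [n _ <-]; rewrite lee_fin.
Qed.

Lemma rec_iter_le_sol n t : rec_iter n t <= rec_sol t.
Proof.
rewrite -(cvg_lim (@Rhausdorff R) (@rec_sol_cvg t)).
apply: nondecreasing_cvgn_le; first exact: rec_iter_nd.
by apply/cvg_ex; eexists; exact: rec_sol_cvg.
Qed.

Lemma rec_sol_ge0 t : 0 <= rec_sol t.
Proof. exact: (rec_iter_le_sol 0). Qed.

Lemma rec_sol_eq t :
  rec_sol t = e t + \sum_(1 <= i < m.+1) c (t - i%:Z) i * rec_sol (t - i%:Z).
Proof.
have h1 := @rec_sol_cvg t.
have h2 : rec_iter n.+1 t @[n --> \oo] -->
   e t + \sum_(1 <= i < m.+1) c (t - i%:Z) i * rec_sol (t - i%:Z).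
  rewrite /=; apply: cvgD; first exact: cvg_cst.
  apply: cvg_sumr => i; apply: cvgMr; exact: rec_sol_cvg.
have h3 : rec_iter n.+1 t @[n --> \oo] --> rec_sol t.
  by have := h1; rewrite -cvg_shiftS.
exact: (cvg_unique (@Rhausdorff R) h3 h2).
Qed.

Lemma rec_sol_le (D : int -> R) : (forall t, 0 <= D t) ->
  (forall t, e t + \sum_(1 <= i < m.+1) c (t - i%:Z) i * D (t - i%:Z) <= D t) ->
  forall t, rec_sol t <= D t.
Proof.
move=> D0 hD t; rewrite -(cvg_lim (@Rhausdorff R) (@rec_sol_cvg t)).
apply: limr_le; first by apply/cvg_ex; eexists; exact: rec_sol_cvg.
by apply: nearW => n; exact: rec_iter_le.
Qed.

End bounded.

End minimal_solution.

Lemma rec_iter_mono m (e e' : int -> R) (c c' : int -> nat -> R) :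
  (forall t, 0 <= e t) -> (forall t i, 0 <= c t i) ->
  (forall t, e t <= e' t) -> (forall t i, c t i <= c' t i) ->
  forall n t, rec_iter m e c n t <= rec_iter m e' c' n t.
Proof.
move=> e0 c0 ee cc; elim=> //= n ih t.
rewrite lerD//; apply: ler_sum => i _.
by rewrite ler_pM// rec_iter_ge0.
Qed.

Lemma rec_iter_shift m (e : int -> R) (c : int -> nat -> R) s n t :
  rec_iter m (fun u => e (u + s)) (fun u => c (u + s)) n t = rec_iter m e c n (t + s).
Proof.
elim: n t => //= n ih t; congr (_ + _); apply: eq_bigr => i _.
by rewrite ih (addrAC t).
Qed.

Lemma rec_sol_shift m (e : int -> R) (c : int -> nat -> R) s t :
  rec_sol m (fun u => e (u + s)) (fun u => c (u + s)) t = rec_sol m e c (t + s).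
Proof.
rewrite /rec_sol (_ : (fun n => _) = (fun n => (rec_iter m e c n (t + s))%:E))//.
by apply: funext => n; rewrite rec_iter_shift.
Qed.

(** With [r] the factor of one iteration, the leading constant is the fixed point of
    [B = C + r * B], so the bound reproduces itself. *)
Lemma rec_iter_growth m (e : int -> R) (b : nat -> R) (C l : R) t :
  (forall j, 0 <= b j) -> 1 <= l -> (\sum_(1 <= j < m.+1) b j) * l ^+ m < 1 ->
  (forall k : nat, e (t - k%:Z) <= C * l ^+ k) -> 0 <= C ->
  forall n (k : nat), rec_iter m e (fun=> b) n (t - k%:Z) <=
    C / (1 - (\sum_(1 <= j < m.+1) b j) * l ^+ m) * l ^+ k.
Proof.
move=> b0 l1; set r := _ * _ => r1 he C0.
have l0 : 0 <= l by lra.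
have d0 : 0 < 1 - r by lra.
elim=> [|n ih] k.
  by rewrite /= mulr_ge0 ?divr_ge0 ?exprn_ge0// ltW.
rewrite /=; apply: (@le_trans _ _ (C * l ^+ k +
   \sum_(1 <= i < m.+1) b i * (C / (1 - r) * l ^+ (k + m)))).
  rewrite lerD//; rewrite !big_nat; apply: ler_sum => j /andP[j1 jm].
  rewrite ler_wpM2l//; rewrite -addrA -opprD -PoszD; apply: le_trans (ih _) _.
  rewrite ler_wpM2l ?divr_ge0 ?(ltW d0)//.
  by apply: ler_weXn2l => //; rewrite leq_add2l.
rewrite -mulr_suml exprD.
rewrite (_ : C * l ^+ k + _ = C * l ^+ k * (1 + r / (1 - r))); last by rewrite /r; ring.
rewrite (_ : 1 + r / (1 - r) = (1 - r)^-1); last by field; lra.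
by rewrite mulrAC.
Qed.

End linear_recursions.

(** * Scalar inequalities and lag polynomials *)

Section scalar_inequalities.
Context {R : realType}.
Implicit Types x y d L : R.

(** Split one factor [x + y] off the power: the remaining exponent [d - 1] is nonpositive, so
    replacing [x + y] by either summand increases what remains. *)
Lemma powR_subadd d x y : 0 < d <= 1 -> 0 <= x -> 0 <= y ->
  (x + y) `^ d <= x `^ d + y `^ d.
Proof.
move=> /andP[d0 d1] x0 y0.
have aux u v : 0 <= u -> 0 <= v -> u * (u + v) `^ (d - 1) <= u `^ d.
  rewrite le_eqVlt => /orP[/eqP <- v0|u0 v0]; first by rewrite mul0r powR_ge0.
  rewrite -(mulr_powRB1 (ltW u0) d0) ler_pM2l//.
  have -> : d - 1 = - (1 - d) by rewrite opprB.
  rewrite !powRN lef_pV2 ?posrE ?powR_gt0//; last by rewrite ltr_wpDr.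
  apply: ge0_ler_powR; rewrite ?nnegrE ?subr_ge0 ?lerDl//; first exact: ltW.
  by rewrite addr_ge0// ltW.
rewrite -(mulr_powRB1 (addr_ge0 x0 y0) d0) mulrDl lerD//; first exact: aux.
by rewrite [x + y]addrC; exact: aux.
Qed.

Lemma powR_sum_le d (I : Type) (r : seq I) (f : I -> R) : 0 < d <= 1 ->
  (forall i, 0 <= f i) -> (\sum_(i <- r) f i) `^ d <= \sum_(i <- r) f i `^ d.
Proof.
move=> d01 f0; elim: r => [|i r ih].
  by rewrite !big_nil powR0// gt_eqF//; case/andP: d01.
rewrite !big_cons; apply: le_trans (powR_subadd d01 _ _) _ => //.
  exact: sumr_ge0.
by rewrite lerD2l.
Qed.

(** Beyond the threshold [x ^ d = L], the factor [x ^ (d - 1)] is a nonpositive power of [x ^ d],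
    hence at most that power of [L]. For [L > 1] and small [d] the slope is tiny, which offsets
    large means of [x]. *)
Lemma powR_le_affine d x L : 0 < d <= 1 -> 0 <= x -> 0 < L ->
  x `^ d <= L + L `^ (1 - d^-1) * x.
Proof.
move=> /andP[d0 d1] x0 L0.
have [xL|Lx] := leP (x `^ d) L.
  by apply: le_trans xL _; rewrite lerDl mulr_ge0// powR_ge0.
have {}x0 : 0 < x.
  rewrite lt_neqAle x0 andbT; apply/eqP => x00.
  by move: Lx; rewrite -x00 powR0 ?gt_eqF// ltNge (ltW L0).
rewrite -(mulr_powRB1 (ltW x0) d0) mulrC.
apply: (@le_trans _ _ (L `^ (1 - d^-1) * x)); last by rewrite lerDr ltW.
rewrite ler_pM2r//.
have -> : d - 1 = d * (1 - d^-1) by rewrite mulrBr mulr1 divff// gt_eqF.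
rewrite powRrM -opprB !powRN lef_pV2 ?posrE ?powR_gt0//.
apply: ge0_ler_powR; rewrite ?nnegrE ?powR_ge0 ?(ltW L0) ?(ltW Lx)//.
by rewrite subr_ge0 -[leLHS]invr1 lef_pV2 ?posrE.
Qed.

Lemma ln_le_powR d x : 0 < d -> 0 < x -> ln x <= x `^ d / d.
Proof.
move=> d0 x0; rewrite ler_pdivlMr// mulrC -ln_powR.
by apply: ltW; apply: ln_sublinear; rewrite powR_gt0.
Qed.

Lemma ln_lt_sub1 x : 0 < x -> x != 1 -> ln x < x - 1.
Proof.
move=> x0 x1; have lx : ln x != 0 by rewrite ln_eq0.
by have := expR_gt1Dx lx; rewrite lnK//; lra.
Qed.

Lemma ln_le_sub1 x : 0 < x -> ln x <= x - 1.
Proof.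
by move=> x0; have [->|/(ln_lt_sub1 x0)/ltW//] := eqVneq x 1; rewrite ln1 subrr.
Qed.

End scalar_inequalities.

Section polynomial_identifiability.
Context {R : realType}.

Context {p q : nat}.
Implicit Types th : param R p q.

Lemma bet0 th : bet th 0 = 0. Proof. by []. Qed.

Lemma bet_out th j : (q < j)%N -> bet th j = 0.
Proof. by move=> qj; rewrite /bet; case: ifP => // /andP[_]; rewrite leqNgt qj. Qed.

Lemma coef_sumX (n l : nat) (f : nat -> R) :
  (\sum_(1 <= j < n.+1) (f j)%:P * 'X^j)`_l = if (1 <= l <= n)%N then f l else 0.
Proof.
rewrite coef_sum.
under eq_bigr do rewrite coefCM coefXn.
have [ln|ln] := boolP (1 <= l <= n)%N.
  rewrite (bigD1_seq l) ?iota_uniq ?mem_index_iota//= eqxx mulr1 big1 ?addr0// => j.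
  by rewrite eq_sym => /negbTE ->; rewrite mulr0.
rewrite big_nat big1// => j jn; case: eqP => [lj|]; last by rewrite mulr0.
by move: ln; rewrite lj -ltnS jn.
Qed.

Lemma coef_apoly th l : (apoly th)`_l = if (1 <= l <= p)%N then alph th l else 0.
Proof. exact: coef_sumX. Qed.

Lemma coef_bpoly th l : (bpoly th)`_l = (l == 0%N)%:R - bet th l.
Proof.
by rewrite coefB coef1 coef_sumX /bet; case: ifP => h; rewrite ?h.
Qed.

Lemma size_apoly th : (size (apoly th) <= p.+1)%N.
Proof.
apply/leq_sizeP => j pj; rewrite coef_apoly.
by case: ifP => // /andP[_]; rewrite leqNgt pj.
Qed.

Lemma size_bpoly th : (size (bpoly th) <= q.+1)%N.
Proof.
apply/leq_sizeP => j qj; rewrite coef_bpoly bet_out// subr0.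
by case: j qj.
Qed.

Lemma coef_bpoly0 th : (bpoly th)`_0 = 1.
Proof. by rewrite coef_bpoly bet0 subr0. Qed.

Lemma coprime_of_no_common_root (A B : {poly R}) : A != 0 ->
  (forall z : R[i], ~ (root (map_poly (real_complex R) A) z /\
                       root (map_poly (real_complex R) B) z)) ->
  coprimep A B.
Proof.
move=> A0 h; rewrite /coprimep; apply: contrapT => /negP sg.
have : size (map_poly (real_complex R) (gcdp A B)) != 1 by rewrite size_map_poly.
move=> /closed_rootP[z rz]; apply: (h z); split.
  have /dvdpP[C ->] := dvdp_gcdl A B.
  by rewrite rmorphM/= rootM rz orbT.
have /dvdpP[C ->] := dvdp_gcdr A B.
by rewrite rmorphM/= rootM rz orbT.
Qed.

(** By coprimality the true polynomials divide the other two with a common quotient, whose constant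
    term is [1] because both [bpoly] have constant term [1]. A quotient of positive degree is
    excluded since one of the true polynomials has full degree. *)
Lemma polynomials_identifiable th th0 :
  (exists i, (1 <= i <= p)%N /\ 0 < alph th0 i) ->
  (alph th0 p, bet th0 q) != (0, 0) ->
  (forall z : R[i], ~ (root (map_poly (real_complex R) (apoly th0)) z /\
                       root (map_poly (real_complex R) (bpoly th0)) z)) ->
  apoly th * bpoly th0 = apoly th0 * bpoly th ->
  apoly th = apoly th0 /\ bpoly th = bpoly th0.
Proof.
move=> [i0 [i0p ai0]] ab nz E.
set A := apoly th; set B := bpoly th; set A0 := apoly th0; set B0 := bpoly th0.
have A0n : A0 != 0.
  apply/eqP => /(congr1 (fun P : {poly R} => P`_i0)).
  by rewrite coef_apoly i0p coef0 => /eqP; rewrite gt_eqF.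
have cop : coprimep A0 B0 by exact: coprime_of_no_common_root.
have {}E : A * B0 = A0 * B by exact: E.
have /dvdpP[C AC] : A0 %| A by rewrite -(Gauss_dvdpl _ cop) E dvdp_mulr.
have BC : B = C * B0.
  by apply: (mulfI A0n); rewrite -E AC; ring.
have C0 : C`_0 = 1.
  by have := coef_bpoly0 th; rewrite -/B BC coefM big_ord1 subnn coef_bpoly0 mulr1.
have Cn : C != 0 by apply: contra_eq_neq C0 => ->; rewrite coef0 eq_sym oner_eq0.
have sC : (size C <= 1)%N.
  move: ab; rewrite xpair_eqE negb_and => /orP[ap|bq].
    have sA0 : (p < size A0)%N.
      rewrite ltnNge; apply: contra ap => /leq_sizeP/(_ p (leqnn p)).
      rewrite coef_apoly leqnn andbT.
      by rewrite (leq_trans _ (_ : (i0 <= p)%N))// ?(andP i0p).1 ?(andP i0p).2// => ->.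
    have := size_apoly th; rewrite -/A AC size_mul//.
    by move: sA0; move: (size A0) (size C) => a c'; lia.
  have sB0 : (q < size B0)%N.
    rewrite ltnNge; apply: contra bq => /leq_sizeP/(_ q (leqnn q)).
    rewrite coef_bpoly; have [q0|q0] := posnP q.
      by move=> _; rewrite /bet; case: ifP => // /andP[]; lia.
    by rewrite sub0r => /eqP; rewrite oppr_eq0.
  have := size_bpoly th; rewrite -/B BC size_mul//; last first.
    by rewrite -size_poly_gt0; apply: leq_ltn_trans sB0.
  by move: sB0; move: (size B0) (size C) => a c'; lia.
have C1 : C = 1.
  by rewrite (size1_polyC sC) C0.
by rewrite AC BC C1 !mul1r.
Qed.

Lemma param_ext th th0 : apoly th = apoly th0 -> bpoly th = bpoly th0 ->
  alph th 0 = alph th0 0 -> gam th = gam th0 -> th = th0.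
Proof.
move=> aE bE a0E gE; apply/rowP => k.
have [kp|pk] := leqP k p.
  have E (t : param R p q) : t 0 k = alph t k.
    by rewrite /alph; congr (t _ _); apply: val_inj; rewrite /= inordK//; lia.
  rewrite !E; case: (posnP k) => [->//|k0].
  have := congr1 (fun P : {poly R} => P`_k) aE.
  by rewrite !coef_apoly k0 kp.
have [kpq|pqk] := leqP k (p + q).
  have E (t : param R p q) : t 0 k = bet t (k - p).
    rewrite /bet ifT; last by lia.
    by congr (t _ _); apply: val_inj; rewrite /= inordK//; lia.
  rewrite !E; have := congr1 (fun P : {poly R} => P`_(k - p)) bE.
  by rewrite !coef_bpoly => /addrI/oppr_inj.
have E (t : param R p q) : t 0 k = gam t.
  rewrite /gam; congr (t _ _); apply: val_inj; rewrite /= inordK//.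
  by have := ltn_ord k; lia.
by rewrite !E.
Qed.

End polynomial_identifiability.

Section probability_facts.
Context d {T : measurableType d} {R : realType} (P : probability T R).

Lemma integral_prob_cst (r : R) : (\int[P]_w r%:E = r%:E)%E.
Proof.
transitivity (\int[P]_w cst r%:E w)%E => //.
by rewrite integral_cst//= probability_setT mule1.
Qed.

Lemma ae_ex (Q : T -> Prop) : (\forall w \ae P, Q w) -> exists w, Q w.
Proof.
move=> [N [mN N0 QN]]; apply: contrapT => nQ.
have : P N = 1%E.
  rewrite -(probability_setT P); congr (P _); apply/seteqP; split => // w _.
  by apply: QN => Qw; apply: nQ; exists w.
by rewrite N0 => /eqP; rewrite eqe eq_sym oner_eq0.
Qed.

End probability_facts.

(** * Moments of the stationary volatility *)

Section small_fractional_moment.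
Context d {T : measurableType d} {R : realType} (P : probability T R).

Lemma eventually_mulr_le (c r e : R) : 0 < c -> 0 < e ->
  exists l0, forall l, (l0 <= l)%N -> r * expR (- (c * l%:R)) <= e.
Proof.
move=> c0 e0; exists (Num.truncn (`|r| / (c * e))).+1 => l hl.
have hl' : `|r| / (c * e) < l%:R.
  by apply: lt_le_trans (truncnS_gt _) _; rewrite ler_nat.
have ce0 : 0 < c * e by rewrite mulr_gt0.
rewrite expRN ler_pdivrMr ?expR_gt0//.
apply: le_trans (ler_norm r) _.
apply: (@le_trans _ _ (e * (1 + c * l%:R))); last first.
  by rewrite ler_pM2l// expR_ge1Dx.
move: hl'; rewrite ltr_pdivrMr// => hl'.
have -> : e * (1 + c * l%:R) = e + l%:R * (c * e) by ring.
by move: hl'; lra.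
Qed.

(** The means may grow exponentially in [l] although the variables decay exponentially almost
    surely. An exponent [dl = A / l] turns both rates into constants: off a rare event the power is
    at most [exp (- kap * A / 2)], and on it the affine bound costs [L] times a small probability
    plus a slope that beats the growth of the means. *)
Lemma small_fractional_moment (X : nat -> T -> R) (D kap e : R) :
  (forall l, measurable_fun setT (X l)) -> (forall l w, 0 <= X l w) ->
  1 <= D -> (forall l, (\int[P]_w (X l w)%:E <= (D ^+ l.+1)%:E)%E) ->
  0 < kap -> (\forall w \ae P, exists C, forall l, X l w <= C * expR (- (kap * l%:R))) ->
  0 < e ->
  exists l (dl : R), [/\ (0 < l)%N, 0 < dl <= 1 & (\int[P]_w (X l w `^ dl)%:E <= e%:E)%E].
Proof.
move=> mX X0 D1 EX kap0 Xdecay e0.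
pose s l := expR (- (kap / 2 * l%:R)).
pose Bad l := [set w | s l < X l w].
have mBad l : measurable (Bad l).
  rewrite -[X in measurable X]setTI.
  have := mX l measurableT _ (measurable_itv `]s l, +oo[).
  by congr (measurable (_ `&` _)); apply/seteqP; split => z /=; rewrite in_itv/= andbT.
have PBad : (P (Bad l) @[l --> \oo] --> 0%:E)%E.
  have [| | | | |_ _] := @dominated_convergence _ _ R P setT measurableT
    (fun l w => (\1_(Bad l) w)%:E) (cst 0%E) (cst 1%E).
  - by move=> l; apply/measurable_EFinP; exact: measurable_indic.
  - exact: measurable_cst.
  - move: Xdecay; apply: filterS => w [C hC] _.
    have k20 : 0 < kap / 2 by rewrite divr_gt0.
    have [l0 hl0] := eventually_mulr_le C k20 ltr01.
    apply: cvg_near_cst; exists l0 => // l /= ll0.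
    rewrite indicE memNset// /Bad /= => /lt_le_trans/(_ (hC l)).
    rewrite ltNge => /negP; apply.
    rewrite (_ : kap * l%:R = kap / 2 * l%:R + kap / 2 * l%:R); last by field.
    rewrite opprD expRD mulrA /s -[leRHS]mul1r ler_wpM2r ?expR_ge0//.
    exact: hl0.
  - exact: finite_measure_integrable_cst.
  - by apply: aeW => w l _ /=; rewrite lee_fin indicE; case: (_ \in _); rewrite ?normr1 ?normr0.
  rewrite integral0; apply: cvg_trans; apply: near_eq_cvg; apply: nearW => l.
  by rewrite /= integral_indic// setIT.
have e30 : 0 < e / 3 by rewrite divr_gt0.
(* Chosen so that [kap / 2 * A] is at least [3 / e], which makes the exponential of its opposite at
   most [e / 3]. *)
pose A := 1 + 6 / (e * kap).
have ek0 : 0 < e * kap by rewrite mulr_gt0.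
have A1 : 1 <= A by rewrite /A lerDl divr_ge0// ltW.
have A0 : 0 < A by lra.
have hA : expR (- (kap / 2 * A)) <= e / 3.
  rewrite expRN -[leRHS]invrK lef_pV2 ?posrE ?invr_gt0 ?expR_gt0//.
  apply: le_trans (expR_ge1Dx _).
  have -> : (e / 3)^-1 = 3 / e by field; rewrite gt_eqF.
  have -> : kap / 2 * A = kap / 2 + 3 / e by rewrite /A; field; rewrite !gt_eqF.
  by lra.
pose th := ln D.
have th0 : 0 <= th by rewrite ln_ge0.
have DE k : D ^+ k = expR (th * k%:R).
  by rewrite mulrC expRM_natl lnK// posrE; lra.
(* For [dl = A / l] the slope of the affine bound is [L * exp (- l * (1 + 2 * th))]. The part
   [2 * th] pays for [D ^ l.+1], which is at most [exp (2 * th * l)], and [L * exp (- l)]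
   remains. *)
pose L := expR (A * (1 + 2 * th)).
have L0 : 0 < L by exact: expR_gt0.
have [l1 hl1] := eventually_mulr_le L ltr01 e30.
have [l2 hl2] : exists l2, forall l, (l2 <= l)%N -> (L%:E * P (Bad l) <= (e / 3)%:E)%E.
  have eL0 : 0 < e / 3 / L by rewrite divr_gt0.
  have := PBad; move/fine_cvgP => [_] /cvgrPdist_le/(_ _ eL0)[l2 _ hl2].
  exists l2 => l /hl2 /=; rewrite sub0r normrN ger0_norm ?fine_ge0// => h.
  rewrite -(@fineK _ (P (Bad l))) ?fin_num_measure// -EFinM lee_fin mulrC.
  by rewrite -ler_pdivlMr.
pose l := (l1 + l2 + (Num.truncn A).+1)%N.
have lA : A < l%:R.
  by apply: lt_le_trans (truncnS_gt _) _; rewrite ler_nat /l leq_addl.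
have l0 : 0 < l%:R :> R by lra.
pose dl := A / l%:R.
have dl0 : 0 < dl by rewrite divr_gt0.
have dl1 : dl <= 1 by rewrite ler_pdivrMr// mul1r ltW.
have l_gt0 : (0 < l)%N by rewrite /l addnS.
exists l, dl; split; [by []|by rewrite dl0|].
have pt w : X l w `^ dl <= s l `^ dl + L * \1_(Bad l) w + L `^ (1 - dl^-1) * X l w.
  have [Xs|sX] := leP (X l w) (s l).
    rewrite indicE memNset; last by rewrite /Bad /= ltNge Xs.
    rewrite mulr0 addr0; apply: (@le_trans _ _ (s l `^ dl)).
      by apply: ge0_ler_powR => //; rewrite ?nnegrE ?expR_ge0// ltW.
    by rewrite lerDl mulr_ge0// powR_ge0.
  rewrite indicE mem_set// mulr1 -addrA.
  apply: (@le_trans _ _ (L + L `^ (1 - dl^-1) * X l w)); last by rewrite lerDr powR_ge0.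
  by apply: powR_le_affine => //; rewrite dl0.
apply: (@le_trans _ _ (\int[P]_w ((s l `^ dl)%:E + L%:E * (\1_(Bad l) w)%:E +
    (L `^ (1 - dl^-1))%:E * (X l w)%:E)%E)%E).
  apply: ge0_le_integral => //.
  - by move=> w _; rewrite lee_fin powR_ge0.
  - by apply/measurable_EFinP; exact: (measurableT_comp (measurable_powR _) (mX l)).

  - apply/measurable_EFinP; apply: measurable_funD; last exact: measurable_funM.
    by apply: measurable_funD => //; exact: measurable_funM.
  - by move=> w _; rewrite -!EFinM -!EFinD lee_fin pt.
rewrite ge0_integralD//; last 4 first.
- by move=> w _; rewrite -EFinM -EFinD lee_fin addr_ge0 ?powR_ge0// mulr_ge0 ?indicE ?ler0n// ltW.
- by apply/measurable_EFinP; apply: measurable_funD => //; exact: measurable_funM.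
- by move=> w _; rewrite -EFinM lee_fin mulr_ge0 ?powR_ge0.
- by apply/measurable_EFinP; exact: measurable_funM.
rewrite ge0_integralD//; last 3 first.
- by move=> w _; rewrite lee_fin powR_ge0.
- by move=> w _; rewrite -EFinM lee_fin mulr_ge0 ?indicE ?ler0n// ltW.
- by apply/measurable_EFinP; exact: measurable_funM.
rewrite ge0_integralZl//; last 2 first.
- by apply/measurable_EFinP; exact: measurable_indic.
- by rewrite lee_fin ltW.
rewrite ge0_integralZl; last 4 first.
- exact: measurableT.
- exact/measurable_EFinP.
- by move=> w _; rewrite lee_fin.
- by rewrite lee_fin powR_ge0.
rewrite integral_indic// setIT integral_prob_cst.
rewrite (_ : e = e / 3 + e / 3 + e / 3); last by field.
rewrite [in leRHS]EFinD [in leRHS]EFinD; apply: leeD; [apply: leeD|].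
- rewrite lee_fin -expRM (_ : - _ * dl = - (kap / 2 * A)) ?hA//.
  by rewrite /dl; field; rewrite gt_eqF.
- by apply: hl2; rewrite /l -addnA addnCA leq_addr.
- apply: (@le_trans _ _ ((L `^ (1 - dl^-1))%:E * (D ^+ l.+1)%:E)%E).
    by apply: lee_pmul => //; [rewrite lee_fin powR_ge0|apply: integral_ge0 => w _; rewrite lee_fin].
  rewrite -EFinM lee_fin -expRM DE -expRD.
  apply: le_trans (hl1 l _); last by rewrite /l -addnA leq_addr.
  rewrite /L -expRD ler_expR mul1r.
  have -> : A * (1 + 2 * th) * (1 - dl^-1) = A * (1 + 2 * th) - l%:R * (1 + 2 * th).
    by rewrite /dl; field; rewrite !gt_eqF.
  rewrite -natr1 mulrDr mulr1.
  have : th <= th * l%:R by rewrite ler_peMr// ler1n.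
  by rewrite mulrDr mulr1; lra.
Qed.

End small_fractional_moment.

Section random_recursion.
Context {R : realType}.
Variables (m : nat) (a : R) (cf : nat -> R -> R).
Implicit Types z : paths R.

Definition rvol_iter z (n : nat) (t : int) : R :=
  rec_iter m (fun=> a) (fun s i => cf i (z s)) n t.

Definition rvol z (t : int) : R := rec_sol m (fun=> a) (fun s i => cf i (z s)) t.

Definition lag_weight z (t : int) : nat -> nat -> R :=
  fun k i => cf i (z (t - k%:Z)).

Definition rvol_finite z := forall t, exists B, forall n, rvol_iter z n t <= B.

Hypotheses (m0 : (0 < m)%N) (a0 : 0 < a) (cf_ge0 : forall i x, 0 <= cf i x)
  (cfm : forall i x, (m < i)%N -> cf i x = 0)
  (mcf : forall i, measurable_fun setT (cf i)).

Lemma measurable_rvol_iter n t : measurable_fun [set: paths R] (rvol_iter ^~ n ^~ t).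
Proof.
elim: n t => [|n ih] t; first exact: measurable_cst.
apply: measurable_funD; first exact: measurable_cst.
apply: measurable_sum => i; apply: measurable_funM; last exact: ih.
exact: (measurableT_comp (mcf i) (measurable_coord _)).
Qed.

Lemma measurable_rvol t : measurable_fun [set: paths R] (rvol ^~ t).
Proof.
apply: (measurableT_comp (fine_measurable measurableT)).
have := @measurable_fun_esups _ (paths R) R setT
  (fun n z => (rvol_iter z n t)%:E) (fun n => _) 0%N.
rewrite /esups /sdrop /=.
rewrite (_ : (fun z => _) = (fun z => ereal_sup (range (fun n => (rvol_iter z n t)%:E)))).
  apply => n; apply/measurable_EFinP; exact: measurable_rvol_iter.
by apply/funext => z; congr ereal_sup; apply/seteqP; split=> x [k _ <-]; exists k.
Qed.

Lemma measurable_path_weight N k t :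
  measurable_fun [set: paths R] (fun z => path_weight (lag_weight z t) N k).
Proof.
elim: N k => [|N ih] k /=; first exact: measurable_cst.
apply: measurable_funD => //; apply: measurable_funM => //.
exact: (measurableT_comp (mcf _) (measurable_coord _)).
Qed.

Lemma rvol_iter_dep n t : depends_on [pred s | s < t] (rvol_iter ^~ n ^~ t).
Proof.
elim: n t => //= n ih t z z' zz'; rewrite /rvol_iter /=; congr (_ + _).
rewrite !big_nat; apply: eq_bigr => i /andP[i1 _].
rewrite zz'; last by rewrite inE; lia.
by congr (_ * _); apply: ih => s /= st; apply: zz'; rewrite inE; lia.
Qed.

Lemma rvol_dep t : depends_on [pred s | s < t] (rvol ^~ t).
Proof.
move=> z z' zz'; rewrite /rvol /rec_sol; congr (fine (ereal_sup _)).
rewrite (_ : (fun n => _) = (fun n => (rvol_iter z' n t)%:E))//.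
by apply: funext => n; rewrite -/(rvol_iter z n t) (rvol_iter_dep n zz').
Qed.

(** A jump is weighted by the innovation at its landing time, so the weight of the paths to lag [k]
    involves no innovation before time [t - k], whereas the volatility at time [t - k] involves only
    those: the two are independent. *)
Lemma path_weight_dep N k t : (N <= k)%N ->
  depends_on [pred s | (t - k%:Z <= s)] (fun z => path_weight (lag_weight z t) N k).
Proof.
elim: N k => //= N ih k Nk z z' zz'.
rewrite (ih k (ltnW Nk) _ _ zz') (ih N (leqnn N) z z'); last first.
  by move=> s /= hs; apply: zz'; rewrite inE; lia.
by rewrite /lag_weight zz'// inE.
Qed.

Lemma rvol_iter_shift z n t s : rvol_iter (time_shift s z) n t = rvol_iter z n (t + s).
Proof.
exact: (rec_iter_shift m (fun=> a) (fun s i => cf i (z s))).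
Qed.

Lemma rvol_shift z t s : rvol (time_shift s z) t = rvol z (t + s).
Proof. exact: (rec_sol_shift m (fun=> a) (fun s i => cf i (z s))). Qed.

Let ca0 : forall t : int, 0 <= a. Proof. by move=> _; exact: ltW. Qed.

Let cge0 z : forall (s : int) i, 0 <= cf i (z s). Proof. by []. Qed.

Lemma rvol_iter_ge0 z n t : 0 <= rvol_iter z n t.
Proof. exact: rec_iter_ge0. Qed.

Lemma rvol_iter_nd z t : nondecreasing_seq (rvol_iter z ^~ t).
Proof. exact: rec_iter_nd. Qed.

Section finite.
Variable z : paths R.
Hypothesis zfin : rvol_finite z.

Lemma rvolE t : rvol z t = a + \sum_(1 <= i < m.+1) cf i (z (t - i%:Z)) * rvol z (t - i%:Z).
Proof. exact: (rec_sol_eq ca0 (cge0 z) zfin). Qed.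

Lemma rvol_cvg t : rvol_iter z n t @[n --> \oo] --> rvol z t.
Proof. exact: (rec_sol_cvg ca0 (cge0 z) zfin). Qed.

Lemma rvol_ge t : a <= rvol z t.
Proof.
rewrite rvolE lerDl sumr_ge0// => i _; rewrite mulr_ge0//.
exact: (rec_sol_ge0 ca0 (cge0 z) zfin).
Qed.

Lemma rvol_gt0 t : 0 < rvol z t.
Proof. exact: lt_le_trans (rvol_ge t). Qed.

Let G t k := path_weight (lag_weight z t) k k.

Let c0 t : forall k i, 0 <= lag_weight z t k i.
Proof. by move=> k i; exact: cf_ge0. Qed.

Let cm t : forall k i, (m < i)%N -> lag_weight z t k i = 0.
Proof. by move=> k i; exact: cfm. Qed.

Lemma rvol_expansion t N :
  rvol z t = \sum_(k < N) G t k * a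
    + \sum_(N <= k < N + m) path_weight (lag_weight z t) N k * rvol z (t - k%:Z).
Proof.
have := @path_expansion_eq _ (lag_weight z t) m m0 (cm t)
  (fun k => rvol z (t - k%:Z)) (fun=> a) N; rewrite /= subr0; apply => k.
rewrite rvolE; congr (_ + _); apply: eq_bigr => i _.
by rewrite /lag_weight PoszD opprD addrA.
Qed.

Lemma sum_path_weight_le t N : \sum_(k < N) G t k <= rvol z t / a.
Proof.
rewrite ler_pdivlMr// (rvol_expansion t N) mulr_suml lerDl sumr_ge0// => k _.
by rewrite mulr_ge0 ?path_weight_ge0// ltW// rvol_gt0.
Qed.

Lemma path_weight_cvg0 t : G t k @[k --> \oo] --> (0 : R).
Proof.
apply: cvg_series_cvg_0; apply: nondecreasing_is_cvgn.
  apply/nondecreasing_seqP => n; rewrite /series/= big_nat_recr//= lerDl.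
  exact: path_weight_ge0.
exists (rvol z t / a) => _ [n _ <-]; rewrite /series/= big_mkord.
exact: sum_path_weight_le.
Qed.

(* Over [m] lags the tail loses at least the proportion [a / U], where [U] is the sum of
   the volatilities at these lags. By ergodicity these proportions add up linearly, so
   that the path weights decay exponentially. *)
Definition path_tail t N := rvol z t - \sum_(k < N) G t k * a.

Lemma path_tail_ge0 t N : 0 <= path_tail t N.
Proof.
rewrite /path_tail subr_ge0 (rvol_expansion t N) lerDl sumr_ge0// => k _.
by rewrite mulr_ge0 ?path_weight_ge0// ltW// rvol_gt0.
Qed.

Lemma path_tail_step t N :
  path_tail t (N + m) <= path_tail t N *
    (1 - a / \sum_(j < m) rvol z (t - N%:Z - j%:Z)).
Proof.
set U := \sum_(j < m) _.
have U0 : 0 < U.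
  rewrite /U; case: m m0 => // m' _; rewrite big_ord_recl ltr_pwDl ?rvol_gt0//.
  by apply: sumr_ge0 => j _; rewrite ltW// rvol_gt0.
have h1 : path_tail t N - path_tail t (N + m) = a * \sum_(N <= k < N + m) G t k.
  rewrite /path_tail -!(big_mkord xpredT (fun k => G t k * a)).
  rewrite [in X in _ - X](big_cat_nat (n := N)) ?leq_addr//= -mulr_suml -mulr_suml.
  by ring.
(* The tail is the remainder of the expansion at [N], carried by the next [m] lags; its weights are
   at most the full path weights there, and its volatilities at most their sum [U]. *)
have h2 : path_tail t N <= U * \sum_(N <= k < N + m) G t k.
  rewrite {1}/path_tail (rvol_expansion t N) addrAC subrr add0r mulr_sumr.
  rewrite !big_nat; apply: ler_sum => k /andP[Nk kNm].
  rewrite mulrC ler_pM ?path_weight_ge0 ?(ltW (rvol_gt0 _))//; last first.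
    exact: path_weight_mono.
  have km : (k - N < m)%N by lia.
  rewrite /U (bigD1 (Ordinal km))//= (_ : t - N%:Z - (k - N)%N%:Z = t - k%:Z); last by lia.
  by rewrite lerDl sumr_ge0// => j _; rewrite ltW// rvol_gt0.
rewrite mulrBr mulr1; suff : path_tail t N * (a / U) <= a * \sum_(N <= k < N + m) G t k.
  by move: h1; lra.
by rewrite mulrCA ler_pM2l// ler_pdivrMr// mulrC.
Qed.

Lemma path_tail_decay t l :
  path_tail t (l * m) <= rvol z t *
    expR (- \sum_(i < l) a / \sum_(j < m) rvol z (t - (i * m)%N%:Z - j%:Z)).
Proof.
elim: l => [|l ih].
  by rewrite /path_tail mul0n !big_ord0 subr0 oppr0 expR0 mulr1.
rewrite mulSn addnC; apply: le_trans (path_tail_step _ _) _.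
set x := a / _.
rewrite big_ord_recr/= -/x opprD expRD mulrA.
apply: (@le_trans _ _ (path_tail t (l * m) * expR (- x))).
  by rewrite ler_wpM2l ?path_tail_ge0// expR_ge1Dx.
by rewrite ler_wpM2r// expR_ge0.
Qed.

Lemma path_weight_le_tail t N k : (N <= k)%N -> G t k * a <= path_tail t N.
Proof.
move=> Nk; have := path_tail_ge0 t k.+1.
rewrite /path_tail -!(big_mkord xpredT (fun k => G t k * a)).
rewrite (big_cat_nat (n := N))//=; last by rewrite ltnW.
rewrite big_nat_recr//=.
have : 0 <= \sum_(N <= i < k) G t i * a.
  by apply: sumr_ge0 => i _; rewrite mulr_ge0 ?path_weight_ge0// ltW.
by lra.
Qed.

End finite.

Lemma lag_weight_ge0 z t k i : 0 <= lag_weight z t k i.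
Proof. exact: cf_ge0. Qed.

Lemma lag_path_weight_ge0 z t N k : 0 <= path_weight (lag_weight z t) N k.
Proof. by apply: path_weight_ge0 => *; exact: lag_weight_ge0. Qed.

Lemma rvol_iter_path_expansion z n t N :
  rvol_iter z n t <= \sum_(k < N) path_weight (lag_weight z t) k k * a
    + \sum_(N <= k < N + m) path_weight (lag_weight z t) N k * rvol_iter z n (t - k%:Z).
Proof.
have := @path_expansion_le _ (lag_weight z t) m m0 _ _
  (fun k => rvol_iter z n (t - k%:Z)) (fun=> a) N; rewrite /= subr0; apply.
- by move=> k i; exact: cf_ge0.
- by move=> k i; exact: cfm.
move=> k; apply: (@le_trans _ _ (rvol_iter z n.+1 (t - k%:Z))).
  exact: rec_iterS.
rewrite /rvol_iter /= lerD2l; apply: ler_sum => i _.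
by rewrite /lag_weight PoszD opprD addrA.
Qed.

Section moments.
Variable mu : probability (paths R) R.
Hypothesis iidmu : iid_seq mu (fun t z => z t).
Hypothesis Ecf : forall i, (\int[mu]_z (cf i (z 0))%:E < +oo)%E.

Lemma mean_cf_bound : exists2 M : R, 0 <= M &
  forall i t, (\int[mu]_z (cf i (z t))%:E <= M%:E)%E.
Proof.
have E0 i : (0 <= \int[mu]_z (cf i (z 0))%:E)%E.
  by apply: integral_ge0 => z _; rewrite lee_fin.
exists (\sum_(i < m.+1) fine (\int[mu]_z (cf i (z 0))%:E)).
  by apply: sumr_ge0 => i _; exact/fine_ge0.
move=> i t.
have -> : (\int[mu]_z (cf i (z t))%:E = \int[mu]_z (cf i (z 0))%:E)%E.
  rewrite -(ge0_integral_shift iidmu t (f := fun z => (cf i (z 0))%:E)).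
  - by apply: eq_integral => z _; rewrite /time_shift add0r.
  - apply/measurable_EFinP; exact: (measurableT_comp (mcf i) (measurable_coord _)).
  - by move=> z; rewrite lee_fin.
have [im|mi] := ltnP i m.+1; last first.
  rewrite integral0_eq; first by rewrite lee_fin sumr_ge0// => j _; exact/fine_ge0.
  by move=> z _; rewrite cfm.
rewrite (bigD1 (Ordinal im))//= -[leLHS]fineK ?ge0_fin_numE//.
by rewrite lee_fin lerDl sumr_ge0// => j _; exact/fine_ge0.
Qed.

Lemma mean_path_weight : exists2 M : R, 0 <= M & forall N k t, (N <= k)%N ->
  (\int[mu]_z (path_weight (lag_weight z t) N k)%:E <= ((1 + M) ^+ N)%:E)%E.
Proof.
have [M M0 hM] := mean_cf_bound; exists M => // N k t.
elim: N k => [|N ih] k Nk.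
  rewrite expr0; have -> : (\int[mu]_z (path_weight (lag_weight z t) 0 k)%:E =
    \int[mu]_z (cst ((k == 0%N)%:R : R)%:E z))%E by [].
  rewrite integral_cst//= probability_setT mule1 lee_fin.
  by case: (k == 0%N).
rewrite /=; under eq_integral do rewrite EFinD.
rewrite ge0_integralD//; last 4 first.
- by move=> z _; rewrite lee_fin lag_path_weight_ge0.
- by apply/measurable_EFinP; exact: measurable_path_weight.
- by move=> z _; rewrite lee_fin mulr_ge0 ?lag_path_weight_ge0 ?lag_weight_ge0.
- apply/measurable_EFinP/measurable_funM; first exact: measurable_path_weight.
  exact: (measurableT_comp (mcf _) (measurable_coord _)).
under [X in (_ + X)%E]eq_integral do rewrite EFinM.
(* The new jump lands at [k > N], hence on an innovation earlier than those in the weight up to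
   [N]. *)
rewrite (ge0_integralM_indep iidmu (I := [pred s | t - N%:Z <= s])
  (f := fun z => (path_weight (lag_weight z t) N N)%:E)
  (g := fun z => (lag_weight z t k (k - N))%:E)); last first.
- by move=> z z' zz'; rewrite /lag_weight zz'// inE -ltNge; lia.
- by move=> z z' zz'; congr EFin; exact: path_weight_dep.
- by move=> z; rewrite lee_fin lag_weight_ge0.
- by move=> z; rewrite lee_fin lag_path_weight_ge0.
- apply/measurable_EFinP; exact: (measurableT_comp (mcf _) (measurable_coord _)).
- by apply/measurable_EFinP; exact: measurable_path_weight.
rewrite exprSr mulrDr mulr1 EFinD EFinM; apply: leeD; first by apply: ih; rewrite ltnW.
apply: lee_pmul => //.
- by apply: integral_ge0 => z _; rewrite lee_fin lag_path_weight_ge0.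
- by apply: integral_ge0 => z _; rewrite lee_fin lag_weight_ge0.
- exact: ih.
- exact: hM.
Qed.

Lemma rvol_ge0 z t : 0 <= rvol z t.
Proof.
apply: fine_ge0; apply: ereal_sup_ubound.
by exists 0%N.
Qed.

Hypothesis finmu : \forall z \ae mu, rvol_finite z.

Lemma path_weight_exp_decay : exists2 kap : R, 0 < kap &
  \forall z \ae mu, exists C, forall l k, (l * m <= k)%N ->
    path_weight (lag_weight z 0) k k <= C * expR (- (kap * l%:R)).
Proof.
pose U z (t : int) := \sum_(j < m) rvol z (t - j%:Z).
(* The truncation at [1] makes the proportion integrable; a smaller proportion only weakens the
   decay bound. *)
pose f z := Num.min 1 (a / U z 0).
have U0 z t : 0 <= U z t by apply: sumr_ge0 => j _; exact: rvol_ge0.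
have f0 z : 0 <= f z by rewrite le_min ler01 divr_ge0// ltW.
have f1 z : f z <= 1 by rewrite ge_min lexx.
have mU t : measurable_fun [set: paths R] (U ^~ t).
  by apply: measurable_sum => j; exact: measurable_rvol.
have mf : measurable_fun [set: paths R] f.
  apply: measurable_minr => //; apply: measurable_funM => //.
  rewrite (_ : (fun z => _) = (fun z => U z 0 `^ (-1))); last first.
    by apply/funext => z; rewrite powR_inv1.
  exact: (measurableT_comp (@measurable_powR R (-1)) (mU 0)).
have intf : mu.-integrable setT (EFin \o f).
  apply: (@le_integrable _ _ _ mu setT _ _ (EFin \o cst 1)) => //.
  - exact/measurable_EFinP.
  - by move=> z _ /=; rewrite lee_fin normr1 ger0_norm.
  - exact: finite_measure_integrable_cst.
have Ef0 : (0 < \int[mu]_z (f z)%:E)%E.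
  rewrite lt0e integral_ge0 ?andbT; last by move=> z _; rewrite lee_fin.
  apply/eqP => f00.
  have : ae_eq mu setT (EFin \o f) (cst 0%E).
    apply/(ae_eq_integral_abs mu measurableT); first exact/measurable_EFinP.
    by rewrite -[RHS]f00; apply: eq_integral => z _ /=; rewrite ger0_norm.
  move=> /(filterI finmu)/ae_ex[z [zfin /(_ Logic.I)/= [fz0]]].
  have : 0 < f z.
    rewrite lt_min ltr01 divr_gt0//.
    rewrite /U; case: (m) m0 => // m' _; rewrite big_ord_recl ltr_pwDl ?rvol_gt0//.
    by apply: sumr_ge0 => j _; exact: rvol_ge0.
  by rewrite fz0 ltxx.
have Effin := integrable_fin_num measurableT intf.
(* Half the mean: [f - kap] still has positive mean, so its sums along backward steps of length [m]
   are bounded below. *)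
pose kap := fine (\int[mu]_z (f z)%:E) / 2.
have kap0 : 0 < kap by rewrite divr_gt0// fine_gt0// Ef0 -ge0_fin_numE ?ltW.
exists kap => //.
have intg : mu.-integrable setT (EFin \o (f \- cst kap)).
  apply: (integrableB measurableT intf (g := EFin \o cst kap)).
  exact: finite_measure_integrable_cst.
have Eg : (0 < \int[mu]_z ((f \- cst kap) z)%:E)%E.
  have -> : (\int[mu]_z ((f \- cst kap) z)%:E = \int[mu]_z (f z)%:E - kap%:E)%E.
    rewrite (integralB_EFin measurableT intf (f2 := cst kap)); last first.
      exact: finite_measure_integrable_cst.
    by rewrite integral_prob_cst.
  have EfE : (\int[mu]_z (f z)%:E = (fine (\int[mu]_z (f z)%:E))%:E)%E by rewrite fineK.
  by rewrite EfE -EFinB lte_fin; have := kap0; rewrite /kap; lra.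
have mz : - m%:Z != 0 by rewrite oppr_eq0; lia.
have := birkhoff_lower iidmu mz intg Eg.
apply: filterS2 finmu => z zfin [C hC].
exists (rvol z 0 / a * expR C) => l k lk.
apply: (@le_trans _ _ ((rvol z 0 * expR (C - kap * l%:R)) / a)); last first.
  by rewrite expRD le_eqVlt; apply/orP; left; apply/eqP; ring.
rewrite ler_pdivlMr//; apply: le_trans (path_weight_le_tail zfin 0 lk) _.
apply: le_trans (path_tail_decay zfin 0 l) _.
rewrite ler_wpM2l ?rvol_ge0// ler_expR.
suff : \sum_(k < l) f (time_shift (- m%:Z * k%:Z) z) <=
    \sum_(i < l) a / \sum_(j < m) rvol z (0 - (i * m)%N%:Z - j%:Z).
  have := hC l; rewrite /= sumrB sumr_const card_ord -mulr_natr.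
  by lra.
apply: ler_sum => i _; rewrite /f ge_min; apply/orP; right.
rewrite /U le_eqVlt; apply/orP; left; apply/eqP; congr (_ / _).
apply: eq_bigr => j _; rewrite rvol_shift; congr (rvol _ _).
by lia.
Qed.

Lemma mean_rvol_iter n t : (\int[mu]_z (rvol_iter z n t)%:E < +oo)%E.
Proof.
elim: n t => [|n ih] t; first by rewrite integral0_eq.
rewrite /rvol_iter /=; under eq_integral do rewrite EFinD -sumEFin.
have mterm i : measurable_fun [set: paths R]
    (fun z => (cf i (z (t - i%:Z)) * rvol_iter z n (t - i%:Z))%:E).
  apply/measurable_EFinP/measurable_funM; last exact: measurable_rvol_iter.
  exact: (measurableT_comp (mcf i) (measurable_coord _)).
have term0 i z : (0 <= (cf i (z (t - i%:Z)) * rvol_iter z n (t - i%:Z))%:E)%E.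
  by rewrite lee_fin mulr_ge0 ?rvol_iter_ge0.
rewrite ge0_integralD//; last 3 first.
- by move=> z _; rewrite lee_fin ltW.
- by move=> z _; apply: sume_ge0 => i _; exact: term0.
- by apply: emeasurable_sum => i; exact: mterm.
rewrite integral_prob_cst ge0_integral_sum//.
apply: lte_add_pinfty; first exact: ltry.
apply: lte_sum_pinfty => i _.
under eq_integral do rewrite EFinM.
rewrite (ge0_integralM_indep iidmu (I := [pred s | t - i%:Z <= s])
  (f := fun z => (cf i (z (t - i%:Z)))%:E)
  (g := fun z => (rvol_iter z n (t - i%:Z))%:E)); last first.
- move=> z z' zz'; congr EFin; apply: rvol_iter_dep => s /= st.
  by apply: zz'; rewrite inE -ltNge.
- by move=> z z' zz'; rewrite zz'// inE.
- by move=> z; rewrite lee_fin rvol_iter_ge0.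
- by move=> z; rewrite lee_fin.
- by apply/measurable_EFinP; exact: measurable_rvol_iter.
- apply/measurable_EFinP; exact: (measurableT_comp (mcf i) (measurable_coord _)).
have [M M0 hM] := mean_cf_bound.
apply: lte_mul_pinfty; [by apply: integral_ge0 => z _; rewrite lee_fin| |exact: ih].
rewrite ge0_fin_numE; first exact: le_lt_trans (hM i _) (ltry _).
by apply: integral_ge0 => z _; rewrite lee_fin.
Qed.

(* By exponential decay, for small [dl] the [dl]-th powers of late path weights have means
   adding up to at most [1 / 2], so that the recursion contracts in [dl]-th mean. *)
Lemma rvol_moment : exists2 dl : R, 0 < dl <= 1 &
  (\int[mu]_z (rvol z 0 `^ dl)%:E < +oo)%E.
Proof.
have [M M0 hM] := mean_path_weight.
have [kap kap0 hdec] := path_weight_exp_decay.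
pose G (k : nat) (z : paths R) := path_weight (lag_weight z 0) k k.
have G0 k z : 0 <= G k z by exact: lag_path_weight_ge0.
have mG k : measurable_fun [set: paths R] (G k) by exact: measurable_path_weight.
pose X l z := \sum_(j < m) G (l * m + j)%N z.
have X0 l z : 0 <= X l z by apply: sumr_ge0 => j _.
have mX l : measurable_fun [set: paths R] (X l) by exact: measurable_sum.
have mR0 : 0 < m%:R :> R by rewrite ltr0n.
pose D := m%:R * (1 + M) ^+ m.
have M1 : 1 <= 1 + M by rewrite lerDl.
have D1 : 1 <= D.
  by rewrite /D -[leLHS]mulr1 ler_pM// ?ler1n// exprn_ege1.
have EX l : (\int[mu]_z (X l z)%:E <= (D ^+ l.+1)%:E)%E.
  rewrite /X; under eq_integral do rewrite -sumEFin.
  rewrite ge0_integral_sum//; last 2 first.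
  - by move=> j; exact/measurable_EFinP.
  - by move=> j z _; rewrite lee_fin.
  apply: (@le_trans _ _ (\sum_(j < m) ((1 + M) ^+ (l.+1 * m))%:E)%E).
    apply: lee_sum => j _; apply: le_trans (hM _ _ _ (leqnn _)) _.
    rewrite lee_fin; apply: ler_weXn2l => //.
    by rewrite mulSn addnC leq_add2r ltnW.
  rewrite sumEFin lee_fin sumr_const card_ord -mulr_natl /D exprMn -exprM mulnC.
  rewrite ler_wpM2r ?exprn_ge0 ?(le_trans ler01)//.
  by rewrite -[leLHS]expr1; apply: ler_weXn2l; rewrite // ler1n.
have Xdec : \forall z \ae mu, exists C, forall l, X l z <= C * expR (- (kap * l%:R)).
  move: hdec; apply: filterS => z [C hC]; exists (m%:R * C) => l.
  apply: (@le_trans _ _ (\sum_(j < m) C * expR (- (kap * l%:R)))).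
    by apply: ler_sum => j _; apply: hC; rewrite leq_addr.
  by rewrite sumr_const card_ord -[X in X <= _]mulr_natl mulrA lexx.
(* Each of the [m] boundary lags may contribute the fraction [1 / (2 * m)] of the moment, which
   makes one half in total. *)
have e0 : 0 < (2 * m%:R)^-1 :> R by rewrite invr_gt0 mulr_gt0.
have [l [dl [l0 dl01 hX]]] := small_fractional_moment mX X0 D1 EX kap0 Xdec e0.
have /andP[dl0 dl1] := dl01.
exists dl => //.
pose N := (l * m)%N.
pose A z := \sum_(k < N) G k z * a.
have A0 z : 0 <= A z by apply: sumr_ge0 => k _; rewrite mulr_ge0// ltW.
have mA : measurable_fun [set: paths R] A.
  by apply: measurable_sum => k; exact: measurable_funM.
pose W n t z := rvol_iter z n t.
have W0 n t z : 0 <= W n t z by exact: rvol_iter_ge0.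
have mW n t : measurable_fun [set: paths R] (W n t) by exact: measurable_rvol_iter.
have mpow (f : paths R -> R) : measurable_fun [set: paths R] f ->
    measurable_fun [set: paths R] (fun z => (f z `^ dl)%:E).
  move=> mf; apply/measurable_EFinP; exact: (measurableT_comp (measurable_powR _) mf).
have powle (x : R) : 0 <= x -> x `^ dl <= 1 + x.
  move=> x0; have := powR_le_affine dl01 x0 ltr01; by rewrite powR1 mul1r.
have finpow (f : paths R -> R) : measurable_fun [set: paths R] f -> (forall z, 0 <= f z) ->
    (\int[mu]_z (f z)%:E < +oo)%E -> (\int[mu]_z (f z `^ dl)%:E < +oo)%E.
  move=> mf f0 If.
  apply: (@le_lt_trans _ _ (\int[mu]_z (1%:E + (f z)%:E))%E).
    apply: ge0_le_integral => //.
    - by move=> z _; rewrite lee_fin powR_ge0.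
    - exact: mpow.
    - by apply/measurable_EFinP; exact: measurable_funD.
    - by move=> z _; rewrite -EFinD lee_fin powle.
  rewrite ge0_integralD//; last 2 first.
  - by move=> z _; rewrite lee_fin.
  - exact/measurable_EFinP.
  by rewrite integral_prob_cst lte_add_pinfty// ltry.
have IA : (\int[mu]_z (A z)%:E < +oo)%E.
  rewrite /A; under eq_integral do rewrite -sumEFin.
  rewrite ge0_integral_sum//; last 2 first.
  - by move=> k; apply/measurable_EFinP; exact: measurable_funM.
  - by move=> k z _; rewrite lee_fin mulr_ge0// ltW.
  apply: lte_sum_pinfty => k _.
  under eq_integral do rewrite EFinM.
  rewrite ge0_integralZr//; last 3 first.
  - exact/measurable_EFinP.
  - by move=> z _; rewrite lee_fin.
  - by rewrite lee_fin ltW.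
  apply: lte_mul_pinfty; rewrite ?ltry//.
    by apply: integral_ge0 => z _; rewrite lee_fin.
  rewrite ge0_fin_numE; first exact: le_lt_trans (hM _ _ _ (leqnn _)) (ltry _).
  by apply: integral_ge0 => z _; rewrite lee_fin.
have IApow := finpow _ mA A0 IA.
have pow0 (f : paths R -> R) : (0 <= \int[mu]_z (f z `^ dl)%:E)%E.
  by apply: integral_ge0 => z _; rewrite lee_fin powR_ge0.
pose C0 := fine (\int[mu]_z (A z `^ dl)%:E).
have bound n : (\int[mu]_z (W n 0 z `^ dl)%:E <= (2 * C0)%:E)%E.
  have pt z : W n 0 z `^ dl <= A z `^ dl +
      \sum_(j < m) G (N + j)%N z `^ dl * W n (- (N + j)%N%:Z) z `^ dl.
    have h : W n 0 z <= A z + \sum_(j < m) G (N + j)%N z * W n (- (N + j)%N%:Z) z.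
      apply: le_trans (rvol_iter_path_expansion z n 0 N) _; rewrite lerD2l.
      rewrite -{1}[N]add0n big_addn addnC addnK big_mkord; apply: ler_sum => j _.
      rewrite sub0r [(j + N)%N]addnC ler_wpM2r ?rvol_iter_ge0//.
      by apply: path_weight_mono; rewrite ?leq_addr// => *; exact: lag_weight_ge0.
    apply: (@le_trans _ _ ((A z + \sum_(j < m) G (N + j)%N z * W n (- (N + j)%N%:Z) z) `^ dl)).
      apply: ge0_ler_powR h; rewrite ?nnegrE ?(ltW dl0)//.
      by rewrite addr_ge0// sumr_ge0// => j _; rewrite mulr_ge0.
    apply: le_trans (powR_subadd dl01 _ _) _ => //.
      by rewrite sumr_ge0// => j _; rewrite mulr_ge0.
    rewrite lerD2l; apply: le_trans (powR_sum_le _ dl01 _) _.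
      by move=> j; rewrite mulr_ge0.
    by apply: ler_sum => j _; rewrite powRM.
  (* Every single iterate has a finite mean, so the moment [e] is finite and half of it can be moved
     to the left side. *)
  have fin := finpow _ (mW n 0) (W0 n 0) (mean_rvol_iter n 0).
  set e := (\int[mu]_z (W n 0 z `^ dl)%:E)%E.
  have efin : e \is a fin_num.
    by rewrite ge0_fin_numE; [exact: fin|exact: pow0].
  suff : (e <= C0%:E + (2^-1)%:E * e)%E.
    rewrite -(fineK efin) -EFinM -EFinD !lee_fin; lra.
  have mterm j : measurable_fun [set: paths R] (fun z =>
      (G (N + j)%N z `^ dl * W n (- (N + j)%N%:Z) z `^ dl)%:E).
    by apply/measurable_EFinP/measurable_funM; apply/measurable_EFinP; exact: mpow.
  have term0 j z : (0 <= (G (N + j)%N z `^ dl * W n (- (N + j)%N%:Z) z `^ dl)%:E)%E.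
    by rewrite lee_fin mulr_ge0 ?powR_ge0.
  apply: (@le_trans _ _ (\int[mu]_z ((A z `^ dl)%:E +
      \sum_(j < m) (G (N + j)%N z `^ dl * W n (- (N + j)%N%:Z) z `^ dl)%:E))%E).
    apply: ge0_le_integral => //.
    - by move=> z _; rewrite lee_fin powR_ge0.
    - exact: mpow.
    - apply: emeasurable_funD; first exact: mpow.
      by apply: emeasurable_sum => j; exact: mterm.
    - by move=> z _; rewrite sumEFin -EFinD lee_fin pt.
  rewrite ge0_integralD//; last 4 first.
  - by move=> z _; rewrite lee_fin powR_ge0.
  - exact: mpow.
  - by move=> z _; apply: sume_ge0 => j _; exact: term0.
  - by apply: emeasurable_sum => j; exact: mterm.
  rewrite ge0_integral_sum//.
  apply: leeD.
    have Afin : (\int[mu]_z (A z `^ dl)%:E)%E \is a fin_num.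
      by rewrite ge0_fin_numE; [exact: IApow|exact: pow0].
    by rewrite /C0 (fineK Afin).
  apply: (@le_trans _ _ (\sum_(j < m) ((2 * m%:R)^-1)%:E * e)%E); last first.
    rewrite -(fineK efin) -EFinM sumEFin -EFinM lee_fin sumr_const card_ord -mulr_natl.
    rewrite le_eqVlt; apply/orP; left; apply/eqP; field.
    by rewrite gt_eqF.
  apply: lee_sum => j _.
  under eq_integral do rewrite EFinM.
  rewrite (ge0_integralM_indep iidmu (I := [pred s | - (N + j)%N%:Z <= s])
    (f := fun z => (G (N + j)%N z `^ dl)%:E)
    (g := fun z => (W n (- (N + j)%N%:Z) z `^ dl)%:E)); last first.
  - move=> z z' zz'; congr (_ `^ _)%:E; apply: rvol_iter_dep => s /= st.
    by apply: zz'; rewrite inE -ltNge.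
  - move=> z z' zz'; congr (_ `^ _)%:E; apply: path_weight_dep => // s /= st.
    by apply: zz'; move: st; rewrite sub0r inE.
  - by move=> z; rewrite lee_fin powR_ge0.
  - by move=> z; rewrite lee_fin powR_ge0.
  - exact: mpow.
  - exact: mpow.
  apply: lee_pmul; [exact: pow0|exact: pow0| |].
    apply: le_trans hX; apply: ge0_le_integral => //.
    - by move=> z _; rewrite lee_fin powR_ge0.
    - exact: mpow.
    - exact: mpow.
    - move=> z _; rewrite lee_fin; apply: ge0_ler_powR; rewrite ?nnegrE ?(ltW dl0)//.
      by rewrite /X (bigD1 j)//= lerDl sumr_ge0.
  rewrite /e -(ge0_integral_shift iidmu (- (N + j)%N%:Z) (f := fun z => (W n 0 z `^ dl)%:E)).
  - apply: ge0_le_integral => //.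
    + by move=> z _; rewrite lee_fin powR_ge0.
    + exact: mpow.
    + apply: (measurableT_comp (mpow _ (mW n 0)) (measurable_time_shift _)).
    + by move=> z _; rewrite /W rvol_iter_shift add0r.
  - exact: mpow.
  - by move=> z; rewrite lee_fin powR_ge0.
apply: (@le_lt_trans _ _ (2 * C0)%:E); last exact: ltry.
have nd z : nondecreasing_seq (fun n => (W n 0 z `^ dl)%:E).
  move=> i j ij; rewrite lee_fin; apply: ge0_ler_powR; rewrite ?nnegrE ?(ltW dl0)//.
  exact: rvol_iter_nd.
have -> : (\int[mu]_z (rvol z 0 `^ dl)%:E = \int[mu]_z limn (fun n => (W n 0 z `^ dl)%:E))%E.
  apply: ge0_ae_eq_integral => //.
  - by apply: mpow; exact: measurable_rvol.
  - apply: (emeasurable_fun_cvg (fun n => (fun z => (W n 0 z `^ dl)%:E))).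
      by move=> n; exact: mpow.
    by move=> z _; exact: ereal_nondecreasing_is_cvgn.
  - by move=> z _; rewrite lee_fin powR_ge0.
  - move=> z _; apply: lime_ge; first exact: ereal_nondecreasing_is_cvgn.
    by apply: nearW => n; rewrite lee_fin powR_ge0.
  - move: finmu; apply: filterS => z zfin _.
    apply/esym/cvg_lim => //; apply: cvg_EFin; first exact: nearW.
    have V0 := rvol_gt0 zfin 0.
    have cpow : {for rvol z 0, continuous (fun x : R => x `^ dl)}.
      apply: differentiable_continuous; apply/derivable1_diffP.
      by apply: derivable_powR; rewrite in_itv/= V0.
    exact: (continuous_cvg _ cpow (rvol_cvg zfin (t := 0))).
rewrite monotone_convergence//.
- apply: lime_le; last exact: nearW.
  apply: ereal_nondecreasing_is_cvgn => i j ij; apply: ge0_le_integral => //.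
  - by move=> z _; rewrite lee_fin powR_ge0.
  - exact: mpow.
  - exact: mpow.
  - by move=> z _; exact: nd.
- by move=> n; exact: mpow.
- by move=> n z _; rewrite lee_fin powR_ge0.
Qed.

End moments.
End random_recursion.

(** * Uniqueness of the stationary solution *)

Section growth.
Context {R : realType}.

(** Growth below every geometric rate in both time directions: past values enter the infinite
    expansions, future ones the likelihood sums. Products stay in the class because a rate can be
    shared as two square roots. *)
Definition subexp (u : int -> R) := forall r : R, 0 < r < 1 ->
  exists2 C, 0 <= C & forall t : int, `|u t| * r ^+ `|t|%N <= C.

Lemma subexpM (u v : int -> R) : subexp u -> subexp v -> subexp (fun t => u t * v t).
Proof.
move=> hu hv r r01; have /andP[r0 r1] := r01.
have s01 : 0 < Num.sqrt r < 1 by rewrite sqrtr_gt0 r0 -[ltRHS]sqrtr1 ltr_sqrt.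
have [C C0 hC] := hu _ s01; have [D D0 hD] := hv _ s01.
exists (C * D); first exact: mulr_ge0.
move=> t; rewrite normrM -[X in _ * X ^+ _](sqr_sqrtr (ltW r0)) expr2 exprMn mulrACA.
by rewrite ler_pM// mulr_ge0// exprn_ge0// sqrtr_ge0.
Qed.

Lemma subexpD (u v : int -> R) : subexp u -> subexp v -> subexp (fun t => u t + v t).
Proof.
move=> hu hv r r01; have /andP[r0 r1] := r01.
have [C C0 hC] := hu _ r01; have [D D0 hD] := hv _ r01.
exists (C + D); first exact: addr_ge0.
move=> t; apply: (@le_trans _ _ ((`|u t| + `|v t|) * r ^+ `|t|%N)).
  by rewrite ler_wpM2r ?exprn_ge0 ?ler_normD// ltW.
by rewrite mulrDl lerD.
Qed.

Lemma subexp_cst (c : R) : subexp (fun=> c).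
Proof.
move=> r /andP[r0 r1]; exists `|c| => // t.
by rewrite ler_piMr// exprn_ile1// ltW.
Qed.

Lemma subexp_shift (u : int -> R) s : subexp u -> subexp (fun t => u (t + s)).
Proof.
move=> hu r r01; have /andP[r0 r1] := r01.
have [C C0 hC] := hu _ r01.
exists (C / r ^+ `|s|%N); first by rewrite divr_ge0// exprn_ge0// ltW.
move=> t; rewrite ler_pdivlMr ?exprn_gt0// -mulrA -exprD.
apply: le_trans (hC (t + s)); rewrite ler_wpM2l//.
by apply: ler_wiXn2l; [exact: ltW|exact: ltW|lia].
Qed.

Lemma subexp_sum (I : Type) (l : seq I) (u : I -> int -> R) :
  (forall i, subexp (u i)) -> subexp (fun t => \sum_(i <- l) u i t).
Proof.
move=> hu; elim: l => [|i l ih].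
  by under eq_fun do rewrite big_nil; exact: subexp_cst.
by under eq_fun do rewrite big_cons; exact: subexpD.
Qed.

Lemma subexp_le (u v : int -> R) : (forall t, `|u t| <= `|v t|) -> subexp v -> subexp u.
Proof.
move=> uv hv r r01; have /andP[r0 r1] := r01.
have [C C0 hC] := hv _ r01; exists C => // t.
by apply: le_trans (hC t); rewrite ler_wpM2r ?exprn_ge0// ltW.
Qed.

Variable mu : probability (paths R) R.
Hypothesis iidmu : iid_seq mu (fun t z => z t).

(** The sum of all shifted values with weights [r ^ k] has finite mean, so it is finite almost
    surely and bounds each of its terms. *)
Lemma stationary_growth_rate (f : paths R -> R) (r : R) :
  measurable_fun setT f -> (forall z, 0 <= f z) -> (\int[mu]_z (f z)%:E < +oo)%E ->
  0 < r < 1 ->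
  \forall z \ae mu, exists2 C, 0 <= C &
    forall t : int, f (time_shift t z) * r ^+ `|t|%N <= C.
Proof.
move=> mf f0 If /andP[r0 r1].
pose g (k : nat) z := (f (time_shift k%:Z z) + f (time_shift (- k%:Z) z)) * r ^+ k.
have g0 k z : (0 <= (g k z)%:E)%E.
  by rewrite lee_fin mulr_ge0 ?addr_ge0// exprn_ge0// ltW.
have mfs t : measurable_fun [set: paths R] (fun z => f (time_shift t z)).
  exact: (measurableT_comp mf (measurable_time_shift t)).
have mg k : measurable_fun [set: paths R] (fun z => (g k z)%:E).
  apply/measurable_EFinP/measurable_funM => //; exact: measurable_funD.
pose F z : \bar R := (\sum_(0 <= k <oo) (g k z)%:E)%E.
have F0 z : (0 <= F z)%E by apply: nneseries_ge0 => k _ _.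
have mF : measurable_fun [set: paths R] F.
  by apply: ge0_emeasurable_sum => [k z _ _|k _].
set I := (\int[mu]_z (f z)%:E)%E in If.
have I0 : (0 <= I)%E by apply: integral_ge0 => z _; rewrite lee_fin.
have IE : I = (fine I)%:E by rewrite fineK// ge0_fin_numE.
have Ig k : (\int[mu]_z (g k z)%:E = (2 * fine I * r ^+ k)%:E)%E.
  rewrite /g; under eq_integral do rewrite EFinM EFinD.
  rewrite ge0_integralZr//; last 3 first.
  - by apply: emeasurable_funD; exact/measurable_EFinP.
  - by move=> z _; rewrite -EFinD lee_fin addr_ge0.
  - by rewrite lee_fin exprn_ge0// ltW.
  rewrite ge0_integralD//; last 4 first.
  - by move=> z _; rewrite lee_fin.
  - exact/measurable_EFinP.
  - by move=> z _; rewrite lee_fin.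
  - exact/measurable_EFinP.
  have Ish t : (\int[mu]_z (f (time_shift t z))%:E = I)%E.
    apply: (ge0_integral_shift iidmu t (f := fun z => (f z)%:E)).
      exact/measurable_EFinP.
    by move=> z; rewrite lee_fin.
  by rewrite !Ish IE -EFinD -EFinM; congr EFin; ring.
have IF : mu.-integrable setT F.
  apply/integrableP; split => //.
  under eq_integral do rewrite gee0_abs//.
  rewrite /F integral_nneseries//.
  under eq_eseriesr do rewrite Ig.
  have fI0 : 0 <= fine I by exact: fine_ge0.
  apply: (@le_lt_trans _ _ (2 * fine I / (1 - r))%:E); last exact: ltry.
  apply: lime_le.
    by apply: is_cvg_nneseries => k _ _; rewrite lee_fin !mulr_ge0 ?exprn_ge0// ltW.
  apply: nearW => n; rewrite sumEFin lee_fin.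
  have -> : \sum_(0 <= k < n) 2 * fine I * r ^+ k = series (geometric (2 * fine I) r) n by [].
  rewrite geometric_seriesE ?lt_eqF// ler_wpM2r ?invr_ge0 ?subr_ge0 ?(ltW r1)//.
  by rewrite ler_piMr ?mulr_ge0// gerBl exprn_ge0// ltW.
move: (integrable_ae measurableT IF); apply: filterS => z /(_ Logic.I) Fz.
exists (fine (F z)); first exact: fine_ge0.
move=> t; rewrite -lee_fin fineK//.
apply: (@le_trans _ _ (g `|t|%N z)%:E).
  rewrite lee_fin /g ler_wpM2r ?exprn_ge0 ?(ltW r0)//.
  case: (lerP 0 t) => t0.
    by rewrite gez0_abs// lerDl.
  by rewrite ltz0_abs// opprK lerDr.
apply: le_trans (nneseries_lim_ge `|t|%N.+1 _) => //.
by rewrite big_nat_recr//= leeDr// sume_ge0.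
Qed.

Lemma stationary_growth (f : paths R -> R) :
  measurable_fun setT f -> (forall z, 0 <= f z) -> (\int[mu]_z (f z)%:E < +oo)%E ->
  \forall z \ae mu, subexp (fun t => f (time_shift t z)).
Proof.
move=> mf f0 If.
(* Countably many rates tending to [1] keep the exceptional set null; a bound at a rate above [r]
   implies one at [r]. *)
pose rr (n : nat) : R := n.+1%:R / n.+2%:R.
have rr01 n : 0 < rr n < 1.
  by rewrite /rr divr_gt0//= ltr_pdivrMr// mul1r ltr_nat.
have := ae_foralln (fun n => stationary_growth_rate mf f0 If (rr01 n)).
apply: filterS => z hz r /andP[r0 r1].
pose n := Num.truncn (1 - r)^-1.
have rn : r <= rr n.
  have h : (1 - r)^-1 < n.+1%:R by exact: truncnS_gt.
  rewrite /rr ler_pdivlMr// -[n.+2%:R]natr1 mulrDr mulr1.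
  have : 1 < n.+1%:R * (1 - r) by rewrite -ltr_pdivrMr ?subr_gt0// div1r.
  by rewrite mulrBr mulr1; lra.
have [C C0 hC] := hz n; exists C => // t.
rewrite ger0_norm//; apply: le_trans (hC t); rewrite ler_wpM2l//.
by apply: lerXn2r; rewrite ?nnegrE ?(ltW r0) ?(le_trans (ltW r0) rn).
Qed.

Lemma subexp_of_powR (u : int -> R) (d : R) : 0 < d -> (forall t, 0 <= u t) ->
  subexp (fun t => u t `^ d) -> subexp u.
Proof.
move=> d0 u0 hu r /andP[r0 r1].
have rd01 : 0 < r `^ d < 1.
  rewrite powR_gt0//=; have := @gt0_ltr_powR R d d0 r 1.
  by rewrite !nnegrE powR1; apply => //; exact: ltW.
have [C C0 hC] := hu _ rd01; exists (C `^ d^-1); first exact: powR_ge0.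
move=> t; have := hC t; rewrite ger0_norm ?powR_ge0// ger0_norm// => h.
have e : (u t * r ^+ `|t|%N) `^ d = u t `^ d * (r `^ d) ^+ `|t|%N.
  rewrite powRM ?exprn_ge0 ?(ltW r0)//; congr (_ * _).
  by rewrite -(powR_mulrn _ (ltW r0)) -(powR_mulrn _ (powR_ge0 r d)) powRAC.
rewrite -e in h.
have x0 : 0 <= u t * r ^+ `|t|%N by rewrite mulr_ge0// exprn_ge0// ltW.
have -> : u t * r ^+ `|t|%N = ((u t * r ^+ `|t|%N) `^ d) `^ d^-1.
  by rewrite -powRrM divff ?gt_eqF// powRr1.
by apply: (ge0_ler_powR _ _ _ h); rewrite ?nnegrE ?invr_ge0 ?powR_ge0// ltW.
Qed.

End growth.

(** * Identification of the given stationary solution with the minimal one *)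

Section stationary_solution.
Context {R : realType} {d : measure_display} {T : measurableType d}
  (P : probability T R).
Variables (Z : int -> T -> R).
Hypothesis iidZ : iid_seq P Z.

Definition path_of (w : T) : paths R := fun t => Z t w.

Lemma measurable_path_of : measurable_fun setT path_of.
Proof.
by have [mZ _ _] := iidZ; apply: measurable_fun_path => t; exact: mZ.
Qed.

Definition path_of_mfun : {mfun T >-> paths R} := mfun_Sub (mem_set measurable_path_of).

Definition path_law : probability (paths R) R := distribution P path_of_mfun.

Lemma path_lawE A : path_law A = P (path_of @^-1` A).
Proof. by []. Qed.

Lemma iid_path_law : iid_seq path_law (fun t z => z t).
Proof.
have [mZ same ind] := iidZ; split.
- by move=> t; exact: measurable_coord.
- by move=> t B mB; have := same t B mB.
- by move=> n ts B inj mB; have := ind n ts B inj mB.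
Qed.

Lemma ae_path_of (Q : paths R -> Prop) :
  (\forall z \ae path_law, Q z) -> \forall w \ae P, Q (path_of w).
Proof.
move=> [N [mN N0 QN]]; exists (path_of @^-1` N); split => //.
- by rewrite -[X in measurable X]setTI; exact: measurable_path_of.
- by move=> w /= nQ; exact: QN.
Qed.

Lemma integral_path_of (f : paths R -> \bar R) :
  measurable_fun [set: paths R] f -> (forall z, 0 <= f z)%E ->
  (\int[path_law]_z f z = \int[P]_w f (path_of w))%E.
Proof.
move=> mf f0.
by rewrite (ge0_integral_pushforward measurable_path_of P measurableT mf).
Qed.

Variables (m : nat) (a : R) (cf : nat -> R -> R).
Hypotheses (m0 : (0 < m)%N) (a0 : 0 < a) (cf_ge0 : forall i x, 0 <= cf i x)
  (cfm : forall i x, (m < i)%N -> cf i x = 0)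
  (mcf : forall i, measurable_fun setT (cf i)).

Lemma measurable_rvol_finite : measurable [set z : paths R | rvol_finite m a cf z].
Proof.
have -> : [set z : paths R | rvol_finite m a cf z] =
  \bigcap_(k : nat) \bigcup_(B : nat) \bigcap_(n : nat)
    [set z | rvol_iter m a cf z n (int_of_code k) <= B%:R].
  apply/seteqP; split=> z.
    move=> h k _; have [B hB] := h (int_of_code k).
    exists (Num.truncn B).+1 => // n _ /=; apply: le_trans (hB n) _.
    exact/ltW/truncnS_gt.
  move=> h t; have [k <-] := int_of_code_surj t.
  by have [B _ hB] := h k Logic.I; exists B%:R => n; exact: hB.
apply: bigcapT_measurable => k; apply: bigcupT_measurable => B.
apply: bigcapT_measurable => n; rewrite -[X in measurable X]setTI.
have := @measurable_rvol_iter _ m a cf mcf n (int_of_code k) measurableT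
  _ (measurable_itv `]-oo, B%:R]).
by congr (measurable (_ `&` _)); apply/seteqP; split => z /=; rewrite in_itv.
Qed.

Variable S2 : int -> T -> R.
Hypotheses (mS2 : forall t, measurable_fun setT (S2 t)) (S2_ge0 : forall t w, 0 <= S2 t w)
  (S2_law : forall t M, P [set w | M < S2 t w] = P [set w | M < S2 0 w])
  (S2_eq : forall t, \forall w \ae P,
     S2 t w = a + \sum_(1 <= i < m.+1) cf i (Z (t - i%:Z) w) * S2 (t - i%:Z) w).

Lemma ae_forall_int (Q : int -> T -> Prop) :
  (forall t, \forall w \ae P, Q t w) -> \forall w \ae P, forall t, Q t w.
Proof.
move=> h; have := ae_foralln (fun n => h (int_of_code n)).
by apply: filterS => w hw t; have [k <-] := int_of_code_surj t.
Qed.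

(** A nonnegative solution dominates every iterate. This is where finiteness of the minimal solution
    comes from. *)
Lemma rvol_iter_le_S2 : \forall w \ae P, forall n t,
  rvol_iter m a cf (path_of w) n t <= S2 t w.
Proof.
move: (ae_forall_int S2_eq); apply: filterS => w hw n t.
apply: (@rec_iter_le _ m (fun=> a) (fun s i => cf i (Z s w)) _ (S2 ^~ w)) => // s.
by rewrite [leRHS]hw.
Qed.

Lemma ae_rvol_finite : \forall z \ae path_law, rvol_finite m a cf z.
Proof.
exists (~` [set z | rvol_finite m a cf z]); split => //.
  by apply: measurableC; exact: measurable_rvol_finite.
rewrite path_lawE.
have [N [mN N0 hN]] := rvol_iter_le_S2.
apply: (subset_measure0 _ mN) => //.
  rewrite -[X in measurable X]setTI; apply: measurable_path_of => //.
  by apply: measurableC; exact: measurable_rvol_finite.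
move=> w /= nf; apply: hN => /= h; apply: nf => t.
by exists (S2 t w) => n.
Qed.

Lemma measurable_rvol_path t : measurable_fun setT (fun w => rvol m a cf (path_of w) t).
Proof. exact: (measurableT_comp (@measurable_rvol _ m a cf mcf t) measurable_path_of). Qed.

Lemma tight_S2 (e : R) : 0 < e ->
  exists2 M, 0 <= M & (P [set w | (M < S2 0 w)%R] <= e%:E)%E.
Proof.
move=> e0; pose A n := [set w | n%:R < S2 0 w].
have mA n : measurable (A n).
  rewrite -[X in measurable X]setTI.
  have := mS2 0 measurableT (measurable_itv `]n%:R, +oo[).
  by congr (measurable (_ `&` _)); apply/seteqP; split => z /=; rewrite in_itv/= andbT.
have h : (P (A n) @[n --> \oo] --> P (\bigcap_n A n))%E.
  apply: nonincreasing_cvg_mu => //.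
  - exact: le_lt_trans (probability_le1 _ (mA 0%N)) (ltry _).
  - exact: bigcapT_measurable.
  - move=> i j ij; apply/subsetPset => w /=; apply: le_lt_trans.
    by rewrite ler_nat.
have E : \bigcap_n A n = set0.
  apply/seteqP; split => // w h'.
  have := h' (Num.truncn (S2 0 w)).+1 Logic.I.
  by rewrite /A /= ltNge (ltW (truncnS_gt _)).
rewrite E measure0 in h.
have := h; move/fine_cvgP => [_] /cvgrPdist_le/(_ _ e0)[n _ /(_ n (leqnn n))] /=.
rewrite sub0r normrN ger0_norm ?fine_ge0// => hn.
exists n%:R => //; rewrite -(@fineK _ (P _)) ?fin_num_measure//; last exact: mA.
Qed.

(* The difference of two solutions is homogeneous, hence bounded by path weights, which
   tend to [0], times past values of [S2], which are tight by stationarity. *)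
Lemma stationary_solution_rvol t : \forall w \ae P, S2 t w = rvol m a cf (path_of w) t.
Proof.
pose V t w := rvol m a cf (path_of w) t.
pose G k w := path_weight (lag_weight cf (path_of w) t) k k.
(* No mean of [S2] is available; the truncated difference is a bounded variable with the same
   zeros. *)
pose D w := Num.min 1 `|S2 t w - V t w|.
have mD : measurable_fun setT D.
  apply: measurable_minr => //; apply: measurableT_comp => //.
  by apply: measurable_funB => //; exact: measurable_rvol_path.
have D0 w : 0 <= D w by rewrite le_min ler01 normr_ge0.
have mG k : measurable_fun setT (G k).
  exact: (measurableT_comp (@measurable_path_weight _ cf mcf k k t) measurable_path_of).
have G0 k w : 0 <= G k w by exact: lag_path_weight_ge0.
have finP := ae_path_of ae_rvol_finite.
pose h M k w := Num.min 1 (M * G k w).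
have mh M k : measurable_fun setT (h M k).
  by apply: measurable_minr => //; exact: measurable_funM.
have hcvg M : 0 <= M -> (\int[P]_w (h M k w)%:E @[k --> \oo] --> 0%:E)%E.
  move=> M0.
  have [| | | | |_ _] := @dominated_convergence _ _ R P setT measurableT
    (fun k w => (h M k w)%:E) (cst 0%E) (cst 1%E).
  - by move=> k; exact/measurable_EFinP.
  - exact: measurable_cst.
  - move: finP; apply: filterS => w wfin _.
    apply: cvg_EFin; first exact: nearW.
    apply: (@squeeze_cvgr _ _ _ _ (cst 0) (fun k => M * G k w)).
    + apply: nearW => k /=; rewrite /h le_min ler01 mulr_ge0//=.
      by rewrite ge_min lexx orbT.
    + exact: cvg_cst.
    + rewrite -[X in _ --> X](mulr0 M); apply: cvgMr.
      exact: (path_weight_cvg0 m0 a0 cf_ge0 cfm wfin).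
  - exact: finite_measure_integrable_cst.
  - apply: aeW => w k _ /=; rewrite lee_fin ger0_norm ?ge_min ?lexx//.
    by rewrite /h le_min ler01 mulr_ge0.
  by rewrite integral0.
have main M N : 0 <= M -> (\int[P]_w (D w)%:E <=
    \sum_(j < m) (\int[P]_w (h M (N + j)%N w)%:E + P [set w | (M < S2 0 w)%R]))%E.
  move=> M0.
  pose B j := [set w | M < S2 (t - (N + j)%N%:Z) w].
  have mB j : measurable (B j).
    rewrite -[X in measurable X]setTI.
    have := mS2 (t - (N + j)%N%:Z) measurableT (measurable_itv `]M, +oo[).
    by congr (measurable (_ `&` _)); apply/seteqP; split => z /=; rewrite in_itv/= andbT.
  have pt : \forall w \ae P, D w <= \sum_(j < m) (h M (N + j)%N w + \1_(B j) w).
    move: finP (ae_forall_int S2_eq); apply: filterS2 => w wfin weq.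
    pose Dk (k : nat) := S2 (t - k%:Z) w - V (t - k%:Z) w.
    have wVE s := rvolE a0 cf_ge0 wfin s.
    have Dk0 k : 0 <= Dk k.
      rewrite /Dk subr_ge0.
      apply: (@rec_sol_le _ m (fun=> a) (fun s i => cf i (Z s w)) _ _ _ (S2 ^~ w)) => //.
        by move=> _; exact: ltW.
      by move=> s; rewrite [leRHS]weq.
    have DE : Dk 0%N <= \sum_(j < m) G (N + j)%N w * S2 (t - (N + j)%N%:Z) w.
      have -> : Dk 0%N = \sum_(N <= k < N + m)
          path_weight (lag_weight cf (path_of w) t) N k * Dk k.
        rewrite (@path_expansion_eq _ (lag_weight cf (path_of w) t) m m0 _ Dk (cst 0) N).
        + by rewrite big1 ?add0r// => k _; rewrite mulr0.
        + by move=> k i; exact: cfm.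
        move=> k; rewrite add0r /Dk weq [V _ _]wVE opprD addrACA subrr add0r -sumrB.
        apply: eq_bigr => i _; rewrite -mulrBr /lag_weight /path_of.
        by rewrite PoszD opprD addrA.
      rewrite -{1}[N]add0n big_addn addnC addnK big_mkord; apply: ler_sum => j _.
      rewrite [(j + N)%N]addnC ler_pM ?lag_path_weight_ge0//.
        by apply: path_weight_mono; rewrite ?leq_addr// => *; exact: lag_weight_ge0.
      by rewrite /Dk gerBl; exact/ltW/(rvol_gt0 a0 cf_ge0 wfin).
    have D0E : Dk 0%N = S2 t w - V t w by rewrite /Dk subr0.
    have DD : `|S2 t w - V t w| = Dk 0%N by rewrite -D0E ger0_norm.
    have term0 j : 0 <= h M (N + j)%N w + \1_(B j) w.
      by rewrite addr_ge0 ?indicE// /h le_min ler01 mulr_ge0.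
    (* If some past value exceeds [M] or some product [M * G] reaches [1], that single term of the
       sum is already at least [1]; otherwise the path expansion is bounded term by term. *)
    have [/existsP[j hj]|/existsPn nex] :=
        boolP [exists j : 'I_m, (M < S2 (t - (N + j)%N%:Z) w) || (1 <= M * G (N + j)%N w)].
      apply: (@le_trans _ _ 1); first by rewrite /D ge_min lexx.
      rewrite (bigD1 j)//=; apply: ler_wpDr; first by rewrite sumr_ge0.
      case/orP: hj => hj.
        by rewrite indicE mem_set// ler_wpDl// /h le_min ler01 mulr_ge0.
      by rewrite /h min_l// ler_wpDr// indicE.
    rewrite /D DD ge_min; apply/orP; right; apply: le_trans DE _.
    apply: ler_sum => j _; have := nex j; rewrite negb_or -leNgt -ltNge => /andP[h1 h2].
    rewrite /h min_r ?(ltW h2)//; apply: ler_wpDr; first by rewrite indicE.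
    by rewrite mulrC ler_wpM2r.
  apply: (@le_trans _ _ (\int[P]_w (\sum_(j < m) ((h M (N + j)%N w)%:E + (\1_(B j) w)%:E)))%E).
    apply: ae_ge0_le_integral => //.
    - by move=> w _; rewrite lee_fin.
    - exact/measurable_EFinP.
    - move=> w _; apply: sume_ge0 => j _; rewrite -EFinD lee_fin addr_ge0 ?indicE//.
      by rewrite /h le_min ler01 mulr_ge0.
    - apply: emeasurable_sum => j; apply/measurable_EFinP.
      by apply: measurable_funD => //; exact: measurable_indic.
    - move: pt; apply: filterS => w ptw _.
      by under eq_bigr do rewrite -EFinD; rewrite sumEFin lee_fin.
  rewrite ge0_integral_sum//; last 2 first.
  - move=> j; apply/measurable_EFinP.
    by apply: measurable_funD => //; exact: measurable_indic.
  - move=> j w _; rewrite -EFinD lee_fin addr_ge0 ?indicE//.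
    by rewrite /h le_min ler01 mulr_ge0.
  apply: lee_sum => j _; rewrite ge0_integralD//; last 3 first.
  - by move=> w _; rewrite lee_fin /h le_min ler01 mulr_ge0.
  - exact/measurable_EFinP.
  - by apply/measurable_EFinP; exact: measurable_indic.
  by rewrite integral_indic// setIT -(S2_law (t - (N + j)%N%:Z) M).
have ID0 : (\int[P]_w (D w)%:E = 0)%E.
  apply/eqP; rewrite eq_le integral_ge0 ?andbT; last by move=> w _; rewrite lee_fin.
  apply/lee_addgt0Pr => e e0; rewrite add0e.
  have mR0 : 0 < m%:R :> R by rewrite ltr0n.
  have em0 : 0 < e / (2 * m%:R) by rewrite divr_gt0// mulr_gt0.
  have [M M0 hM] := tight_S2 em0.
  have := hcvg M M0; move/fine_cvgP => [[n1 _ hn1] /cvgrPdist_le/(_ _ em0)[n2 _ hn2]].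
  apply: le_trans (main M (n1 + n2)%N M0) _.
  apply: (@le_trans _ _ (\sum_(j < m) ((e / (2 * m%:R))%:E + (e / (2 * m%:R))%:E))%E).
    apply: lee_sum => j _; apply: leeD => //.
    have k1 : (n1 <= n1 + n2 + j)%N by rewrite -addnA leq_addr.
    have k2 : (n2 <= n1 + n2 + j)%N by rewrite addnAC leq_addl.
    have := hn2 _ k2; have := hn1 _ k1 => /= f1.
    rewrite sub0r normrN => h2; rewrite -[leLHS]fineK// lee_fin.
    exact: le_trans (ler_norm _) h2.
  under eq_bigr do rewrite -EFinD.
  rewrite sumEFin lee_fin sumr_const card_ord -mulr_natl le_eqVlt; apply/orP; left.
  by apply/eqP; field; rewrite gt_eqF.
have : ae_eq P setT (EFin \o D) (cst 0%E).
  apply/(ae_eq_integral_abs P measurableT); first exact/measurable_EFinP.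
  by rewrite -[RHS]ID0; apply: eq_integral => w _ /=; rewrite ger0_norm.
apply: filterS => w /(_ Logic.I)/= [] /eqP.
rewrite /D; case: (leP 1 `|S2 t w - V t w|) => _; first by rewrite oner_eq0.
by rewrite normr_eq0 subr_eq0 => /eqP.
Qed.

End stationary_solution.

(** * Monotone parametrization of the volatility *)

Section generalized_parameters.
Context {R : realType}.

(* The conditional variance is linear in
   [alpha_i * (1 - gamma) ^ 2], [alpha_i * (1 + gamma) ^ 2] and monotone in these
   coefficients and in [alpha_0], [beta_j], unlike in [gamma]. *)
Record gparam := GParam {
  g_a : R; g_c : nat -> R; g_d : nat -> R; g_b : nat -> R }.
Implicit Types g : gparam.

Definition gle g g' := [/\ g_a g <= g_a g', forall i, g_c g i <= g_c g' i,
  forall i, g_d g i <= g_d g' i & forall i, g_b g i <= g_b g' i].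

Definition gnonneg g := [/\ 0 <= g_a g, forall i, 0 <= g_c g i,
  forall i, 0 <= g_d g i & forall i, 0 <= g_b g i].

Definition sqpos (y : R) := Num.max y 0 ^+ 2.

Lemma sqpos_ge0 y : 0 <= sqpos y. Proof. exact: sqr_ge0. Qed.

Lemma sqpos_le y : sqpos y <= y ^+ 2.
Proof.
rewrite /sqpos; case: (leP y 0) => y0; last by [].
by rewrite expr0n/= sqr_ge0.
Qed.

Lemma sqpos_split (y g : R) :
  (`|y| - g * y) ^+ 2 = (1 - g) ^+ 2 * sqpos y + (1 + g) ^+ 2 * sqpos (- y).
Proof.
rewrite /sqpos; case: (leP y 0) => y0.
  by rewrite max_l ?oppr_ge0// ler0_norm//; ring.
by rewrite max_r ?oppr_le0 ?ltW// gtr0_norm//; ring.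
Qed.

Lemma sqposM (c y : R) : 0 <= c -> sqpos (c * y) = c ^+ 2 * sqpos y.
Proof. by move=> c0; rewrite /sqpos -{1}(mulr0 c) -maxr_pMr// exprMn. Qed.

Variable m : nat.

Definition ginput g (x : int -> R) (t : int) :=
  g_a g + \sum_(1 <= i < m.+1)
    (g_c g i * sqpos (x (t - i%:Z)) + g_d g i * sqpos (- x (t - i%:Z))).

(* With the returns [X_t] for [x], this is [h_t] started in the infinite past. *)
Definition gvol g (x : int -> R) (t : int) : R :=
  rec_sol m (ginput g x) (fun=> g_b g) t.

(** The rate [l > 1] is small enough for the recursion over the betas to contract sequences growing
    like [l ^ k] into the past. Solutions are unique within this growth class, which contains the
    subexponential sequences. *)
Definition gstable g l := 1 < l /\ (\sum_(1 <= j < m.+1) g_b g j) * l ^+ m < 1.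

Lemma gstable_ex g : gnonneg g -> \sum_(1 <= j < m.+1) g_b g j < 1 ->
  exists l, gstable g l.
Proof.
move=> [_ _ _ b0] b1; have [|r [r0 r1 br]] := @expn_lt_bound _ (\sum_(1 <= j < m.+1) g_b g j) m.
  by rewrite b1 sumr_ge0.
exists r^-1; split; first by rewrite invf_gt1.
by rewrite exprVn -ltr_pdivlMr ?invr_gt0 ?exprn_gt0// div1r invrK.
Qed.

Lemma gle_nonneg g g' : gnonneg g -> gle g g' -> gnonneg g'.
Proof.
move=> [a0 c0 d0 b0] [a1 c1 d1 b1].
by split => [|i|i|i]; [exact: le_trans a1|exact: le_trans (c1 i)|
  exact: le_trans (d1 i)|exact: le_trans (b1 i)].
Qed.

Lemma gle_stable g g' l : gle g g' -> gstable g' l -> gstable g l.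
Proof.
move=> [_ _ _ b1] [l1 h]; split => //; apply: le_lt_trans h.
by rewrite ler_wpM2r ?exprn_ge0 ?(le_trans _ (ltW l1))//; exact: ler_sum.
Qed.

Section volatility.
Variable x : int -> R.
Hypothesis xsub : subexp (fun t => x t ^+ 2).

Lemma ginput_ge0 g t : gnonneg g -> 0 <= ginput g x t.
Proof.
move=> [a0 c0 d0 _]; rewrite addr_ge0// sumr_ge0// => i _.
by rewrite addr_ge0// mulr_ge0// sqpos_ge0.
Qed.

Lemma ginput_le g g' t : gle g g' -> ginput g x t <= ginput g' x t.
Proof.
move=> [a0 c0 d0 _]; rewrite lerD//; apply: ler_sum => i _.
by rewrite lerD// ler_wpM2r// sqpos_ge0.
Qed.

Lemma ginput_subexp g : subexp (ginput g x).
Proof.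
have pos (y : int -> R) : (forall t, y t ^+ 2 = x t ^+ 2) -> subexp (fun t => sqpos (y t)).
  move=> yx; apply: subexp_le xsub => t.
  by rewrite !ger0_norm ?sqpos_ge0 ?sqr_ge0// -yx sqpos_le.
apply: subexpD; first exact: subexp_cst.
apply: subexp_sum => i; apply: subexpD; apply: subexpM; try exact: subexp_cst.
  by apply: (@subexp_shift _ (fun t => sqpos (x t)) (- i%:Z)); exact: pos.
apply: (@subexp_shift _ (fun t => sqpos (- x t)) (- i%:Z)).
by apply: pos => t; rewrite sqrrN.
Qed.

Lemma subexp_backward (u : int -> R) l t : subexp u -> 1 < l ->
  exists2 C, 0 <= C & forall k : nat, `|u (t - k%:Z)| <= C * l ^+ k.
Proof.
move=> /(@subexp_shift _ _ t) hu l1.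
have l0 : 0 < l by exact: lt_trans l1.
have [|C C0 hC] := hu l^-1; first by rewrite invr_gt0 l0 invf_lt1.
exists C => // k; rewrite -ler_pdivrMr ?exprn_gt0// -exprVn.
by have := hC (- k%:Z); rewrite addrC abszN.
Qed.

Section stable.
Variables (g : gparam) (l : R).
Hypotheses (g0 : gnonneg g) (gl : gstable g l).

Let e0 t : 0 <= ginput g x t. Proof. exact: ginput_ge0. Qed.
Let b0 : forall (t : int) i, 0 <= (fun=> g_b g) t i. Proof. by case: g0. Qed.

Lemma gvol_iter_growth t : exists2 C, 0 <= C & forall n (k : nat),
  rec_iter m (ginput g x) (fun=> g_b g) n (t - k%:Z) <= C * l ^+ k.
Proof.
have [l1 bl] := gl; have [_ _ _ b0'] := g0.
have [C C0 hC] := subexp_backward t (ginput_subexp g) l1.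
eexists; last first.
  move=> n k; apply: rec_iter_growth C0 _ _ => //; first exact: ltW.
  by move=> j; apply: le_trans (hC j); rewrite ler_norm.
by rewrite divr_ge0// subr_ge0 ltW.
Qed.

Lemma gvol_bounded t : exists B, forall n,
  rec_iter m (ginput g x) (fun=> g_b g) n t <= B.
Proof.
have [C C0 hC] := gvol_iter_growth t; exists C => n.
by have := hC n 0%N; rewrite subr0 expr0 mulr1.
Qed.

Lemma gvol_ge0 t : 0 <= gvol g x t.
Proof. exact: (rec_sol_ge0 e0 b0 gvol_bounded). Qed.

Lemma gvolE t : gvol g x t =
  ginput g x t + \sum_(1 <= j < m.+1) g_b g j * gvol g x (t - j%:Z).
Proof. exact: (rec_sol_eq e0 b0 gvol_bounded). Qed.

Lemma gvol_ge t : g_a g <= gvol g x t.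
Proof.
have [_ c0 d0 b0'] := g0.
rewrite gvolE /ginput -addrA lerDl addr_ge0// sumr_ge0// => i _.
  by rewrite addr_ge0// mulr_ge0// sqpos_ge0.
by rewrite mulr_ge0// gvol_ge0.
Qed.

Lemma gvol_growth t : exists2 C, 0 <= C & forall k : nat, gvol g x (t - k%:Z) <= C * l ^+ k.
Proof.
have [C C0 hC] := gvol_iter_growth t; exists C => // k.
have h := @rec_sol_cvg _ m _ _ e0 b0 gvol_bounded (t - k%:Z).
by apply: (cvgr_to_le h); apply: nearW => n; exact: hC.
Qed.

Lemma gvol_unique (D : int -> R) : (forall t, 0 <= D t) ->
  (forall t, exists C, forall k : nat, D (t - k%:Z) <= C * l ^+ k) ->
  (forall t, D t = ginput g x t + \sum_(1 <= j < m.+1) g_b g j * D (t - j%:Z)) ->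
  forall t, D t = gvol g x t.
Proof.
move=> D0 Dg Drec t; have [l1 bl] := gl; have [_ _ _ b0'] := g0.
have [C hC] := Dg t; have [C' C'0 hC'] := gvol_growth t.
apply/eqP; rewrite -subr_eq0 -normr_eq0 eq_le normr_ge0 andbT.
have := @homogeneous_le0 R (fun k => `|D (t - k%:Z) - gvol g x (t - k%:Z)|) (g_b g) m
  (C + C') l b0' (ltW l1) bl.
rewrite subr0; apply.
- move=> k; rewrite Drec gvolE opprD addrACA subrr add0r -sumrB.
  apply: le_trans (ler_norm_sum _ _ _) _; apply: ler_sum => j _.
  rewrite -mulrBr normrM ger0_norm// PoszD opprD addrA.
  by [].
- move=> k; apply: le_trans (ler_normB _ _) _; rewrite mulrDl.
  by rewrite !ger0_norm ?gvol_ge0// lerD.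
Qed.

End stable.

Lemma gvol_le g g' l t : gnonneg g -> gle g g' -> gstable g' l ->
  gvol g x t <= gvol g' x t.
Proof.
move=> g0 gg gl; have g0' := gle_nonneg g0 gg.
have cvg u : gnonneg u -> gstable u l ->
    rec_iter m (ginput u x) (fun=> g_b u) n t @[n --> \oo] --> gvol u x t.
  move=> u0 ul; apply: rec_sol_cvg => [s|s i|s]; first exact: ginput_ge0.
    by case: u0.
  exact: gvol_bounded u0 ul s.
have h1 := cvg _ g0 (gle_stable gg gl); have h2 := cvg _ g0' gl.
apply: (ler_cvg_to h1 h2); apply: nearW => n.
have [_ _ _ b1] := gg; have [_ _ _ b0] := g0.
by apply: rec_iter_mono => [s|s i|s|s i]; [exact: ginput_ge0| |exact: ginput_le|].
Qed.

(** Monotonicity in the parameters makes the volatilities converge at every time. The limit solves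
    the limiting recursion and is dominated by the volatility of [gM], so uniqueness within the
    growth class identifies it. *)
Lemma gvol_cvg (g_ : nat -> gparam) g gM l t :
  (forall n, gnonneg (g_ n)) -> (forall n, gle (g_ n) gM) -> gstable gM l ->
  gnonneg g -> gle g gM ->
  (forall n, gle (g_ n) (g_ n.+1)) \/ (forall n, gle (g_ n.+1) (g_ n)) ->
  g_a (g_ n) @[n --> \oo] --> g_a g ->
  (forall i, g_c (g_ n) i @[n --> \oo] --> g_c g i) ->
  (forall i, g_d (g_ n) i @[n --> \oo] --> g_d g i) ->
  (forall i, g_b (g_ n) i @[n --> \oo] --> g_b g i) ->
  gvol (g_ n) x t @[n --> \oo] --> gvol g x t.
Proof.
move=> gn0 gnM gMl g0 ggM mono ca cc cd cb.
have st n := gle_stable (gnM n) gMl.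
have gM0 := gle_nonneg g0 ggM.
have cv s : cvgn (fun n => gvol (g_ n) x s).
  case: mono => mono.
    apply: nondecreasing_is_cvgn.
      by apply/nondecreasing_seqP => n; apply: gvol_le (mono n) (st _).
    by exists (gvol gM x s) => _ [n _ <-]; apply: gvol_le (gnM n) gMl.
  apply: nonincreasing_is_cvgn.
    by apply/nonincreasing_seqP => n; apply: gvol_le (mono n) (st _).
  by exists 0 => _ [n _ <-]; exact: gvol_ge0 (st n) _.
pose L s := limn (fun n => gvol (g_ n) x s).
have cL s : gvol (g_ n) x s @[n --> \oo] --> L s by exact: cv.
suff <- : L t = gvol g x t by [].
have LM s : L s <= gvol gM x s.
  by apply: (cvgr_to_le (cL s)); apply: nearW => n; exact: gvol_le (gnM n) gMl.
apply: (gvol_unique g0 (gle_stable ggM gMl)) => s.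
- by apply: (cvgr_to_ge (cL s)); apply: nearW => n; exact: gvol_ge0 (st n) _.
- have [C _ hC] := gvol_growth gM0 gMl s; exists C => k.
  exact: le_trans (LM _) (hC k).
apply: (@cvg_unique _ (@Rhausdorff R) _ _ _ _ (cL s)).
have -> : (fun n => gvol (g_ n) x s) = (fun n => ginput (g_ n) x s +
    \sum_(1 <= j < m.+1) g_b (g_ n) j * gvol (g_ n) x (s - j%:Z)).
  by apply/funext => n; exact: gvolE (gn0 n) (st n) s.
rewrite /=; apply: cvgD.
  apply: cvgD => //; apply: cvg_sumr => i.
  by apply: cvgD; apply: cvgMl.
by apply: cvg_sumr => j; apply: cvgM.
Qed.

End volatility.
End generalized_parameters.

Section parameter_boxes.
Context {R : realType} {p q : nat}.
Implicit Types th : param R p q.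
Let m := (p + q).+1.

(** Padding with zeros lets both sums run over [1, ..., m]. The order [m = p + q + 1] exceeds [p]
    and [q] and is positive even if both vanish. *)
Definition gparam_of th : gparam := GParam (alph th 0)
  (fun i => if (1 <= i <= p)%N then alph th i * (1 - gam th) ^+ 2 else 0)
  (fun i => if (1 <= i <= p)%N then alph th i * (1 + gam th) ^+ 2 else 0)
  (bet th).

Lemma sum_bet_widen (f : nat -> R) th :
  \sum_(1 <= j < m.+1) bet th j * f j = \sum_(1 <= j < q.+1) bet th j * f j.
Proof.
rewrite (@big_cat_nat _ _ _ q.+1)//=; last by rewrite ltnS (leq_trans (leq_addl p q)).
rewrite [X in _ + X = _](_ : _ = 0) ?addr0// big_nat big1// => j /andP[qj _].
by rewrite bet_out// mul0r.
Qed.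

Lemma ginput_gparam_of th (x : int -> R) t :
  ginput m (gparam_of th) x t = alph th 0 +
    \sum_(1 <= i < p.+1) alph th i * (`|x (t - i%:Z)| - gam th * x (t - i%:Z)) ^+ 2.
Proof.
rewrite /ginput; congr (_ + _).
rewrite (@big_cat_nat _ _ _ p.+1)//=; last by rewrite ltnS (leq_trans (leq_addr q p)).
rewrite [X in _ + X = _](_ : _ = 0) ?addr0; last first.
  rewrite big_nat big1// => j /andP[pj _].
  by rewrite (leqNgt j) pj andbF !mul0r addr0.
rewrite !big_nat; apply: eq_bigr => i ip.
by rewrite sqpos_split -ltnS ip mulrDr !mulrA.
Qed.

Lemma gparam_of_nonneg th : param_space th -> gnonneg (gparam_of th).
Proof.
move=> [a0 ai bj _ _]; split => [|i|i|i] /=; first exact: ltW.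
- by case: ifP => // ip; rewrite mulr_ge0 ?ai// sqr_ge0.
- by case: ifP => // ip; rewrite mulr_ge0 ?ai// sqr_ge0.
- by have [jq|jq] := boolP (1 <= i <= q)%N; [case/andP: (bj _ jq)|rewrite /bet (negbTE jq)].
Qed.

Lemma sum_bet_lt1 th : param_space th -> \sum_(1 <= j < m.+1) bet th j < 1.
Proof.
move=> [_ _ _ b1 _]; have := sum_bet_widen (fun=> 1) th.
by under eq_bigr do rewrite mulr1; move=> ->; under eq_bigr do rewrite mulr1.
Qed.

Definition gup (e : R) (g : gparam) : gparam := GParam (g_a g + e)
  (fun i => g_c g i + e) (fun i => g_d g i + e) (fun i => g_b g i + e).

(** Truncation at [0] keeps the lower corner among the nonnegative coefficients, where the
    comparison lemmas apply. The corners of a box need not come from any [th], which is why they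
    live in [gparam]. *)
Definition glo (e : R) (g : gparam) : gparam := GParam (Num.max 0 (g_a g - e))
  (fun i => Num.max 0 (g_c g i - e)) (fun i => Num.max 0 (g_d g i - e))
  (fun i => Num.max 0 (g_b g i - e)).

Lemma glo_nonneg e (g : gparam) : gnonneg (glo e g).
Proof. by split => [|i|i|i] /=; rewrite le_max lexx. Qed.

Lemma gup_nonneg e (g : gparam) : 0 <= e -> gnonneg g -> gnonneg (gup e g).
Proof. by move=> e0 [*]; split => [|i|i|i] /=; rewrite addr_ge0. Qed.

Lemma gup_mono e e' (g : gparam) : e <= e' -> gle (gup e g) (gup e' g).
Proof. by move=> ee; split => [|i|i|i] /=; rewrite lerD2l. Qed.

Lemma glo_mono e e' (g : gparam) : e <= e' -> gle (glo e' g) (glo e g).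
Proof.
by move=> ee; split => [|i|i|i] /=; rewrite ge_max !le_max lexx/= lerB// orbT.
Qed.

Lemma le_gup e (g : gparam) : 0 <= e -> gle g (gup e g).
Proof. by move=> e0; split => [|i|i|i] /=; rewrite lerDl. Qed.

Lemma glo_le e (g : gparam) : 0 <= e -> gnonneg g -> gle (glo e g) g.
Proof. by move=> e0 [*]; split => [|i|i|i] /=; rewrite ge_max gerBl e0 andbT. Qed.

Lemma gle_trans (g1 g2 g3 : @gparam R) : gle g1 g2 -> gle g2 g3 -> gle g1 g3.
Proof.
move=> [a1 c1 d1 b1] [a2 c2 d2 b2]; split => [|i|i|i].
- exact: le_trans a2.
- exact: le_trans (c2 i).
- exact: le_trans (d2 i).
- exact: le_trans (b2 i).
Qed.

Lemma gup_stable (g : gparam) : gnonneg g -> \sum_(1 <= j < m.+1) g_b g j < 1 ->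
  exists e l, [/\ 0 < e, gstable m (gup e g) l & \sum_(1 <= j < m.+1) g_b (gup e g) j < 1].
Proof.
move=> g0 b1; set s := \sum_(1 <= j < m.+1) g_b g j in b1.
(* Raising each of the [m] coefficients by [e] uses up half of the gap [1 - s]. *)
pose e := (1 - s) / (m%:R * 2).
have m0 : 0 < m%:R :> R by rewrite ltr0n.
have e0 : 0 < e by rewrite divr_gt0 ?subr_gt0// mulr_gt0.
have sE : \sum_(1 <= j < m.+1) g_b (gup e g) j < 1.
  rewrite /= big_split/= -/s sumr_const_nat subn1/=.
  have -> : e *+ m = (1 - s) / 2 by rewrite -mulr_natr /e; field; rewrite gt_eqF.
  lra.
have [l hl] := gstable_ex (gup_nonneg (ltW e0) g0) sE.
by exists e, l.
Qed.

Section limits.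
Variables (x : int -> R) (e_ : nat -> R) (g : @gparam R) (l : R).
Hypotheses (xsub : subexp (fun t => x t ^+ 2)) (e0 : forall n, 0 <= e_ n)
  (e_ni : forall n, e_ n.+1 <= e_ n) (e_cvg : e_ n @[n --> \oo] --> 0)
  (g0 : gnonneg g) (gl : gstable m (gup (e_ 0%N) g) l).

Let e_le0 n : e_ n <= e_ 0%N.
Proof. by elim: n => // n; apply: le_trans. Qed.

Lemma gvol_gup_cvg t : gvol m (gup (e_ n) g) x t @[n --> \oo] --> gvol m g x t.
Proof.
have addc (c : R) : c + e_ n @[n --> \oo] --> c.
  by rewrite -[X in _ --> X]addr0; apply: cvgD => //; exact: cvg_cst.
apply: (gvol_cvg xsub _ _ gl g0) => [n|n| | | |i|i|i] /=; try exact: addc.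
- exact: gup_nonneg.
- exact: gup_mono.
- exact: le_gup.
- by right => n; exact: gup_mono.
Qed.

Lemma gvol_glo_cvg t : gvol m (glo (e_ n) g) x t @[n --> \oo] --> gvol m g x t.
Proof.
have subc (c : R) : 0 <= c -> Num.max 0 (c - e_ n) @[n --> \oo] --> c.
  move=> c0; rewrite -[X in _ --> X](max_r c0).
  have : c - e_ n @[n --> \oo] --> c.
    by rewrite -[X in _ --> X]subr0; apply: cvgB => //; exact: cvg_cst.
  have -> : (fun n => Num.max 0 (c - e_ n)) = (fun n => ((c - e_ n) + `|c - e_ n|) / 2).
    apply/funext => n; have [h|h] := leP 0 (c - e_ n).
      by rewrite ger0_norm//; lra.
    by rewrite ltr0_norm//; lra.
  move=> h; have -> : Num.max 0 c = (c + `|c|) / 2 by rewrite max_r// ger0_norm//; lra.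
  by apply: cvgMl; apply: cvgD => //; exact: cvg_norm.
have [ga gc gd gb] := g0.
apply: (gvol_cvg xsub _ _ gl g0) => [n|n| | | |i|i|i] /=; try exact: subc.
- exact: glo_nonneg.
- by apply: (gle_trans (glo_le (e0 n) g0)); exact: le_gup.
- exact: le_gup.
- by left => n; exact: glo_mono.
Qed.

End limits.

Lemma near_coordinate_box (f : nat -> param R p q -> R) (n : nat) th (e : R) : 0 < e ->
  (forall i, f i t @[t --> th] --> f i th) -> (forall i t, (n <= i)%N -> f i t = 0) ->
  \forall t \near th, forall i, 0 <= f i t ->
    f i t <= f i th + e /\ Num.max 0 (f i th - e) <= f i t.
Proof.
move=> e0 cf out; have filt : Filter (nbhs th) by exact: nbhs_filter.
have : \forall t \near th, forall i : 'I_n, f i th - e <= f i t <= f i th + e.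
  apply: (@filter_forall _ 'I_n (fun i t => f i th - e <= f i t <= f i th + e) (nbhs th)) => i.
  move: (cf i) => /cvgrPdist_le/(_ _ e0); apply: filterS => t.
  by rewrite ler_distl => /andP[h1 h2]; apply/andP; split; lra.
apply: filterS => t h i ft0; have [iN|Ni] := ltnP i n.
  by have /andP[h1 h2] := h (Ordinal iN); rewrite ge_max ft0 h1.
by rewrite !out// add0r (ltW e0) ge_max lexx sub0r oppr_le0 (ltW e0).
Qed.

Lemma gparam_of_nbhs th (e : R) : 0 < e -> param_space th ->
  \forall th' \near th, param_space th' ->
    gle (gparam_of th') (gup e (gparam_of th)) /\ gle (glo e (gparam_of th)) (gparam_of th').
Proof.
move=> e0 thP; have filt : Filter (nbhs th) by exact: nbhs_filter.
have cc (i : 'I_(p.+1 + q).+1) : (fun t : param R p q => t 0 i) @ th --> th 0 i.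
  exact: coord_continuous.
have ca i : alph t i @[t --> th] --> alph th i by exact: cc.
have cg : gam t @[t --> th] --> gam th by exact: cc.
have cb i : bet t i @[t --> th] --> bet th i.
  have [h|h] := boolP (0 < i <= q)%N; last first.
    by apply: cvg_near_cst; apply: nearW => t; rewrite /bet (negbTE h).
  have bE : (fun t : param R p q => bet t i) = (fun t => t 0 (inord (p + i))).
    by apply/funext => t; rewrite /bet h.
  by rewrite bE /bet h; exact: cc.
have cC i : g_c (gparam_of t) i @[t --> th] --> g_c (gparam_of th) i.
  rewrite /=; case: ifP => _; last exact: cvg_cst.
  by apply: cvgM => //; apply: cvgM; apply: cvgB => //; exact: cvg_cst.
have cD i : g_d (gparam_of t) i @[t --> th] --> g_d (gparam_of th) i.
  rewrite /=; case: ifP => _; last exact: cvg_cst.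
  by apply: cvgM => //; apply: cvgM; apply: cvgD => //; exact: cvg_cst.
have outp i : (m <= i)%N -> (0 < i <= p)%N = false.
  move=> im; have ip : (p < i)%N by apply: leq_trans im; rewrite ltnS leq_addr.
  by rewrite (leqNgt i p) ip andbF.
have outC i t : (m <= i)%N -> g_c (gparam_of t) i = 0 by move=> /outp /= ->.
have outD i t : (m <= i)%N -> g_d (gparam_of t) i = 0 by move=> /outp /= ->.
have outB i (t : param R p q) : (m <= i)%N -> bet t i = 0.
  by move=> im; apply: bet_out; apply: leq_trans im; rewrite ltnS leq_addl.
have nC := near_coordinate_box (f := fun i t => g_c (gparam_of t) i) e0 cC outC.
have nD := near_coordinate_box (f := fun i t => g_d (gparam_of t) i) e0 cD outD.
have nB := near_coordinate_box (f := fun i t => bet t i) e0 cb outB.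
have nA : \forall t \near th, `|alph th 0 - alph t 0| <= e by move/cvgrPdist_le: (ca 0%N); exact.
apply: filterS (filterI nA (filterI nC (filterI nD nB))) => t [hA [hC [hD hB]]] tP.
have [ta tc td tb] := gparam_of_nonneg tP.
have {}hC i := hC i (tc i); have {}hD i := hD i (td i); have {}hB i := hB i (tb i).
move: hA; rewrite ler_distl => /andP[hA1 hA2].
split; split => [|i|i|i] /=; try by [case: (hC i)|case: (hD i)|case: (hB i)].
  by lra.
by rewrite ge_max [0 <= _]ta/=; lra.
Qed.

End parameter_boxes.

(** * Error of the recursively computed volatility *)

Section recursive_estimator.
Context {R : realType} {p q : nat}.
Implicit Types th : param R p q.
Let m := (p + q).+1.
Variables (x : int -> R) (v : 'I_q -> R).
Hypothesis v0 : forall j, 0 <= v j.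

(* The recursion re-indexed so that time [s - (p + q)] has index [s]. *)
Definition hlag th (s : nat) : R := nth 0 (hs th x v s) (p + q).

Lemma nth_hs_addl th t k i : nth 0 (hs th x v (t + k)) (i + k) = nth 0 (hs th x v t) i.
Proof. by elim: k => [|k ih]; rewrite ?addn0// !addnS. Qed.

Lemma hhat_hlag th t : hhat th x v t = hlag th (t + (p + q)).
Proof. by rewrite /hlag -[X in nth _ _ X]add0n nth_hs_addl nth0. Qed.

Lemma hs_ge0 th t i : param_space th -> 0 <= nth 0 (hs th x v t) i.
Proof.
move=> thP; elim: t i => [|t ih] i /=.
  have [iq|iq] := ltnP i q; last by rewrite nth_default// size_map size_enum_ord.
  by rewrite (nth_map (Ordinal iq)) ?size_enum_ord.
case: i => [|i] //=; case: thP => a0 ai bj _ _.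
rewrite addr_ge0// ?addr_ge0 ?(ltW a0)//.
  by rewrite big_nat sumr_ge0// => i ip; rewrite mulr_ge0 ?ai// sqr_ge0.
by rewrite big_nat sumr_ge0// => j jq; rewrite mulr_ge0//; case/andP: (bj j jq).
Qed.

(** These indices are the times up to [0]: the entry is an initial value, or the default [0] of
    [nth] before time [- q + 1]. The bound is the same for all [th], which makes the decay constants
    uniform. *)
Lemma hlag_init th s : (s < m)%N -> hlag th s <= \sum_j v j.
Proof.
rewrite ltnS => sm; rewrite /hlag -(subnK sm) -[X in hs _ _ _ X]add0n nth_hs_addl /=.
have [iq|iq] := ltnP (p + q - s) q; last first.
  by rewrite nth_default ?sumr_ge0// size_map size_enum_ord.
rewrite (nth_map (Ordinal iq)) ?size_enum_ord//.
rewrite [nth _ _ _](_ : _ = Ordinal iq); last by apply: val_inj; rewrite /= nth_enum_ord.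
by rewrite (bigD1 (Ordinal iq))//= lerDl sumr_ge0.
Qed.

Lemma hlag_rec th s : (m <= s)%N -> hlag th s =
  ginput m (gparam_of th) x (s%:Z - (p + q)%:Z)
  + \sum_(1 <= j < m.+1) bet th j * hlag th (s - j).
Proof.
move=> ms; have [t st] : exists t, s = (t.+1 + (p + q))%N.
  by exists (s - m)%N; rewrite /m in ms *; lia.
rewrite st -hhat_hlag /hhat /= ginput_gparam_of sum_bet_widen.
rewrite (_ : (t.+1 + (p + q))%N%:Z - (p + q)%:Z = t.+1%:Z); last by rewrite PoszD addrK.
congr (_ + _); rewrite !big_nat; apply: eq_bigr => j /andP[j1 jq].
congr (_ * _); rewrite /hlag.
have -> : (t.+1 + (p + q) - j = t + (p + q - j.-1))%N by move: jq; rewrite ltnS; lia.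
rewrite -[X in _ = nth _ _ X](_ : j.-1 + (p + q - j.-1) = p + q)%N ?nth_hs_addl//.
by move: jq; rewrite ltnS; lia.
Qed.

Section comparison.
Hypothesis xsub : subexp (fun t => x t ^+ 2).
Variables (g : @gparam R) (l : R).
Hypotheses (g0 : gnonneg g) (gl : gstable m g l).

Let b1 : \sum_(1 <= j < m.+1) g_b g j < 1.
Proof.
have [l1 h] := gl; apply: le_lt_trans h.
rewrite -[leLHS]mulr1 ler_wpM2l//; last exact/exprn_ege1/ltW.
by case: g0 => _ _ _ b0; exact: sumr_ge0.
Qed.

Let timeE s j : (m <= s)%N -> (j <= m)%N ->
  (s - j)%N%:Z - (p + q)%:Z = s%:Z - (p + q)%:Z - j%:Z.
Proof. by lia. Qed.

(** The order of the coefficients makes the difference of the two volatilities a subsolution of the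
    homogeneous recursion with the betas of the corner [g]. Its decay constants serve all parameters
    below [g] at once. *)
Lemma hhat_le_gvol : exists C r, [/\ 0 <= C, 0 < r, r < 1 &
  forall th, param_space th -> gle (gparam_of th) g ->
  forall t, hhat th x v t <= gvol m g x t%:Z + C * r ^+ t].
Proof.
have [_ _ _ b0] := g0.
have A0 : 0 <= \sum_j v j by exact: sumr_ge0.
have [C [r [C0 r0 r1 h]]] := forward_decay b0 b1 A0.
exists (C * r ^+ (p + q)), r; split => //; first by rewrite mulr_ge0 ?exprn_ge0// ltW.
move=> th thP gg t.
rewrite -lerBlDl -mulrA -exprD addnC hhat_hlag.
pose u s := hlag th s - gvol m g x (s%:Z - (p + q)%:Z).
have -> : gvol m g x t%:Z = gvol m g x ((t + (p + q))%N%:Z - (p + q)%:Z).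
  by rewrite PoszD addrK.
apply: (h u) => {t} s sm.
  by rewrite /u; apply: le_trans (hlag_init th sm); rewrite gerBl (gvol_ge0 xsub g0 gl).
rewrite {1}/u (hlag_rec th sm) (gvolE xsub g0 gl) opprD addrACA.
apply: (@le_trans _ _ (0 + (\sum_(1 <= j < m.+1) g_b g j * hlag th (s - j)
   - \sum_(1 <= j < m.+1) g_b g j * gvol m g x (s%:Z - (p + q)%:Z - j%:Z)))).
  apply: lerD; first by rewrite subr_le0; exact: ginput_le.
  rewrite lerD2r; apply: ler_sum => j _; rewrite ler_wpM2r ?hs_ge0//.
  by case: gg => _ _ _ h4; exact: h4.
rewrite add0r -sumrB !big_nat; apply: ler_sum => j /andP[_ jm].
by rewrite -mulrBr /u timeE.
Qed.

Lemma gvol_le_hhat : exists C r, [/\ 0 <= C, 0 < r, r < 1 &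
  forall th, param_space th -> gle g (gparam_of th) ->
  forall t, gvol m g x t%:Z <= hhat th x v t + C * r ^+ t].
Proof.
have [_ _ _ b0] := g0.
pose A := \sum_(s < m) gvol m g x (s%:Z - (p + q)%:Z).
have A0 : 0 <= A by apply: sumr_ge0 => s _; exact: (gvol_ge0 xsub g0 gl).
have [C [r [C0 r0 r1 h]]] := forward_decay b0 b1 A0.
exists (C * r ^+ (p + q)), r; split => //; first by rewrite mulr_ge0 ?exprn_ge0// ltW.
move=> th thP gg t.
rewrite -lerBlDl -mulrA -exprD addnC hhat_hlag.
pose u s := gvol m g x (s%:Z - (p + q)%:Z) - hlag th s.
have -> : gvol m g x t%:Z = gvol m g x ((t + (p + q))%N%:Z - (p + q)%:Z).
  by rewrite PoszD addrK.
apply: (h u) => {t} s sm.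
  rewrite /u; apply: (@le_trans _ _ (gvol m g x (s%:Z - (p + q)%:Z))).
    by rewrite gerBl hs_ge0.
  rewrite /A (bigD1 (Ordinal sm))//= lerDl sumr_ge0// => i _.
  exact: (gvol_ge0 xsub g0 gl).
rewrite {1}/u (hlag_rec th sm) (gvolE xsub g0 gl) opprD addrACA.
apply: (@le_trans _ _ (0 + (\sum_(1 <= j < m.+1) g_b g j * gvol m g x (s%:Z - (p + q)%:Z - j%:Z)
   - \sum_(1 <= j < m.+1) g_b g j * hlag th (s - j)))).
  apply: lerD; first by rewrite subr_le0; exact: ginput_le.
  rewrite lerD2l lerN2; apply: ler_sum => j _; rewrite ler_wpM2r ?hs_ge0//.
  by case: gg => _ _ _ h4; exact: h4.
rewrite add0r -sumrB !big_nat; apply: ler_sum => j /andP[_ jm].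
by rewrite -mulrBr /u timeE.
Qed.

End comparison.

End recursive_estimator.

Section gvol_functional.
Context {R : realType}.
Variables (m : nat) (g : @gparam R).

Lemma measurable_sqpos : measurable_fun [set: R] sqpos.
Proof. by apply: measurable_funX; apply: measurable_maxr. Qed.

Lemma ginput_ext (x x' : int -> R) t : (forall s, s < t -> x s = x' s) ->
  ginput m g x t = ginput m g x' t.
Proof.
move=> xx; congr (_ + _); rewrite !big_nat; apply: eq_bigr => i /andP[i1 _].
by rewrite xx// ltrBlDr ltrDl.
Qed.

Lemma gvol_ext (x x' : int -> R) t : (forall s, s < t -> x s = x' s) ->
  gvol m g x t = gvol m g x' t.
Proof.
move=> xx.
have it n u : u <= t -> rec_iter m (ginput m g x) (fun=> g_b g) n u =
    rec_iter m (ginput m g x') (fun=> g_b g) n u.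
  elim: n u => //= n ih u ut; rewrite (@ginput_ext x x' u); last first.
    by move=> s su; apply: xx; exact: lt_le_trans ut.
  congr (_ + _); apply: eq_bigr => i _; congr (_ * _).
  by apply: ih; apply: le_trans ut; rewrite gerBl.
rewrite /gvol /rec_sol; congr (fine (ereal_sup _)).
rewrite (_ : (fun n => _) = (fun n => (rec_iter m (ginput m g x') (fun=> g_b g) n t)%:E))//.
by apply/funext => n; rewrite it.
Qed.

Lemma gvol_shift (x : int -> R) s t :
  gvol m g (fun u => x (u + s)) t = gvol m g x (t + s).
Proof.
rewrite /gvol -(rec_sol_shift m (ginput m g x) (fun=> g_b g)).
congr (rec_sol m _ _ t); apply/funext => u; congr (_ + _).
by apply: eq_bigr => i _; rewrite addrAC.
Qed.

Lemma measurable_gvol d (T : measurableType d) (x : T -> int -> R) t :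
  (forall s, measurable_fun setT (x ^~ s)) ->
  measurable_fun [set: T] (fun z => gvol m g (x z) t).
Proof.
move=> mx.
have me s : measurable_fun setT (fun z => ginput m g (x z) s).
  apply: measurable_funD => //; apply: measurable_sum => i.
  apply: measurable_funD; apply: measurable_funM => //.
    exact: (measurableT_comp measurable_sqpos (mx _)).
  apply: (measurableT_comp measurable_sqpos); exact: measurableT_comp.
have mi n s : measurable_fun setT (fun z => rec_iter m (ginput m g (x z)) (fun=> g_b g) n s).
  elim: n s => [|n ih] s; first exact: measurable_cst.
  apply: measurable_funD => //; apply: measurable_sum => i.
  exact: measurable_funM.
apply: (measurableT_comp (fine_measurable measurableT)).
have := @measurable_fun_esups _ T R setT
  (fun n z => (rec_iter m (ginput m g (x z)) (fun=> g_b g) n t)%:E) (fun n => _) 0%N.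
rewrite /esups /sdrop /=.
rewrite (_ : (fun z => _) = (fun z => ereal_sup (range (fun n =>
    (rec_iter m (ginput m g (x z)) (fun=> g_b g) n t)%:E)))).
  by apply => n; apply/measurable_EFinP; exact: mi.
by apply/funext => z; congr ereal_sup; apply/seteqP; split=> y [k _ <-]; exists k.
Qed.

End gvol_functional.

(** * Volatility and returns as functions of the innovations *)

Section agarch_paths.
Context {R : realType} {p q : nat}.
Variable th : param R p q.
Let m := (p + q).+1.
Implicit Types z : paths R.

(* [avol] and [aret] are [sigma_t ^ 2] and [X_t] as functions of the innovations. *)
Definition acoef (i : nat) (x : R) : R :=
  (if (1 <= i <= p)%N then alph th i else 0) * (`|x| - gam th * x) ^+ 2 + bet th i.

Definition avol z (t : int) : R := rvol m (alph th 0) acoef z t.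

Definition aret z (t : int) : R := Num.sqrt (avol z t) * z t.

Hypothesis thP : param_space th.

Let a0 : 0 < alph th 0. Proof. by case: thP. Qed.

Lemma acoef_ge0 i x : 0 <= acoef i x.
Proof.
case: thP => _ ai bj _ _; rewrite /acoef; apply: addr_ge0.
  by case: ifP => h; rewrite mulr_ge0 ?sqr_ge0 ?ai.
by have [jq|jq] := boolP (1 <= i <= q)%N; [case/andP: (bj _ jq)|rewrite /bet (negbTE jq)].
Qed.

Lemma acoef_out i x : (m < i)%N -> acoef i x = 0.
Proof.
move=> mi; rewrite /acoef /bet.
have pi : (p < i)%N by apply: leq_ltn_trans mi; rewrite /m -addnS leq_addr.
have qi : (q < i)%N by apply: leq_ltn_trans mi; rewrite /m -addSn leq_addl.
by rewrite !(leqNgt i) pi qi !andbF mul0r addr0.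
Qed.

Lemma measurable_acoef i : measurable_fun setT (acoef i).
Proof.
apply: measurable_funD => //; apply: measurable_funM => //.
apply: measurable_funX; apply: measurable_funB; last exact: measurable_funM.
exact: normr_measurable.
Qed.

Lemma measurable_avol t : measurable_fun [set: paths R] (avol ^~ t).
Proof. exact: measurable_rvol measurable_acoef t. Qed.

Lemma measurable_aret t : measurable_fun [set: paths R] (aret ^~ t).
Proof.
apply: measurable_funM; last exact: measurable_coord.
apply: (measurableT_comp (continuous_measurable_fun (@sqrt_continuous R))).
exact: measurable_avol.
Qed.

Lemma avol_dep t : depends_on [pred s | s < t] (avol ^~ t).
Proof. exact: rvol_dep. Qed.

Lemma aret_dep t : depends_on [pred s | s <= t] (aret ^~ t).
Proof.
move=> z z' zz'; rewrite /aret (@avol_dep t z z') ?zz'//= ?inE//.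
by move=> s /= st; rewrite zz'//= ltW.
Qed.

Lemma avol_shift z t s : avol (time_shift s z) t = avol z (t + s).
Proof. exact: rvol_shift. Qed.

Lemma aret_shift z t s : aret (time_shift s z) t = aret z (t + s).
Proof. by rewrite /aret avol_shift. Qed.

Lemma gvol_aret_shift g z t s :
  gvol m g (aret (time_shift s z)) t = gvol m g (aret z) (t + s).
Proof.
by rewrite -gvol_shift; congr (gvol _ _ _ t); apply/funext => u; exact: aret_shift.
Qed.

Lemma gvol_aret_dep g t : depends_on [pred s | s < t] (fun z => gvol m g (aret z) t).
Proof.
move=> z z' zz'; apply: gvol_ext => s st; apply: aret_dep => u /= us.
by apply: zz'; exact: le_lt_trans st.
Qed.

(** On such a path the comparisons between volatilities are deterministic; the null sets are
    collected here. *)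
Definition regular_path z := [/\ rvol_finite m (alph th 0) acoef z,
  subexp (avol z), subexp (fun t => z t ^+ 2) & subexp (fun t => aret z t ^+ 2)].

Section regular.
Variable z : paths R.
Hypothesis zr : regular_path z.

Let zfin : rvol_finite m (alph th 0) acoef z. Proof. by case: zr. Qed.

Lemma avol_gt0 t : 0 < avol z t.
Proof. exact: (rvol_gt0 a0 acoef_ge0 zfin). Qed.

Lemma avol_ge t : alph th 0 <= avol z t.
Proof. exact: (rvol_ge a0 acoef_ge0 zfin). Qed.

Lemma sqr_aret t : aret z t ^+ 2 = avol z t * z t ^+ 2.
Proof. by rewrite /aret exprMn sqr_sqrtr// ltW// avol_gt0. Qed.

Lemma sqpos_aret t : sqpos (aret z t) = avol z t * sqpos (z t).
Proof. by rewrite /aret sqposM ?sqrtr_ge0// sqr_sqrtr// ltW// avol_gt0. Qed.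

Lemma sqposN_aret t : sqpos (- aret z t) = avol z t * sqpos (- z t).
Proof. by rewrite /aret -mulrN sqposM ?sqrtr_ge0// sqr_sqrtr// ltW// avol_gt0. Qed.

(** Invertibility at the true parameter: written in terms of the returns, the recursion of the
    squared volatility has only the betas as coefficients, and [gvol] is its unique solution of
    moderate growth. *)
Lemma avol_gvol t : avol z t = gvol m (gparam_of th) (aret z) t.
Proof.
have [_ Vsub _ xsub] := zr; have g0 := gparam_of_nonneg thP.
have [l gl] := gstable_ex g0 (sum_bet_lt1 thP).
apply: (gvol_unique xsub g0 gl) => {}t.
- exact/ltW/avol_gt0.
- have [C C0 hC] := subexp_backward t Vsub gl.1; exists C => k.
  exact: le_trans (ler_norm _) (hC k).
rewrite /avol (rvolE a0 acoef_ge0 zfin) -/(avol z t) /ginput -addrA; congr (_ + _).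
rewrite -big_split/=; apply: eq_bigr => i _.
rewrite -/(avol z (t - i%:Z)) sqpos_aret sqposN_aret /acoef sqpos_split.
by case: ifP => _; ring.
Qed.

End regular.

Variable mu : probability (paths R) R.
Hypothesis iidmu : iid_seq mu (fun t z => z t).
Hypothesis Ez2 : (\int[mu]_z ((z 0) ^+ 2)%:E = 1)%E.
Hypothesis finmu : \forall z \ae mu, rvol_finite m (alph th 0) acoef z.

Lemma mean_acoef i : (\int[mu]_z (acoef i (z 0))%:E < +oo)%E.
Proof.
have [_ ai bj _ /andP[gl gu]] := thP.
set c := if (1 <= i <= p)%N then alph th i else 0.
have c0 : 0 <= c by rewrite /c; case: ifP => // h; exact: ai.
have b0 : 0 <= bet th i.
  by have [jq|jq] := boolP (1 <= i <= q)%N; [case/andP: (bj _ jq)|rewrite /bet (negbTE jq)].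
apply: (@le_lt_trans _ _ (\int[mu]_z ((c * 4)%:E * ((z 0) ^+ 2)%:E + (bet th i)%:E))%E).
  apply: ge0_le_integral => //.
  - by move=> z _; rewrite lee_fin acoef_ge0.
  - by apply/measurable_EFinP; apply: (measurableT_comp (measurable_acoef i)); exact: measurable_coord.
  - apply/measurable_EFinP; apply: measurable_funD => //; apply: measurable_funM => //.
    by apply: measurable_funX; exact: measurable_coord.
  move=> z _; rewrite -EFinM -EFinD lee_fin lerD2r -/c -mulrA ler_wpM2l//.
  have -> : 4 * z 0 ^+ 2 = (2 * `|z 0|) ^+ 2 by rewrite exprMn real_normK ?num_real//; ring.
  rewrite -ler_sqrt ?sqr_ge0// !sqrtr_sqr [leRHS]ger0_norm ?mulr_ge0//.
  apply: le_trans (ler_normB _ _) _; rewrite normr_id normrM mulr2n mulrDl mul1r lerD2l.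
  by rewrite ler_piMl// ler_norml gl.
rewrite ge0_integralD//; last 2 first.
- by move=> z _; rewrite -EFinM lee_fin; apply: mulr_ge0; [exact: mulr_ge0|exact: sqr_ge0].
- by apply/measurable_EFinP; apply: measurable_funM => //;
    apply: measurable_funX; exact: measurable_coord.
rewrite ge0_integralZl//; last 3 first.
- by apply/measurable_EFinP; apply: measurable_funX; exact: measurable_coord.
- by move=> z _; rewrite lee_fin sqr_ge0.
- by rewrite lee_fin mulr_ge0.
by rewrite Ez2 integral_prob_cst mule1 -EFinD ltry.
Qed.

Lemma avol_moment : exists2 dl : R, 0 < dl <= 1 &
  (\int[mu]_z (avol z 0 `^ dl)%:E < +oo)%E.
Proof.
exact: (rvol_moment (ltn0Sn _) a0 acoef_ge0 acoef_out measurable_acoef iidmu mean_acoef finmu).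
Qed.

Lemma ae_regular_path : \forall z \ae mu, regular_path z.
Proof.
have [dl /andP[dl0 dl1] dlI] := avol_moment.
have V0 z t : 0 <= avol z t by exact: rvol_ge0.
have mV : measurable_fun [set: paths R] (fun z => avol z 0 `^ dl).
  exact: (measurableT_comp (measurable_powR dl) (measurable_avol 0)).
have h1 := stationary_growth iidmu mV (fun z => powR_ge0 _ _) dlI.
have mz : measurable_fun [set: paths R] (fun z => z 0 ^+ 2).
  by apply: measurable_funX; exact: measurable_coord.
have zI : (\int[mu]_z (z 0 ^+ 2)%:E < +oo)%E by rewrite Ez2 ltry.
have h2 := stationary_growth iidmu mz (fun z => sqr_ge0 _) zI.
move: finmu h1 h2; apply: filterS3 => z zfin s1 s2.
have sV : subexp (avol z).
  apply: (subexp_of_powR dl0 (V0 z)).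
  rewrite (_ : (fun t => _) = (fun t => avol (time_shift t z) 0 `^ dl))//.
  by apply/funext => t; rewrite avol_shift add0r.
have sz : subexp (fun t => z t ^+ 2).
  rewrite (_ : (fun t => _) = (fun t => time_shift t z 0 ^+ 2))//.
  by apply/funext => t; rewrite /time_shift add0r.
split => //.
rewrite (_ : (fun t => _) = (fun t => avol z t * z t ^+ 2)); first exact: subexpM.
by apply/funext => t; rewrite /aret exprMn sqr_sqrtr.
Qed.

End agarch_paths.

(** * Identifiability *)

Section lag_polynomials.
Context {R : realType}.
Implicit Types (a b : {poly R}) (f : int -> R).

(** The polynomial [a] evaluated at the backward shift: products become compositions, so any two
    such operators commute. *)
Definition lagop a f (t : int) : R := \sum_(l < size a) a`_l * f (t - l%:Z).

Lemma lagopE n a f t : (size a <= n)%N -> lagop a f t = \sum_(l < n) a`_l * f (t - l%:Z).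
Proof.
move=> an; rewrite /lagop (big_ord_widen n (fun l => a`_l * f (t - l%:Z)))// big_mkcond/=.
by apply: eq_bigr => l _; case: ltnP => // la; rewrite nth_default// mul0r.
Qed.

Lemma lagopD a b f t : lagop (a + b) f t = lagop a f t + lagop b f t.
Proof.
pose n := maxn (size a) (size b).
rewrite !(@lagopE n) ?leq_maxl ?leq_maxr//; last exact: size_polyD.
by rewrite -big_split; apply: eq_bigr => l _; rewrite coefD mulrDl.
Qed.

Lemma lagopCM c b f t : lagop (c%:P * b) f t = c * lagop b f t.
Proof.
rewrite mul_polyC !(@lagopE (size b)) ?size_scale_leq// mulr_sumr.
by apply: eq_bigr => l _; rewrite coefZ mulrA.
Qed.

Lemma lagopMX a f t : lagop (a * 'X) f t = lagop a f (t - 1).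
Proof.
rewrite (@lagopE (size a).+1) ?(leq_trans (size_polyMleq _ _)) ?size_polyX ?addn2//.
rewrite big_ord_recl coefMX mul0r add0r; apply: eq_bigr => l _.
by rewrite coefMX/= /bump/= add1n/= intS opprD addrA.
Qed.

Lemma lagop_lin a f g (c : R) t :
  lagop a (fun s => c + f s + g s) t = c * \sum_(l < size a) a`_l + lagop a f t + lagop a g t.
Proof.
rewrite /lagop mulr_sumr -!big_split; apply: eq_bigr => l _.
by rewrite !mulrDr mulrC.
Qed.

Lemma lagopZ a f (c : R) t : lagop a (fun s => c * f s) t = c * lagop a f t.
Proof. by rewrite /lagop mulr_sumr; apply: eq_bigr => l _; rewrite mulrCA. Qed.

Lemma lagopM a b f t : lagop (a * b) f t = lagop a (lagop b f) t.
Proof.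
elim/poly_ind: a t => [|a c ih] t; first by rewrite mul0r /lagop size_poly0 !big_ord0.
rewrite mulrDl mulrAC lagopD lagopMX ih lagopCM lagopD lagopMX; congr (_ + _).
rewrite -[c%:P]mulr1 lagopCM; congr (_ * _).
by rewrite /lagop size_poly1 big_ord1 coef1 mul1r subr0.
Qed.

End lag_polynomials.

Section innovation.
Context {R : realType} (mu : probability (paths R) R).

Lemma ae_imply (Q Q' : paths R -> Prop) : (forall z, Q z -> Q' z) ->
  (\forall z \ae mu, Q z) -> \forall z \ae mu, Q' z.
Proof. by move=> h; apply: filterS. Qed.

Hypotheses (Iz : mu.-integrable setT (fun z : paths R => (z 0)%:E))
  (Ez : (\int[mu]_z (z 0)%:E = 0)%E)
  (nz : forall a b : R, mu [set z | [set a; b] (z 0)] != 1%E).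

Lemma not_two_valued (a b : R) : ~ (\forall z \ae mu, z 0 = a \/ z 0 = b).
Proof.
move=> h; have /eqP := nz a b; apply.
have mS : measurable [set z : paths R | [set a; b] (z 0)].
  rewrite -[X in measurable X]setTI; apply: measurable_coord => //.
  by apply: measurableU.
have : mu (~` [set z : paths R | [set a; b] (z 0)]) = 0%E.
  case: h => N [mN N0 hN]; apply: (subset_measure0 _ mN) => //.
  exact: measurableC.
rewrite probability_setC// => h0.
have fm : mu [set z : paths R | [set a; b] (z 0)] \is a fin_num by exact: fin_num_measure.
by rewrite -[RHS](@subeK _ 1%E _ fm)// h0 add0e.
Qed.

Let mz0 : measurable_fun [set: paths R] (fun z : paths R => z 0).
Proof. exact: measurable_coord. Qed.

(** A variable of constant sign and mean zero vanishes almost surely, so it is concentrated at the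
    degenerate pair [0], [0]. *)
Lemma not_one_signed (s : R) : s != 0 -> ~ (\forall z \ae mu, 0 <= s * z 0).
Proof.
move=> s0 h; apply: (@not_two_valued 0 0).
have : (\int[mu]_z `|(s * z 0)%:E| = 0)%E.
  transitivity (\int[mu]_z (s%:E * (z 0)%:E))%E; last by rewrite integralZl// Ez mule0.
  apply: ae_eq_integral => //.
  - by apply: measurableT_comp => //; apply/measurable_EFinP; exact: measurable_funM.
  - by apply: emeasurable_funM => //; exact/measurable_EFinP.
  by apply: (ae_imply _ h) => z hz _; rewrite /= ger0_norm// EFinM.
move/(ae_eq_integral_abs mu measurableT) => [].
  by apply/measurable_EFinP; exact: measurable_funM.
move=> N [mN N0 hN]; exists N; split => //.
move=> z /= nzz; apply: hN => /= /(_ Logic.I)[] /eqP.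
by rewrite mulf_eq0 (negbTE s0)/= => /eqP z0; apply: nzz; left.
Qed.

(** If [A] is nonzero, [c = 0] prevents [s * z 0] from being positive and any other [c] forces it to
    be positive; mean zero excludes both. *)
Lemma sqpos_nonconstant (s A c : R) : s != 0 ->
  (\forall z \ae mu, A * sqpos (s * z 0) = c) -> A = 0.
Proof.
move=> s0 h; apply/eqP; apply: contrapT => /negP A0; have [c0|c0] := eqVneq c 0.
  apply: (@not_one_signed (- s)); rewrite ?oppr_eq0//; apply: (ae_imply _ h) => z.
  move: {z}(z 0) => x; rewrite mulNr oppr_ge0 leNgt c0 => e; apply/negP => x0.
  move: e; rewrite /sqpos (max_l (ltW x0)) => /eqP.
  by rewrite mulf_eq0 (negbTE A0)/= sqrf_eq0 gt_eqF.
apply: (@not_one_signed s) => //; apply: (ae_imply _ h) => z.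
move: {z}(z 0) => x; rewrite leNgt => e; apply/negP => x0.
move: e; rewrite /sqpos (max_r (ltW x0)) expr0n mulr0 => /esym/eqP.
by rewrite (negbTE c0).
Qed.

(** With both coefficients nonzero the relation determines the positive and the negative value of
    the innovation, which leaves only two points. *)
Lemma sqpos_combination (A B c : R) :
  (\forall z \ae mu, A * sqpos (z 0) + B * sqpos (- z 0) = c) -> A = 0 /\ B = 0.
Proof.
have [-> | A0] := eqVneq A 0; have [-> | B0] := eqVneq B 0 => h //; exfalso.
- move/eqP: B0; apply; apply: (@sqpos_nonconstant (-1) _ c).
    by rewrite oppr_eq0 oner_neq0.
  by apply: (ae_imply _ h) => z; rewrite mul0r add0r mulN1r.
- move/eqP: A0; apply; apply: (@sqpos_nonconstant 1 _ c); first exact: oner_neq0.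
  by apply: (ae_imply _ h) => z; rewrite mul0r addr0 mul1r.
- apply: (@not_two_valued (Num.sqrt (c / A)) (- Num.sqrt (c / B))).
  apply: (ae_imply _ h) => z; move: {z}(z 0) => x e.
  have [x0|x0|x0] := ltgtP x 0.
  + right; move: e; rewrite /sqpos (max_r (ltW x0)) expr0n mulr0 add0r.
    rewrite max_l ?oppr_ge0 ?(ltW x0)// => <-.
    by rewrite mulrAC mulfV// mul1r sqrtr_sqr gtr0_norm ?oppr_gt0// opprK.
  + left; move: e; rewrite /sqpos (max_l (ltW x0)).
    rewrite max_r ?oppr_le0 ?(ltW x0)// expr0n mulr0 addr0 => <-.
    by rewrite mulrAC mulfV// mul1r sqrtr_sqr gtr0_norm.
  (* At [0] the relation gives [c = 0], so [0] coincides with the first of the two points. *)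
  + left; move: e; rewrite x0 /sqpos oppr0 maxxx expr0n !mulr0 addr0 => <-.
    by rewrite mul0r sqrtr0.
Qed.

End innovation.

Section identifiability.
Context {R : realType} {p q : nat}.
Variable th0 : param R p q.
Let m := (p + q).+1.
Hypothesis th0P : param_space th0.
Variable mu : probability (paths R) R.
Hypothesis iidmu : iid_seq mu (fun t z => z t).
Hypotheses (Iz : mu.-integrable setT (fun z : paths R => (z 0)%:E))
  (Ez : (\int[mu]_z (z 0)%:E = 0)%E)
  (nz : forall a b : R, mu [set z | [set a; b] (z 0)] != 1%E).
Hypothesis reg : \forall z \ae mu, regular_path th0 z.

(* Resampling the innovation at time [0] leaves the volatility at time [0] and the
   larger lags unchanged. *)
Lemma lag_relation_eq0 (d d' : {poly R}) (k : R) :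
  (\forall z \ae mu, forall t, lagop d (fun s => sqpos (aret th0 z s)) t
     + lagop d' (fun s => sqpos (- aret th0 z s)) t = k) ->
  d = 0 /\ d' = 0.
Proof.
move=> h; pose n := maxn (size d) (size d').
suff hl l : d`_l = 0 /\ d'`_l = 0.
  by split; apply/polyP => l; rewrite coef0; case: (hl l).
elim/ltn_ind: l => l ih.
(* The relation is read at time [l]: lag [l] then carries the innovation at time [0], smaller lags
   have zero coefficients by induction, and larger lags involve only earlier innovations. *)
pose W z (l' : nat) := d`_l' * sqpos (aret th0 z (l%:Z - l'%:Z))
  + d'`_l' * sqpos (- aret th0 z (l%:Z - l'%:Z)).
have {}h : \forall z \ae mu, W z l + \sum_(l.+1 <= l' < n + l.+1) W z l' = k.
  move: h; apply: filterS => z /(_ l%:Z) <-.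
  rewrite !(@lagopE _ (n + l.+1)); last 2 first.
  - by rewrite (leq_trans (leq_maxr (size d) _))// leq_addr.
  - by rewrite (leq_trans (leq_maxl _ (size d')))// leq_addr.
  rewrite -big_split/= -(big_mkord xpredT (W z)).
  rewrite [RHS](@big_cat_nat _ _ _ l.+1)//= ?leq_addl//; congr (_ + _).
  rewrite big_nat_recr//= big_nat big1 ?add0r// => i /andP[_ il].
  by have [di di'] := ih i il; rewrite /W di di' !mul0r addr0.
have := ae_splice iidmu (predC1 (0 : int)) h.
have := filterI reg; move=> filt.
move=> /filt /(ae_ex (P := mu))[z [zr hz]].
have V0 := avol_gt0 th0P zr 0.
pose c := k - \sum_(l.+1 <= l' < n + l.+1) W z l'.
have [|/eqP A0 /eqP B0] := @sqpos_combination _ mu Iz Ez nz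
    (d`_l * avol th0 z 0) (d'`_l * avol th0 z 0) c; last first.
  move: A0 B0; rewrite !mulf_eq0 (gt_eqF V0) !orbF => /eqP -> /eqP ->.
  by [].
move: hz; apply: filterS => z' hz'.
have same : forall s, s < 0 -> aret th0 (splice (predC1 (0:int)) (z, z')) s = aret th0 z s.
  by move=> s s0; apply: (aret_dep th0P) => u /= us; rewrite /splice/= lt_eqF//; exact: le_lt_trans s0.
rewrite /c -hz' [W _ l](_ : _ = (d`_l * avol th0 z 0) * sqpos (z' 0)
   + (d'`_l * avol th0 z 0) * sqpos (- z' 0)); last first.
  have VE : avol th0 (splice (predC1 (0 : int)) (z, z')) 0 = avol th0 z 0.
    by apply: (avol_dep th0P) => u /= u0; rewrite /splice/= lt_eqF.
  rewrite /W subrr /aret VE /splice/= -mulrN !sqposM ?sqrtr_ge0// sqr_sqrtr ?(ltW V0)//.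
  by rewrite !mulrA.
rewrite [X in _ = _ + X - _](_ : _ = \sum_(l.+1 <= l' < n + l.+1) W z l') ?addrK//.
rewrite !big_nat; apply: eq_bigr => i /andP[li _].
by rewrite /W same// subr_lt0 ltz_nat.
Qed.

Lemma identifiable (th : param R p q) : param_space th ->
  (exists i, (1 <= i <= p)%N /\ 0 < alph th0 i) ->
  (alph th0 p, bet th0 q) != (0, 0) ->
  (forall z : R[i], ~ (root (map_poly (real_complex R) (apoly th0)) z /\
                       root (map_poly (real_complex R) (bpoly th0)) z)) ->
  (\forall z \ae mu, gvol m (gparam_of th) (aret th0 z) 0 = avol th0 z 0) ->
  th = th0.
Proof.
move=> thP exa ab coprime HV.
pose V z t := avol th0 z t.
pose Pp z t := sqpos (aret th0 z t).
pose Qp z t := sqpos (- aret th0 z t).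
have {}HV : \forall z \ae mu, forall t, gvol m (gparam_of th) (aret th0 z) t = V z t.
  have hs (t : int) : \forall z \ae mu, gvol m (gparam_of th) (aret th0 z) t = V z t.
    move: (ae_shift iidmu t HV); apply: filterS => z.
    by rewrite gvol_aret_shift avol_shift add0r.
  have := ae_foralln (fun k => hs (int_of_code k)).
  by apply: filterS => z hz t; have [k <-] := int_of_code_surj t.
have lagE (th' : param R p q) z : param_space th' ->
    subexp (fun t => aret th0 z t ^+ 2) ->
    (forall t, gvol m (gparam_of th') (aret th0 z) t = V z t) ->
    forall t, lagop (bpoly th') (V z) t = alph th' 0
      + (1 - gam th') ^+ 2 * lagop (apoly th') (Pp z) t
      + (1 + gam th') ^+ 2 * lagop (apoly th') (Qp z) t.
  move=> th'P xsub hV t; have g0 := gparam_of_nonneg th'P.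
  have [l gl] := gstable_ex g0 (sum_bet_lt1 th'P).
  have := gvolE xsub g0 gl t; rewrite hV ginput_gparam_of.
  under [X in _ + X]eq_bigr do rewrite hV.
  rewrite sum_bet_widen => Ve.
  rewrite (lagopE _ _ (size_bpoly th')) !(lagopE _ _ (size_apoly th')).
  rewrite [X in X = _]big_ord_recl coef_bpoly0 mul1r subr0 [V z t]Ve.
  have -> : \sum_(i < q) (bpoly th')`_(lift ord0 i) * V z (t - (lift ord0 i)%:Z) =
     - \sum_(1 <= j < q.+1) bet th' j * V z (t - j%:Z).
    rewrite big_add1 big_mkord -sumrN; apply: eq_bigr => i _.
    by rewrite lift0 coef_bpoly sub0r mulNr.
  rewrite addrK -!addrA; congr (_ + _).
  have cf0 : (apoly th')`_0 = 0 by rewrite coef_apoly.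
  rewrite !big_ord_recl cf0 !mul0r !add0r big_add1 big_mkord !mulr_sumr -big_split/=.
  apply: eq_bigr => i _; rewrite coef_apoly /bump /= add1n ltn_ord sqpos_split /Pp /Qp; ring.
set b0 := bpoly th0 in lagE *; set b := bpoly th.
pose U := b0 * apoly th; pose W := b * apoly th0.
pose d := ((1 - gam th) ^+ 2)%:P * U + (- (1 - gam th0) ^+ 2)%:P * W.
pose d' := ((1 + gam th) ^+ 2)%:P * U + (- (1 + gam th0) ^+ 2)%:P * W.
(* A lag operator multiplies a constant by the sum of its coefficients; both intercepts are
   collected on the right. *)
pose k := alph th0 0 * (\sum_(l < size b) b`_l) - alph th 0 * (\sum_(l < size b0) b0`_l).
have [|d0 d'0] := @lag_relation_eq0 d d' k.
  move: reg HV; apply: filterS2 => z zr hV t.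
  have [_ _ _ xsub] := zr.
  have e1 := lagE th z thP xsub hV.
  have e2 := lagE th0 z th0P xsub (fun t => esym (avol_gvol th0P zr t)).
  have : lagop b0 (lagop b (V z)) t = lagop b (lagop b0 (V z)) t.
    by rewrite -!lagopM mulrC.
  rewrite (_ : lagop b (V z) = fun t => alph th 0
      + (1 - gam th) ^+ 2 * lagop (apoly th) (Pp z) t
      + (1 + gam th) ^+ 2 * lagop (apoly th) (Qp z) t); last exact/funext.
  rewrite (_ : lagop b0 (V z) = fun t => alph th0 0
      + (1 - gam th0) ^+ 2 * lagop (apoly th0) (Pp z) t
      + (1 + gam th0) ^+ 2 * lagop (apoly th0) (Qp z) t); last exact/funext.
  rewrite !lagop_lin !lagopZ -!lagopM -/U -/W /d /d' !lagopD !lagopCM /k => E.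
  rewrite -/(Pp z) -/(Qp z).
  by move: E; lra.
have [i0 [i0p ai0]] := exa.
have a0n : apoly th0 != 0.
  apply/eqP => /(congr1 (fun P : {poly R} => P`_i0)).
  by rewrite coef_apoly i0p coef0 => /eqP; rewrite gt_eqF.
have bn (th' : param R p q) : bpoly th' != 0.
  apply/eqP => /(congr1 (fun P : {poly R} => P`_0)).
  by rewrite coef_bpoly0 coef0 => /eqP; rewrite oner_eq0.
have Wn : W != 0 by rewrite mulf_neq0// bn.
have [_ _ _ _ /andP[gl gu]] := thP; have [_ _ _ _ /andP[gl0 gu0]] := th0P.
have c1 l : (1 - gam th) ^+ 2 * U`_l = (1 - gam th0) ^+ 2 * W`_l.
  have := congr1 (fun P : {poly R} => P`_l) d0.
  by rewrite coefD !coefCM coef0 mulNr => /eqP; rewrite subr_eq0 => /eqP.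
have c2 l : (1 + gam th) ^+ 2 * U`_l = (1 + gam th0) ^+ 2 * W`_l.
  have := congr1 (fun P : {poly R} => P`_l) d'0.
  by rewrite coefD !coefCM coef0 mulNr => /eqP; rewrite subr_eq0 => /eqP.
have [l Wl] : exists l, W`_l != 0.
  by exists (size W).-1; rewrite -/(lead_coef W) lead_coef_eq0.
(* When [gam th0] is [1] or [-1] one of the relations [c1], [c2] has a vanishing right side; their
   sum has the factor [2 + 2 * gam th0 ^+ 2], which is always positive. *)
have Ul : U`_l != 0.
  apply/eqP => U0; have := c1 l; have := c2 l; rewrite U0 !mulr0 => e2 e1.
  have : (2 + 2 * gam th0 ^+ 2) * W`_l = 0.
    have -> : (2 + 2 * gam th0 ^+ 2) * W`_l =
      (1 - gam th0) ^+ 2 * W`_l + (1 + gam th0) ^+ 2 * W`_l by ring.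
    by rewrite -e1 -e2 addr0.
  move/eqP; rewrite mulf_eq0 (negbTE Wl) orbF => /eqP h.
  by have := sqr_ge0 (gam th0); lra.
have gE : gam th = gam th0.
  have : ((1 - gam th) * (1 + gam th0)) ^+ 2 = ((1 - gam th0) * (1 + gam th)) ^+ 2.
    apply: (mulIf (mulf_neq0 Ul Wl)).
    have -> : ((1 - gam th) * (1 + gam th0)) ^+ 2 * (U`_l * W`_l) =
      ((1 - gam th) ^+ 2 * U`_l) * ((1 + gam th0) ^+ 2 * W`_l) by ring.
    by rewrite c1 -c2; ring.
  move/eqP; rewrite eqrXn2//; last 2 first.
  - by apply: mulr_ge0; lra.
  - by apply: mulr_ge0; lra.
  by move/eqP; lra.
have UW : U = W.
  apply/polyP => j; have e1 := c1 j; have e2 := c2 j; rewrite gE in e1 e2.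
  have g2 : 2 + 2 * gam th0 ^+ 2 != 0 by have := sqr_ge0 (gam th0); lra.
  apply: (mulfI g2).
  have -> : (2 + 2 * gam th0 ^+ 2) * U`_j =
    (1 - gam th0) ^+ 2 * U`_j + (1 + gam th0) ^+ 2 * U`_j by ring.
  by rewrite e1 e2; ring.
have [aE bE] : apoly th = apoly th0 /\ bpoly th = bpoly th0.
  by apply: polynomials_identifiable => //; rewrite mulrC -/b0 -/U UW /W mulrC.
apply: param_ext => //.
have [z [zr hV]] := ae_ex (filterI reg HV).
have [_ _ _ xsub] := zr.
have := lagE th z thP xsub hV 0; have := lagE th0 z th0P xsub (fun t => esym (avol_gvol th0P zr t)) 0.
by rewrite bE aE gE => ->; lra.
Qed.

End identifiability.

(** * Consistency *)

Lemma fatou_bound d (T : measurableType d) (R : realType) (P : probability T R)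
    (F : nat -> T -> R) (Finf : T -> R) (B : \bar R) :
  (forall n, measurable_fun setT (F n)) -> measurable_fun setT Finf ->
  (forall n w, 0 <= F n w) -> (forall w, 0 <= Finf w) ->
  (\forall w \ae P, F n w @[n --> \oo] --> Finf w) ->
  (forall n, (\int[P]_w (F n w)%:E <= B)%E) -> (\int[P]_w (Finf w)%:E <= B)%E.
Proof.
move=> mF mFi F0 Fi0 cvF hB.
have F0' n w : [set: T] w -> (0 <= (F n w)%:E)%E by rewrite lee_fin.
have mF' n : measurable_fun setT (EFin \o F n) by exact/measurable_EFinP.
apply: (@le_trans _ _ (\int[P]_w limn_einf (fun n => (F n w)%:E))%E).
  apply: ae_ge0_le_integral => //.
  - by move=> w _; rewrite lee_fin.
  - exact/measurable_EFinP.
  - move=> w _; rewrite limn_einf_lim; apply: lime_ge; first exact: is_cvg_einfs.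
    by apply: nearW => n; apply: le_ereal_inf_tmp => _ [k _ <-]; exact: F0'.
  - apply: (@emeasurable_fun_cvg _ _ _ _ (fun n w => einfs (fun k => (F k w)%:E) n)).
      by move=> n; exact: measurable_fun_einfs.
    by move=> w _; rewrite limn_einf_lim; exact: is_cvg_einfs.
  move: cvF; apply: filterS => w cw _.
  have cw' : (F n w)%:E @[n --> \oo] --> (Finf w)%:E.
    by apply: cvg_EFin => //; exact: nearW.
  by rewrite (cvg_limn_einf_sup cw').
apply: le_trans (fatou P measurableT mF' F0') _.
rewrite limn_einf_lim; apply: lime_le; first exact: is_cvg_einfs.
apply: nearW => n; apply: le_trans (hB n).
by apply: ereal_inf_lbound; exists n => /=.
Qed.

(** * Positive mean of the truncated likelihood gap *)

Section strict_jensen.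
Context {R : realType} (mu : probability (paths R) R).
Hypothesis iidmu : iid_seq mu (fun t z => z t).
Hypothesis Ez2 : (\int[mu]_z ((z 0) ^+ 2)%:E = 1)%E.
Variables (c dl : R) (v h : paths R -> R) (hp hm : nat -> paths R -> R).
Hypotheses (c0 : 0 < c) (dl0 : 0 < dl).
Hypotheses (mv : measurable_fun setT v) (mh : measurable_fun setT h)
  (mhp : forall n, measurable_fun setT (hp n)) (mhm : forall n, measurable_fun setT (hm n)).
Hypotheses (vc : forall z, c <= v z) (hc : forall z, c <= h z)
  (hpc : forall n z, c <= hp n z) (hmc : forall n z, c <= hm n z).
Hypotheses (vdep : depends_on [pred s | s < 0] v) (hdep : depends_on [pred s | s < 0] h).
Hypothesis vdl : (\int[mu]_z (v z `^ dl)%:E < +oo)%E.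
Hypotheses (hpcv : \forall z \ae mu, hp n z @[n --> \oo] --> h z)
  (hmcv : \forall z \ae mu, hm n z @[n --> \oo] --> h z).
Hypothesis nev : ~ (\forall z \ae mu, h z = v z).

(** The upper corner [hp] enters the ratio and the lower corner [hm] the logarithm, so that both
    terms are bounded below over the whole box. The truncations at [n] give them finite means. *)
Definition llgap n (z : paths R) : R :=
  Num.min (v z * z 0 ^+ 2 / hp n z) n%:R + Num.min (ln (hm n z)) n%:R
  - z 0 ^+ 2 - ln (v z).

Let mz2 : measurable_fun setT (fun z : paths R => z 0 ^+ 2).
Proof. by apply: measurable_funX; exact: measurable_coord. Qed.

Let minv (f : paths R -> R) : measurable_fun setT f -> (forall z, c <= f z) ->
  measurable_fun setT (fun z => (f z)^-1).
Proof.
move=> mf fc; rewrite (_ : (fun z => _) = (fun z => f z `^ (-1))).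
  exact: (measurableT_comp (measurable_powR _) mf).
by apply/funext => z; rewrite powR_inv1// (le_trans (ltW c0)).
Qed.

Let mln (f : paths R -> R) : measurable_fun setT f -> measurable_fun setT (fun z => ln (f z)).
Proof. by move=> mf; exact: (measurableT_comp (@measurable_ln R) mf). Qed.

(** Adding [k] makes the logarithms of all functions bounded below by [c] nonnegative, so that Fatou
    and Tonelli apply even to infinite integrals. *)
Let k := `|ln c|.

Let k0 : 0 <= k. Proof. exact: normr_ge0. Qed.

Let lnk x : c <= x -> 0 <= ln x + k.
Proof.
move=> cx; have : ln c <= ln x by rewrite ler_ln// posrE (lt_le_trans c0).
by have := ler_norm (- ln c); rewrite normrN -/k; lra.
Qed.

Let F n z := Num.min (v z * z 0 ^+ 2 / hp n z) n%:R + (Num.min (ln (hm n z)) n%:R + k).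
Let Fi z := v z / h z * z 0 ^+ 2 + (ln (h z) + k).
Let G (z : paths R) := z 0 ^+ 2 + (ln (v z) + k).

Let pos x : c <= x -> 0 < x. Proof. exact: lt_le_trans c0. Qed.

Let F0 n z : 0 <= F n z.
Proof.
apply: addr_ge0.
  rewrite le_min ler0n andbT; apply: divr_ge0; last exact/ltW/pos.
  by apply: mulr_ge0; [exact/ltW/pos|exact: sqr_ge0].
have := lnk (hmc n z); have := ler0n R n; have := k0.
by case: (leP (ln (hm n z)) n%:R) => _; lra.
Qed.

Let mF n : measurable_fun setT (F n).
Proof.
apply: measurable_funD.
  apply: measurable_minr => //; apply: measurable_funM; last exact: minv.
  exact: measurable_funM.
by apply: measurable_funD => //; apply: measurable_minr => //; exact: mln.
Qed.

Let Fi0 z : 0 <= Fi z.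
Proof. by rewrite addr_ge0 ?lnk// mulr_ge0 ?sqr_ge0// divr_ge0// ltW ?pos. Qed.

Let mFi : measurable_fun setT Fi.
Proof.
apply: measurable_funD; last by apply: measurable_funD => //; exact: mln.
by apply: measurable_funM => //; apply: measurable_funM => //; exact: minv.
Qed.

Let G0 z : 0 <= G z. Proof. by rewrite addr_ge0 ?sqr_ge0 ?lnk. Qed.

Let mG : measurable_fun setT G.
Proof. by apply: measurable_funD => //; apply: measurable_funD => //; exact: mln. Qed.

Let lnI : (\int[mu]_z (ln (v z) + k)%:E < +oo)%E.
Proof.
apply: (@le_lt_trans _ _ (\int[mu]_z ((dl^-1)%:E * (v z `^ dl)%:E + k%:E))%E).
  apply: ge0_le_integral => //.
  - by move=> z _; rewrite lee_fin lnk.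
  - by apply/measurable_EFinP; apply: measurable_funD => //; exact: mln.
  - apply/measurable_EFinP; apply: measurable_funD => //; apply: measurable_funM => //.
    exact: (measurableT_comp (measurable_powR _) mv).
  move=> z _; rewrite -EFinM -EFinD lee_fin lerD2r mulrC.
  by apply: ln_le_powR => //; exact: pos.
have mp : measurable_fun setT (fun z => (v z `^ dl)%:E).
  by apply/measurable_EFinP; exact: (measurableT_comp (measurable_powR _) mv).
rewrite ge0_integralD//; last 2 first.
- by move=> z _; rewrite -EFinM lee_fin mulr_ge0 ?powR_ge0// invr_ge0 ltW.
- exact: measurable_funeM.
rewrite ge0_integralZl//; last 2 first.
- by move=> z _; rewrite lee_fin powR_ge0.
- by rewrite lee_fin invr_ge0 ltW.
rewrite integral_prob_cst lte_add_pinfty ?ltry//.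
by rewrite lte_mul_pinfty// lee_fin invr_ge0 ltW.
Qed.

Let GI : (\int[mu]_z (G z)%:E = 1 + \int[mu]_z (ln (v z) + k)%:E)%E.
Proof.
under eq_integral do rewrite EFinD.
rewrite ge0_integralD//= ?Ez2//.
- by move=> z _; rewrite lee_fin sqr_ge0.
- exact/measurable_EFinP.
- by move=> z _; rewrite lee_fin lnk.
- by apply/measurable_EFinP; apply: measurable_funD => //; exact: mln.
Qed.

Let FiI : (\int[mu]_z (Fi z)%:E =
  \int[mu]_z (v z / h z)%:E + \int[mu]_z (ln (h z) + k)%:E)%E.
Proof.
have mvh : measurable_fun setT (fun z => v z / h z).
  by apply: measurable_funM => //; exact: minv.
under eq_integral do rewrite EFinD.
rewrite ge0_integralD//=; last 4 first.
- by move=> z _; rewrite lee_fin mulr_ge0 ?sqr_ge0// divr_ge0// ltW ?pos.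
- by apply/measurable_EFinP; exact: measurable_funM.
- by move=> z _; rewrite lee_fin lnk.
- by apply/measurable_EFinP; apply: measurable_funD => //; exact: mln.
congr (_ + _)%E; under eq_integral do rewrite EFinM.
rewrite (@ge0_integralM_indep _ mu iidmu [pred s | s < 0]).
- by rewrite Ez2 mule1.
- exact/measurable_EFinP.
- exact/measurable_EFinP.
- by move=> z; rewrite lee_fin divr_ge0// ltW ?pos.
- by move=> z; rewrite lee_fin sqr_ge0.
- by move=> z z' zz'; rewrite (vdep zz') (hdep zz').
- by move=> z z' zz'; rewrite zz'//= ltxx.
Qed.

Let Gfin : (\int[mu]_z (G z)%:E < +oo)%E.
Proof. by rewrite GI lte_add_pinfty ?ltry. Qed.

Let integrable_ge0 (f : paths R -> R) : measurable_fun setT f -> (forall z, 0 <= f z) ->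
  (\int[mu]_z (f z)%:E < +oo)%E -> mu.-integrable setT (EFin \o f).
Proof.
move=> mf f0 If; apply/integrableP; split; first exact/measurable_EFinP.
by under eq_integral do rewrite /= ger0_norm//.
Qed.

Let Fint n : mu.-integrable setT (EFin \o F n).
Proof.
apply: integrable_ge0 => //; apply: (@le_lt_trans _ _ (\int[mu]_z (n%:R + (n%:R + k) : R)%:E)%E).
  apply: ge0_le_integral => //.
  - by move=> z _; rewrite lee_fin.
  - exact/measurable_EFinP.
  by move=> z _; rewrite lee_fin !lerD ?ge_min ?lexx ?orbT.
by rewrite integral_prob_cst ltry.
Qed.

(* [v / h + ln h >= 1 + ln v], strictly unless [h = v], and [z 0] is independent of [v / h]
   with mean square [1]. *)
Lemma llgap_mean : exists n, mu.-integrable setT (EFin \o llgap n) /\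
  (0 < \int[mu]_z (llgap n z)%:E)%E.
Proof.
have Gint := integrable_ge0 mG G0 Gfin.
have gapE n : EFin \o llgap n = ((EFin \o F n) \- (EFin \o G))%E.
  by apply/funext => z; rewrite /= -EFinB; congr EFin; rewrite /llgap /F /G; ring.
have [n hn] : exists n, (\int[mu]_z (G z)%:E < \int[mu]_z (F n z)%:E)%E; last first.
  exists n; split; first by rewrite gapE; exact: integrableB.
  have -> : (\int[mu]_z (llgap n z)%:E = \int[mu]_z ((F n z)%:E - (G z)%:E))%E.
    by apply: eq_integral => z _; rewrite -[LHS]/((EFin \o llgap n) z) gapE.
  rewrite integralB_EFin// sube_gt0 //.
apply: contrapT => nex.
have le n : (\int[mu]_z (F n z)%:E <= \int[mu]_z (G z)%:E)%E.
  by rewrite leNgt; apply/negP => h'; apply: nex; exists n.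
have FG : (\int[mu]_z (Fi z)%:E <= \int[mu]_z (G z)%:E)%E.
  apply: (@fatou_bound _ _ _ _ F) => //.
  move: hpcv hmcv; apply: filterS2 => z cp cm.
  have minc (f : nat -> R) (l : R) : f n @[n --> \oo] --> l ->
      Num.min (f n) n%:R @[n --> \oo] --> l.
    move=> fl; have : \forall n \near \oo, Num.min (f n) n%:R = f n.
      have [N lN] : exists N : nat, l + 1 <= N%:R.
        by exists (Num.truncn (l + 1)).+1; exact/ltW/truncnS_gt.
      near=> n; rewrite min_l//; apply: (@le_trans _ _ (l + 1)).
        by near: n; apply: (cvgr_le _ fl); rewrite ltrDl.
      apply: le_trans lN _; rewrite ler_nat; near: n; exact: nbhs_infty_ge.
    move=> e; apply: cvg_trans fl; apply: near_eq_cvg.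
    by move: e; apply: filterS => n /esym.
  apply: cvgD; last first.
    apply: cvgD; last exact: cvg_cst.
    apply: minc; apply: continuous_cvg cm; apply: continuous_ln; exact: pos.
  apply: minc; rewrite mulrAC; apply: cvgMr; apply: cvgV => //.
  by rewrite gt_eqF// pos.
pose D z := v z / h z - 1 - ln (v z / h z).
have D0 z : 0 <= D z.
  by have := ln_le_sub1 (divr_gt0 (pos (vc z)) (pos (hc z))); rewrite /D; lra.
have mvh : measurable_fun setT (fun z => v z / h z).
  by apply: measurable_funM => //; exact: minv.
have mD : measurable_fun setT D.
  apply: measurable_funB; last exact: mln.
  exact: measurable_funB.
have DI : (\int[mu]_z (D z)%:E = 0)%E.
  apply/eqP; rewrite eq_le integral_ge0 ?andbT; last by move=> z _; rewrite lee_fin.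
  (* All integrands are nonnegative, so the identity holds even with infinite values; afterwards
     only the finite mean of [G] is cancelled. *)
  have sumE : (\int[mu]_z (v z / h z)%:E + \int[mu]_z (ln (h z) + k)%:E =
      (1 + \int[mu]_z (ln (v z) + k)%:E) + \int[mu]_z (D z)%:E)%E.
    rewrite -[1%E]/(1%:E) -(integral_prob_cst mu) -!ge0_integralD//.
    - apply: eq_integral => z _; rewrite -!EFinD; congr EFin.
      by rewrite /D ln_div ?posrE ?pos//; ring.
    - by move=> z _; rewrite -EFinD lee_fin addr_ge0// lnk.
    - apply/measurable_EFinP; apply: measurable_funD => //.
      by apply: measurable_funD => //; exact: mln.
    - by move=> z _; rewrite lee_fin.
    - exact/measurable_EFinP.
    - by move=> z _; rewrite lee_fin lnk.
    - by apply/measurable_EFinP; apply: measurable_funD => //; exact: mln.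
    - by move=> z _; rewrite lee_fin divr_ge0// ltW ?pos.
    - exact/measurable_EFinP.
    - by move=> z _; rewrite lee_fin lnk.
    - by apply/measurable_EFinP; apply: measurable_funD => //; exact: mln.
  move: FG; rewrite FiI sumE -GI.
  have Gf : (\int[mu]_z (G z)%:E)%E \is a fin_num.
    by rewrite ge0_fin_numE// integral_ge0// => z _; rewrite lee_fin.
  by rewrite -[leRHS]adde0 leeD2lE.
apply: nev.
have : (\int[mu]_z `|(D z)%:E| = 0)%E.
  by rewrite -[RHS]DI; apply: eq_integral => z _ /=; rewrite ger0_norm.
move/(ae_eq_integral_abs mu measurableT) => [].
  exact/measurable_EFinP.
move=> N [mN N0 hN]; exists N; split => // z /= nzz; apply: hN => /= /(_ Logic.I)[] Dz.
apply: nzz; apply/eqP; apply: contrapT => /negP hv.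
have vh : v z / h z != 1.
  apply: contra hv => /eqP e; apply/eqP.
  have hn : h z != 0 by rewrite gt_eqF// pos.
  by rewrite -[LHS]mul1r -e divfK.
have := ln_lt_sub1 (divr_gt0 (pos (vc z)) (pos (hc z))) vh.
by move: Dz; rewrite /D; lra.
Unshelve. all: by end_near.
Qed.

End strict_jensen.

Section quasi_likelihood_terms.
Context {R : realType}.
Implicit Types c A x h H : R.

Lemma ratio_perturb c A x h H : 0 < c -> 0 <= A -> 0 <= x -> c <= h -> c <= H ->
  h <= H + A -> x / H <= x / h + x * A / c ^+ 2.
Proof.
move=> c0 A0 x0 ch cH hA; have h0 := lt_le_trans c0 ch; have H0 := lt_le_trans c0 cH.
rewrite -lerBlDl -mulrBr -mulrA ler_wpM2l//.
have -> : H^-1 - h^-1 = (h - H) / (H * h) by field; rewrite !gt_eqF.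
apply: (@le_trans _ _ (A / (H * h))).
  by apply: ler_wpM2r; [rewrite invr_ge0; exact/ltW/mulr_gt0|lra].
rewrite ler_wpM2l// lef_pV2 ?posrE ?exprn_gt0 ?mulr_gt0//.
by rewrite expr2 ler_pM// ltW.
Qed.

Lemma ln_perturb c A h H : 0 < c -> 0 <= A -> c <= h -> 0 < H ->
  H <= h + A -> ln H <= ln h + A / c.
Proof.
move=> c0 A0 ch H0 HA; have h0 := lt_le_trans c0 ch.
rewrite -lerBlDl -ln_div ?posrE//; apply: le_trans (ln_le_sub1 (divr_gt0 H0 h0)) _.
have -> : H / h - 1 = (H - h) / h by field; rewrite gt_eqF.
apply: (@le_trans _ _ (A / h)).
  by apply: ler_wpM2r; [rewrite invr_ge0; exact: ltW|lra].
by rewrite ler_wpM2l// lef_pV2 ?posrE.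
Qed.

(** Four replacements: [h] by a corner value and [h0] by [V], each in a ratio at cost
    [x * A / c ^+ 2] and in a logarithm at cost [A / c]. *)
Lemma qll_gap c A x V h h0 Hp Hm : 0 < c -> 0 <= A -> 0 <= x ->
  c <= V -> c <= h -> c <= h0 -> c <= Hp -> c <= Hm ->
  h <= Hp + A -> Hm <= h + A -> h0 <= V + A -> V <= h0 + A ->
  x / Hp + ln Hm - x / V - ln V - A * (2 * x / c ^+ 2 + 2 / c)
    <= (x / h + ln h) - (x / h0 + ln h0).
Proof.
move=> c0 A0 x0 cV ch ch0 cHp cHm h1 h2 h3 h4.
have e1 := ratio_perturb c0 A0 x0 ch cHp h1.
have e2 := ln_perturb c0 A0 ch (lt_le_trans c0 cHm) h2.
have e3 := ratio_perturb c0 A0 x0 cV ch0 h4.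
have e4 := ln_perturb c0 A0 cV (lt_le_trans c0 ch0) h3.
have -> : A * (2 * x / c ^+ 2 + 2 / c) = 2 * (x * A / c ^+ 2) + 2 * (A / c) by ring.
lra.
Qed.

Lemma subexp_geometric_sum (u : int -> R) (r : R) : subexp u -> 0 < r < 1 ->
  exists E, forall n, \sum_(1 <= t < n.+1) r ^+ t * u t%:Z <= E.
Proof.
move=> su /andP[r0 r1].
(* One square root of [r] absorbs the growth of [u], the other leaves a bounded geometric sum. *)
have s01 : 0 < Num.sqrt r < 1 by rewrite sqrtr_gt0 r0 -[ltRHS]sqrtr1 ltr_sqrt.
set s := Num.sqrt r in s01; have /andP[s0 s1] := s01.
have rE : r = s ^+ 2 by rewrite sqr_sqrtr// ltW.
have [D D0 hD] := su _ s01.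
have geo n : \sum_(1 <= t < n.+1) s ^+ t <= (1 - s)^-1.
  rewrite -[leRHS]mul1r ler_pdivlMr ?subr_gt0//.
  suff -> : (\sum_(1 <= t < n.+1) s ^+ t) * (1 - s) = s - s ^+ n.+1.
    by have : 0 <= s ^+ n.+1; [rewrite exprn_ge0// ltW|lra].
  elim: n => [|n ih]; first by rewrite big_geq// mul0r expr1 subrr.
  by rewrite big_nat_recr//= mulrDl ih [s ^+ n.+2]exprS; ring.
exists (D / (1 - s)) => n.
apply: (@le_trans _ _ (\sum_(1 <= t < n.+1) D * s ^+ t)).
  apply: ler_sum => t _; rewrite rE -exprM mulnC exprM expr2 -mulrA mulrC.
  rewrite ler_wpM2r ?exprn_ge0 ?(ltW s0)//.
  apply: le_trans (hD t%:Z); rewrite mulrC ler_wpM2r ?ler_norm// exprn_ge0//.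
  exact: ltW.
by rewrite -mulr_sumr ler_wpM2l.
Qed.

End quasi_likelihood_terms.

Section local_domination.
Context {R : realType} {p q : nat}.
Variable th0 : param R p q.
Let m := (p + q).+1.
Hypothesis th0P : param_space th0.
Variable mu : probability (paths R) R.
Hypothesis iidmu : iid_seq mu (fun t z => z t).
Hypothesis Ez2 : (\int[mu]_z ((z 0) ^+ 2)%:E = 1)%E.
Hypothesis finmu : \forall z \ae mu, rvol_finite m (alph th0 0) (acoef th0) z.
Variable v : 'I_q -> R.
Hypothesis v0 : forall j, 0 <= v j.

Lemma hhat_ge (th : param R p q) (x : int -> R) t : param_space th -> (0 < t)%N ->
  alph th 0 <= hhat th x v t.
Proof.
case: t => // t thP _; case: (thP) => a0 ai bj _ _; rewrite /hhat /= -addrA lerDl.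
rewrite addr_ge0// big_nat sumr_ge0// => i ip; first by rewrite mulr_ge0 ?ai// sqr_ge0.
by rewrite mulr_ge0//; [case/andP: (bj i ip)|exact: hs_ge0].
Qed.

Lemma gle_refl (g : @gparam R) : gle g g. Proof. by split. Qed.

(** Passing from the recursive to the stationary volatilities costs geometrically small errors times
    subexponential factors, a bounded total. The constants come from the corners, so [E] is uniform
    in [n] and over the box; the factor [2] clears the one half in [Lhat]. *)
Lemma pathwise_gap (g gp gm : @gparam R) (l c : R) z :
  regular_path th0 z -> 0 < c -> c <= alph th0 0 ->
  gnonneg gm -> c <= g_a gm -> gle gm g -> gle g gp -> gstable m gp l ->
  exists E, forall n (th : param R p q), param_space th -> gle gm (gparam_of th) -> gle (gparam_of th) gp ->
    \sum_(1 <= t < n.+1)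
      (avol th0 z t%:Z * z t%:Z ^+ 2 / gvol m gp (aret th0 z) t%:Z
       + ln (gvol m gm (aret th0 z) t%:Z) - z t%:Z ^+ 2 - ln (avol th0 z t%:Z)) - E
    <= 2 * (Lhat th0 (aret th0 z) v n - Lhat th (aret th0 z) v n).
Proof.
move=> zr c0 ca gm0 cgm gmg ggp gpl.
have [_ _ _ xsub] := zr.
have g0 := gle_nonneg gm0 gmg; have gp0 := gle_nonneg g0 ggp.
have gml := gle_stable (gle_trans gmg ggp) gpl.
have g00 := gparam_of_nonneg th0P.
have [l0 g0l] := gstable_ex g00 (sum_bet_lt1 th0P).
set x := aret th0 z in xsub *.
have [C1 [r1 [C10 r10 r11 h1]]] := hhat_le_gvol v0 xsub gp0 gpl.
have [C2 [r2 [C20 r20 r21 h2]]] := gvol_le_hhat v0 xsub gm0 gml.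
have [C3 [r3 [C30 r30 r31 h3]]] := hhat_le_gvol v0 xsub g00 g0l.
have [C4 [r4 [C40 r40 r41 h4]]] := gvol_le_hhat v0 xsub g00 g0l.
pose C := C1 + C2 + C3 + C4.
pose r := Num.max (Num.max r1 r2) (Num.max r3 r4).
have r0 : 0 < r by rewrite !lt_max r10.
have rlt1 : r < 1 by rewrite !gt_max r11 r21 r31 r41.
have C0 : 0 <= C by rewrite !addr_ge0.
have up Ci ri t : 0 <= Ci <= C -> 0 < ri <= r -> Ci * ri ^+ t <= C * r ^+ t.
  move=> /andP[Ci0 CiC] /andP[ri0 rir]; rewrite ler_pM ?exprn_ge0 ?(ltW ri0)//.
  by rewrite lerXn2r ?nnegrE ?(ltW r0) ?(ltW ri0).
pose u t := C * (2 * x t ^+ 2 / c ^+ 2 + 2 / c).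
have su : subexp u.
  apply: subexpM; first exact: subexp_cst.
  apply: subexpD; last exact: subexp_cst.
  rewrite (_ : (fun t => _) = (fun t => 2 / c ^+ 2 * x t ^+ 2)).
    by apply: subexpM => //; exact: subexp_cst.
  by apply/funext => t; rewrite mulrAC.
have r01 : 0 < r < 1 by rewrite r0.
have [E hE] := subexp_geometric_sum su r01.
exists E => n th thP gmth thgp.
have -> : 2 * (Lhat th0 x v n - Lhat th x v n) = \sum_(1 <= t < n.+1)
   ((x t%:Z ^+ 2 / hhat th x v t + ln (hhat th x v t))
    - (x t%:Z ^+ 2 / hhat th0 x v t + ln (hhat th0 x v t))).
  by rewrite sumrB /Lhat; set S1 := \sum_(_ <= _ < _) _; set S2 := \sum_(_ <= _ < _) _; field.
rewrite lerBlDr -lerBlDl -sumrB; apply: le_trans (hE n).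
rewrite !big_nat; apply: ler_sum => t /andP[t1 _].
have Vt := avol_gvol th0P zr t%:Z.
have V0 := avol_gt0 th0P zr t%:Z.
have cV : c <= avol th0 z t%:Z by apply: le_trans ca _; exact: (avol_ge th0P zr).
have ch0 : c <= hhat th0 x v t by apply: le_trans ca _; exact: hhat_ge.
have cth : c <= hhat th x v t.
  by apply: le_trans cgm _; case: gmth => h _ _ _; apply: le_trans h _; exact: hhat_ge.
have cHm : c <= gvol m gm x t%:Z by apply: le_trans cgm _; exact: (gvol_ge xsub gm0 gml).
have cHp : c <= gvol m gp x t%:Z.
  by apply: le_trans cHm _; exact: (gvol_le xsub _ gm0 (gle_trans gmg ggp) gpl).
have A0 : 0 <= C * r ^+ t by rewrite mulr_ge0// exprn_ge0// ltW.
have := @qll_gap _ c (C * r ^+ t) (x t%:Z ^+ 2) (avol th0 z t%:Z) (hhat th x v t)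
  (hhat th0 x v t) (gvol m gp x t%:Z) (gvol m gm x t%:Z) c0 A0 (sqr_ge0 _) cV cth ch0 cHp cHm.
have xV : x t%:Z ^+ 2 / avol th0 z t%:Z = z t%:Z ^+ 2.
  by rewrite sqr_aret// mulrAC mulfV ?mul1r// gt_eqF.
rewrite xV -(sqr_aret th0P zr) -/x => gap.
have {gap} := gap _ _ _ _; rewrite /u.
have -> : C * r ^+ t * (2 * x t%:Z ^+ 2 / c ^+ 2 + 2 / c) =
  r ^+ t * (C * (2 * x t%:Z ^+ 2 / c ^+ 2 + 2 / c)) by ring.
move=> gap; rewrite lerBlDr -lerBlDl; apply: gap.
- apply: le_trans (h1 th thP thgp t) _; rewrite lerD2l up//.
    by rewrite C10/= /C; lra.
  by rewrite r10 !le_max lexx.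
- apply: le_trans (h2 th thP gmth t) _; rewrite lerD2l up//.
    by rewrite C20/= /C; lra.
  by rewrite r20 !le_max lexx orbT.
- rewrite Vt; apply: le_trans (h3 th0 th0P (gle_refl _) t) _; rewrite lerD2l up//.
    by rewrite C30/= /C; lra.
  by rewrite r30 !le_max lexx !orbT.
- rewrite Vt; apply: le_trans (h4 th0 th0P (gle_refl _) t) _; rewrite lerD2l up//.
    by rewrite C40/= /C; lra.
  by rewrite r40 !le_max lexx !orbT.
Qed.

(* For a small box around [th], the likelihood gap keeps a positive mean when the volatility
   is replaced by its values at the corners of the box; ergodicity then makes the
   summed gap grow linearly. *)
Lemma local_domination (th : param R p q) : param_space th ->
  ~ (\forall z \ae mu, gvol m (gparam_of th) (aret th0 z) 0 = avol th0 z 0) ->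
  exists2 e, 0 < e & \forall z \ae mu, exists N, forall n (th' : param R p q), (N <= n)%N ->
    param_space th' -> gle (gparam_of th') (gup e (gparam_of th)) ->
    gle (glo e (gparam_of th)) (gparam_of th') ->
    Lhat th' (aret th0 z) v n < Lhat th0 (aret th0 z) v n.
Proof.
move=> thP neq; have reg := ae_regular_path th0P iidmu Ez2 finmu.
have [a0 _ _ _ _] := thP; have [a00 _ _ _ _] := th0P.
set g := gparam_of th; have g0 : gnonneg g by exact: gparam_of_nonneg.
have [e1 [l [e10 e1l _]]] := gup_stable g0 (sum_bet_lt1 thP).
(* A common lower bound for all volatilities involved: the box radius is at most [alph th 0 / 2], so
   the lower corner keeps half the intercept. *)
pose c := Num.min (alph th 0 / 2) (alph th0 0).
have c0 : 0 < c by rewrite lt_min a00 andbT divr_gt0.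
have cle : c <= alph th0 0 by rewrite ge_min lexx orbT.
have cle' : c <= alph th 0 / 2 by rewrite ge_min lexx.
pose e0 := Num.min e1 (alph th 0 / 2).
have e00 : 0 < e0 by rewrite lt_min e10 divr_gt0.
pose e_ (n : nat) := e0 / n.+1%:R.
have e_gt0 n : 0 < e_ n by rewrite divr_gt0.
have e_ge0 n : 0 <= e_ n by exact: ltW.
have e_ni n : e_ n.+1 <= e_ n.
  by rewrite ler_wpM2l ?(ltW e00)// lef_pV2 ?posrE// ler_nat.
have e_le n : e_ n <= e0 by rewrite ler_pdivrMr// ler_peMr ?(ltW e00)// ler1n.
have e_cvg : e_ n @[n --> \oo] --> 0.
  rewrite -[X in _ --> X](mulr0 e0); apply: cvgMr; exact: cvg_harmonic.
have gl_ : gstable m (gup (e_ 0%N) g) l.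
  apply: gle_stable e1l; apply: gup_mono; apply: le_trans (e_le 0%N) _.
  by rewrite ge_min lexx.
have gl n : gstable m (gup (e_ n) g) l.
  apply: gle_stable e1l; apply: gup_mono; apply: le_trans (e_le n) _.
  by rewrite ge_min lexx.
have cglo n : c <= g_a (glo (e_ n) g).
  rewrite /= le_max; apply/orP; right; have := e_le n.
  have : e0 <= alph th 0 / 2 by rewrite ge_min lexx orbT.
  lra.
have gmg n : gle (glo (e_ n) g) g by exact: glo_le.
have ggp n : gle g (gup (e_ n) g) by exact: le_gup.
(* The maximum with [c] changes nothing on regular paths and makes the lower bounds hold on every
   path, as [llgap_mean] requires. *)
pose vv z := Num.max c (avol th0 z 0).
pose hh gg z := Num.max c (gvol m gg (aret th0 z) 0).
have mx t : measurable_fun setT ((aret th0)^~ t) by exact: measurable_aret.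
have mhh gg : measurable_fun setT (hh gg).
  by apply: measurable_maxr => //; exact: measurable_gvol.
have mvv : measurable_fun setT vv by apply: measurable_maxr => //; exact: measurable_avol.
have hhdep gg : depends_on [pred s | s < 0] (hh gg).
  by move=> z z' zz'; rewrite /hh (gvol_aret_dep th0P gg zz').
have vvdep : depends_on [pred s | s < 0] vv.
  by move=> z z' zz'; rewrite /vv (avol_dep th0P zz').
have hhc gg z : c <= hh gg z by rewrite /hh le_max lexx.
have vvE z t : regular_path th0 z -> vv (time_shift t z) = avol th0 z t.
  move=> zr; rewrite /vv avol_shift add0r max_r//.
  by apply: le_trans cle _; exact: (avol_ge th0P zr).
have hhE gg z t : regular_path th0 z -> gnonneg gg -> gstable m gg l -> c <= g_a gg ->
    hh gg (time_shift t z) = gvol m gg (aret th0 z) t.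
  move=> zr gg0 ggl ggc; have [_ _ _ xsub] := zr.
  rewrite /hh gvol_aret_shift add0r max_r//; apply: le_trans ggc _.
  exact: (gvol_ge xsub gg0 ggl).
have gup0 n : gnonneg (gup (e_ n) g) by exact: gup_nonneg.
have gupc n : c <= g_a (gup (e_ n) g).
  by case: (ggp n) => h _ _ _; apply: le_trans h; case: (gmg n) => h' _ _ _; apply: le_trans h'.
have glol n : gstable m (glo (e_ n) g) l by apply: gle_stable (gl n); exact: gle_trans (ggp n).
have gstab : gstable m g l by exact: gle_stable (ggp 0%N) (gl 0%N).
have gc : c <= g_a g by case: (gmg 0%N) => h _ _ _; apply: le_trans h.
have [dl /andP[dl0 _] dlI] := avol_moment th0P iidmu Ez2 finmu.
have vvI : (\int[mu]_z (vv z `^ dl)%:E < +oo)%E.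
  apply: le_lt_trans dlI; apply: ae_ge0_le_integral => //.
  - by move=> z _; rewrite lee_fin powR_ge0.
  - by apply/measurable_EFinP; exact: (measurableT_comp (measurable_powR _) mvv).
  - by move=> z _; rewrite lee_fin powR_ge0.
  - apply/measurable_EFinP; apply: (measurableT_comp (measurable_powR _)).
    exact: measurable_avol.
  apply: (ae_imply _ reg) => z zr _.
  by have := vvE z 0 zr; rewrite time_shift0 => ->.
have hpcv : \forall z \ae mu, hh (gup (e_ n) g) z @[n --> \oo] --> hh g z.
  apply: (ae_imply _ reg) => z zr; have [_ _ _ xsub] := zr.
  rewrite -(time_shift0 z) (hhE g)//.
  rewrite (_ : (fun n => _) = (fun n => gvol m (gup (e_ n) g) (aret th0 z) 0)).
    exact: gvol_gup_cvg xsub e_ge0 e_ni e_cvg g0 gl_ _.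
  by apply/funext => n; exact: hhE.
have hmcv : \forall z \ae mu, hh (glo (e_ n) g) z @[n --> \oo] --> hh g z.
  apply: (ae_imply _ reg) => z zr; have [_ _ _ xsub] := zr.
  rewrite -(time_shift0 z) (hhE g)//.
  rewrite (_ : (fun n => _) = (fun n => gvol m (glo (e_ n) g) (aret th0 z) 0)).
    exact: gvol_glo_cvg xsub e_ge0 e_ni e_cvg g0 gl_ _.
  by apply/funext => n; apply: hhE => //; exact: glo_nonneg.
have nev : ~ (\forall z \ae mu, hh g z = vv z).
  move=> h; apply: neq; move: reg h; apply: filterS2 => z zr e.
  have := vvE z 0 zr; rewrite time_shift0 => <-; rewrite -e.
  by have := hhE g z 0 zr g0 gstab gc; rewrite time_shift0.
have vvc z : c <= vv z by rewrite /vv le_max lexx.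
have [k [kint kpos]] := llgap_mean iidmu Ez2 c0 dl0 mvv (mhh g) (fun n => mhh _)
  (fun n => mhh _) vvc (hhc g) (fun n => hhc _) (fun n => hhc _) vvdep (hhdep g)
  vvI hpcv hmcv nev.
exists (e_ k); first exact: e_gt0.
set f := llgap _ _ _ k in kint kpos.
have Ifin : (\int[mu]_z (f z)%:E)%E \is a fin_num by exact: integrable_fin_num.
(* Subtracting half the mean keeps the mean positive and leaves a linear term [n * eta] to outweigh
   the bounded errors. *)
pose eta := fine (\int[mu]_z (f z)%:E)%E / 2.
have eta0 : 0 < eta by rewrite divr_gt0// fine_gt0// kpos -ge0_fin_numE// ltW.
have cint : mu.-integrable setT (EFin \o cst eta) by exact: finite_measure_integrable_cst.
have bint : mu.-integrable setT (EFin \o (fun z => f z - eta)).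
  rewrite (_ : _ \o _ = ((EFin \o f) \- (EFin \o cst eta))%E); first exact: integrableB.
  by apply/funext => z.
have bpos : (0 < \int[mu]_z (f z - eta)%:E)%E.
  have -> : (\int[mu]_z (f z - eta)%:E = \int[mu]_z ((f z)%:E - (cst eta z)%:E))%E by [].
  rewrite integralB_EFin// integral_prob_cst -(fineK Ifin) -EFinB lte_fin.
  by move: eta0; rewrite /eta; lra.
have := birkhoff_lower iidmu (oner_neq0 _ : (1 : int) != 0) bint bpos.
apply: filterS2 reg => z zr [B hB].
have [E hE] := pathwise_gap zr c0 cle (glo_nonneg (e_ k) g) (cglo k) (gmg k) (ggp k) (gl k).
have [N hN] : exists N : nat, B + f z - eta + E < N%:R * eta.
  exists (Num.truncn ((B + f z - eta + E) / eta)).+1.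
  by rewrite -ltr_pdivrMr// truncnS_gt.
exists N => n th' Nn th'P up lo.
rewrite -subr_gt0 -(pmulr_rgt0 _ (ltr0n R 2)).
apply: lt_le_trans (hE n th' th'P lo up).
(* The ergodic sum starts at time [0] and the likelihood at time [1]: one more term is taken, and
   [f z - eta] is accounted for in the threshold [N]. *)
rewrite subr_gt0; have := hB n.+1.
rewrite -(big_mkord xpredT (fun k => f (time_shift (1 * k%:Z) z) - eta)) big_nat_recl//=.
rewrite mulr0 time_shift0.
have -> : \sum_(0 <= i < n) (f (time_shift (1 * i.+1%:Z) z) - eta) =
   \sum_(1 <= i < n.+1) f (time_shift i%:Z z) - n%:R * eta.
  rewrite sumrB sumr_const_nat subn0 mulr_natl big_add1/=; congr (_ - _).
  by apply: eq_bigr => i _; rewrite mul1r.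
have fle : \sum_(1 <= i < n.+1) f (time_shift i%:Z z) <= \sum_(1 <= t < n.+1)
      (avol th0 z t%:Z * z t%:Z ^+ 2 / gvol m (gup (e_ k) g) (aret th0 z) t%:Z
       + ln (gvol m (glo (e_ k) g) (aret th0 z) t%:Z) - z t%:Z ^+ 2 - ln (avol th0 z t%:Z)).
  apply: ler_sum => t _; rewrite /f /llgap vvE// !hhE//; last exact: glo_nonneg.
  rewrite /time_shift add0r !lerD2r.
  by apply: lerD; rewrite ge_min lexx.
have Nn' : N%:R * eta <= n%:R * eta by rewrite ler_wpM2r ?(ltW eta0)// ler_nat.
by move: fle Nn' hN; set S1 := \sum_(_ <= _ < _) _; set S2 := \sum_(_ <= _ < _) _; lra.
Qed.

End local_domination.

(** * From local domination to convergence by compactness *)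

Section almost_surely_eventually.
Context d {T : measurableType d} {R : realType} (P : probability T R).

(* Compactness of the parameter set is applied along this filter, which makes the threshold
   for [n] uniform over the set while still depending on the sample point. *)
Definition ae_eventually : set_system (T * nat) :=
  [set E | \forall w \ae P, \forall n \near \oo, E (w, n)].

Lemma ae_eventually_filter : Filter ae_eventually.
Proof.
split.
- by apply: aeW => w; apply: nearW.
- by move=> A B; rewrite /ae_eventually /=; apply: filterS2 => w; exact: filterI.
- move=> A B AB; rewrite /ae_eventually /=.
  by apply: filterS => w; apply: filterS => n; exact: AB.
Qed.

End almost_surely_eventually.

Section compactness.
Context {R : realType} {p q : nat} d {T : measurableType d} (P : probability T R).
Variables (theta0 : param R p q) (K : set (param R p q)) (x : T -> int -> R) (v : 'I_q -> R)
  (thetahat : nat -> T -> param R p q).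
Hypotheses (cK : compact K) (K0 : K theta0) (KP : K `<=` param_space).
Hypothesis dom : forall th, K th -> th <> theta0 ->
  exists2 e, 0 < e & \forall w \ae P, exists N, forall n (th' : param R p q), (N <= n)%N ->
    param_space th' -> gle (gparam_of th') (gup e (gparam_of th)) ->
    gle (glo e (gparam_of th)) (gparam_of th') ->
    Lhat th' (x w) v n < Lhat theta0 (x w) v n.
Hypothesis hatP : forall n w, K (thetahat n w) /\
  forall th, K th -> Lhat th (x w) v n <= Lhat (thetahat n w) (x w) v n.

Lemma maximizer_near (e : R) : 0 < e ->
  \forall w \ae P, \forall n \near \oo, ball theta0 e (thetahat n w).
Proof.
move=> e0; pose B := (ball theta0 e)°.
have cKB : compact (K `&` ~` B).
  by apply: compact_closedI => //; apply: open_closedC; exact: open_interior.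
have B0 : B theta0 by exact: nbhsx_ballx.
have F := ae_eventually_filter P.
have cov : ae_eventually P (fun wn => (K `&` ~` B) `<=`
    (fun th => param_space th -> Lhat th (x wn.1) v wn.2 < Lhat theta0 (x wn.1) v wn.2)).
  move/compact_near_coveringP : cKB => /(_ (T * nat)%type (ae_eventually P)
    (fun wn th => param_space th -> Lhat th (x wn.1) v wn.2 < Lhat theta0 (x wn.1) v wn.2) F).
  apply => th [Kth nBth].
  have [|e1 e10 h] := dom Kth; first by move=> E; apply: nBth; rewrite E.
  exists ([set th' | param_space th' -> gle (gparam_of th') (gup e1 (gparam_of th)) /\
            gle (glo e1 (gparam_of th)) (gparam_of th')],
          [set wn : T * nat | forall th' : param R p q, param_space th' ->
            gle (gparam_of th') (gup e1 (gparam_of th)) ->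
            gle (glo e1 (gparam_of th)) (gparam_of th') ->
            Lhat th' (x wn.1) v wn.2 < Lhat theta0 (x wn.1) v wn.2]).
    split => /=; first by apply: gparam_of_nbhs => //; exact: KP.
    move: h; apply: filterS => w [N hN]; exists N => // n /= Nn th' th'P; exact: hN.
  move=> [th' [w n]] /= [h1 h2] th'P; have [u1 u2] := h1 th'P; exact: h2.
have {}cov : \forall w \ae P, \forall n \near \oo, (K `&` ~` B) `<=`
    (fun th => param_space th -> Lhat th (x w) v n < Lhat theta0 (x w) v n) by exact: cov.
move: cov; apply: filterS => w; apply: filterS => n hn.
have [Kh maxh] := hatP n w.
apply: interior_subset; apply: contrapT => nB.
have := hn _ (conj Kh nB) (KP Kh); rewrite ltNge => /negP; apply.
exact: maxh.
Qed.

Lemma maximizer_cvg : \forall w \ae P, thetahat ^~ w @ \oo --> theta0.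
Proof.
have h (k : nat) : \forall w \ae P, \forall n \near \oo,
    ball theta0 (k.+1%:R^-1) (thetahat n w).
  by apply: maximizer_near; rewrite invr_gt0 ltr0n.
have := ae_foralln h; apply: filterS => w hw; apply/cvg_ballP => e e0.
have [k ke] : exists k : nat, k.+1%:R^-1 <= e.
  exists (Num.truncn e^-1); rewrite invf_ple ?posrE//.
  exact/ltW/truncnS_gt.
by move: (hw k); apply: filterS => n; exact: le_ball.
Qed.

End compactness.

Unset Implicit Arguments.
Theorem theorem5p5 (R : realType) (d : measure_display) (T : measurableType d)
    (P : probability T R) (p q : nat) (Z X S : int -> T -> R)
    (theta0 : param R p q) (K : set (param R p q)) (v : 'I_q -> R)
    (thetahat : nat -> T -> param R p q) :
  (* (Z_t) i.i.d., E Z_0 = 0, E Z_0^2 = 1 *)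
  iid_seq P Z ->
  P.-integrable setT (EFin \o Z 0) ->
  (\int[P]_w (Z 0 w)%:E = 0)%E ->
  (\int[P]_w ((Z 0 w) ^+ 2)%:E = 1)%E ->
  (* the distribution of Z_0 is not concentrated at two points *)
  (forall a b : R, P (Z 0 @^-1` [set a; b]) != 1%E) ->
  (* ((X_t, sigma_t)) is the strictly stationary AGARCH(p,q) process *)
  agarch_solution P theta0 Z X S ->
  strictly_stationary2 P X S ->
  (* condition 1 *)
  (exists i, (1 <= i <= p)%N /\ 0 < alph theta0 i) ->
  (alph theta0 p, bet theta0 q) != (0, 0) ->
  (* condition 2: a and b have no common (complex) zeros *)
  (forall z : R[i], ~ (root (map_poly (real_complex R) (apoly theta0)) z /\
                       root (map_poly (real_complex R) (bpoly theta0)) z)) ->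
  (* compact parameter set *)
  compact K -> K `<=` param_space -> K theta0 ->
  (* fixed nonnegative initial values hhat_0, ..., hhat_{-q+1} *)
  (forall j, 0 <= v j) ->
  (* thetahat_n is a QMLE: a maximizer of Lhat_n over K *)
  (forall n w, K (thetahat n w) /\
     forall th, K th -> Lhat th (X ^~ w) v n <= Lhat (thetahat n w) (X ^~ w) v n) ->
  (* strong consistency *)
  \forall w \ae P, thetahat ^~ w @ \oo --> theta0.
Proof.
move=> iidZ IZ EZ EZ2 nZ sol stat exa ab coprime cK KP K0 v0 hat.
have th0P := KP _ K0; have [a0 _ _ _ _] := th0P.
pose m := (p + q).+1.
pose cf := acoef theta0.
have S_ge0 t w : 0 <= S t w by case: (sol t).
have mS t : measurable_fun setT (S t).
  move=> _ B mB; rewrite setTI; case: (sol t) => _ /(_ B mB) h _ _.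
  apply: (smallest_sub _ _ h); first exact: sigma_algebra_measurable.
  move=> A [k [_ [C [mC ->]]]]; rewrite -[X in measurable X]setTI.
  by case: iidZ => mZ _ _; exact: mZ.
pose S2 t w := S t w ^+ 2.
have mS2 t : measurable_fun setT (S2 t) by exact: measurable_funX.
have S2_ge0 t w : 0 <= S2 t w by exact: sqr_ge0.
have S2_law t M : P [set w | M < S2 t w] = P [set w | M < S2 0 w].
  pose B : set R := [set s | M < s ^+ 2].
  have mB : measurable B.
    have mf : measurable_fun setT (fun s : R => s ^+ 2) by exact: measurable_funX.
    have := mf measurableT _ (measurable_itv `]M, +oo[).
    rewrite setTI; congr measurable; apply/seteqP; split => s /=; by rewrite in_itv/= andbT.
  (* A single time with [X] unconstrained gives the marginal law of [S]. *)
  have := stat t 1%N (fun=> 0) (fun=> setT) (fun=> B) (fun=> conj measurableT mB).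
  have E (s : int) : \bigcap_(k in `I_1) (X s @^-1` setT `&` S s @^-1` B) = [set w | M < S2 s w].
    apply/seteqP; split => [w /(_ 0%N erefl)[_]//|w h k _]; by split.
  by rewrite !E add0r.
have XE : \forall w \ae P, forall t, X t w = S t w * Z t w.
  by apply: ae_forall_int => t; case: (sol t).
(* Since [S] is nonnegative, its square factors out of the asymmetric term, and both sums merge into
   one linear recursion whose coefficients are functions of the innovations. *)
have S2_eq t : \forall w \ae P, S2 t w =
    alph theta0 0 + \sum_(1 <= i < m.+1) cf i (Z (t - i%:Z) w) * S2 (t - i%:Z) w.
  case: (sol t) => _ _ _ h; move: h XE; apply: filterS2 => w h Xw.
  rewrite /S2 h -addrA; congr (_ + _).
  under eq_bigr do rewrite Xw.
  have widen (f : nat -> R) n : (n <= m)%N ->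
      \sum_(1 <= i < n.+1) f i = \sum_(1 <= i < m.+1) (if (1 <= i <= n)%N then f i else 0).
    move=> nm; rewrite [RHS](@big_cat_nat _ _ _ n.+1)//=.
    rewrite [X in _ = _ + X](_ : _ = 0) ?addr0.
      by rewrite !big_nat; apply: eq_bigr => i /andP[i1]; rewrite ltnS => ->; rewrite i1.
    by rewrite big_nat big1// => i /andP[ni _]; rewrite (leqNgt i) ni andbF.
  rewrite (widen _ p) ?(leq_trans (leq_addr q p))//.
  rewrite (widen _ q) ?(leq_trans (leq_addl p q))//.
  rewrite -big_split/=; apply: eq_bigr => i _; rewrite /cf /acoef mulrDl.
  congr (_ + _); last by rewrite /bet; case: (0 < i <= q)%N; rewrite ?mul0r.
  case: ifP => _; rewrite ?mul0r//.
  by rewrite normrM (ger0_norm (S_ge0 _ _)); ring.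
have m0 : (0 < m)%N by [].
have cf_ge0 : forall i x, 0 <= cf i x by exact: acoef_ge0.
have cfm : forall i x, (m < i)%N -> cf i x = 0 by exact: acoef_out.
have mcf : forall i, measurable_fun setT (cf i) by exact: measurable_acoef.
pose mu := path_law iidZ.
have iidmu : iid_seq mu (fun t z => z t) by exact: iid_path_law.
have finmu : \forall z \ae mu, rvol_finite m (alph theta0 0) cf z.
  exact: (ae_rvol_finite iidZ cf_ge0 mcf S2_ge0 S2_eq).
have S2E : \forall w \ae P, forall t, S2 t w = avol theta0 (path_of Z w) t.
  apply: ae_forall_int => t.
  exact: (stationary_solution_rvol iidZ m0 a0 cf_ge0 cfm mcf mS2 S2_ge0 S2_law S2_eq t).
have XaE : \forall w \ae P, X ^~ w = aret theta0 (path_of Z w).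
  move: XE S2E; apply: filterS2 => w Xw Sw; apply/funext => t.
  by rewrite Xw /aret -Sw /S2 sqrtr_sqr ger0_norm.
have mz : measurable_fun setT (fun z : paths R => (z 0)%:E).
  by apply/measurable_EFinP; exact: measurable_coord.
have Ez : (\int[mu]_z (z 0)%:E = 0)%E by rewrite /mu integral_distribution.
have Iz : mu.-integrable setT (fun z : paths R => (z 0)%:E).
  exact: (integrable_pushforward (measurable_path_of iidZ) mz IZ).
have Ez2 : (\int[mu]_z ((z 0) ^+ 2)%:E = 1)%E.
  rewrite /mu integral_path_of// => [|z]; last by rewrite lee_fin sqr_ge0.
  by apply/measurable_EFinP; apply: measurable_funX; exact: measurable_coord.
have nz (a b : R) : mu [set z | [set a; b] (z 0)] != 1%E by exact: nZ.
have reg := ae_regular_path th0P iidmu Ez2 finmu.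
apply: (@filterS _ _ _ _ _ _ (maximizer_cvg (x := fun w => X ^~ w) cK K0 KP _ hat)) => //.
move=> th Kth neq.
have [|e e0 h] := @local_domination _ _ _ _ th0P mu iidmu Ez2 finmu v v0 th (KP _ Kth).
  by move=> HV; apply: neq; exact: (identifiable th0P iidmu Iz Ez nz reg (KP _ Kth) exa ab coprime HV).
exists e => //; move: XaE (ae_path_of h); apply: filterS2 => w -> [N hN].
by exists N => n th'; exact: hN.
Qed.
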